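(* Let $\mathbb{F}_q$ be a finite field with $q$ elements and let $X^3\subset\mathbb{P}^{4}$ be a nonsingular hypersurface of degree $d\geq 2$ defined over $\mathbb{F}_q$. Then $$N_q(X^3)\leq\theta_3^{d,q}:=(d-1)q^{2}(q+1)+(q+1).$$ Moreover, equality $N_q(X^3)=\theta_3^{d,q}$ holds only if there exists an $\mathbb{F}_q$-point $P\in X^3$ such that $X^3\cap T_PX^3$ is a cone $P*Y$ with vertex $P$ over a nonsingular curve $Y\subset\mathbb{P}^{2}$ such that $N_q(Y)=(d-1)q+1$.
   Context: For an algebraic set $W\subseteq\mathbb{P}^N$ defined by homogeneous polynomials over $\mathbb{F}_q$, $N_q(W)$ denotes the number of $\mathbb{F}_q$-points of $W$. A hypersurface $X^n\subset\mathbb{P}^{n+1}$ of degree $d$ (and dimension $n$) defined over $\mathbb{F}_q$ is the zero locus $V(F)$ of a nonzero homogeneous polynomial $F\in\mathbb{F}_q[x_0,\dots,x_{n+1}]$ of degree $d$. Nonsingularity is always understood over the algebraic closure $\overline{\mathbb{F}}_q$: $F$ and all its first partial derivatives have no common zero in $\mathbb{P}^{n+1}(\overline{\mathbb{F}}_q)$. For $P\in X^n(\mathbb{F}_q)$, $T_PX^n\cong\mathbb{P}^n$ is the (projective) tangent hyperplane to $X^n$ at $P$, and $X^n\cap T_PX^n$ is the hypersurface of $T_PX^n$ defined by the restriction of $F$. It is a cone $P*Y$ with vertex $P$ over $Y$ when, for a hyperplane $\mathbb{P}^{n-1}$ of $T_PX^n$ not containing $P$ and the hypersurface $Y\subset\mathbb{P}^{n-1}$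 cut out there by $F$, the intersection is the union of the lines joining $P$ to points of $Y$. In coordinates with $P=(1:0:\dots:0)$ and $T_PX^n=V(x_{n+1})$, this means that $F|_{x_{n+1}=0}=H(x_1,\dots,x_n)$ does not involve $x_0$, and $Y=V(x_0,x_{n+1},H)$, of degree $d$. Here $n=3$. *)

(* Defs.v *)
From HB Require Import structures.
From mathcomp Require Import all_boot all_order all_algebra all_field.
From mathcomp Require Import mpoly.

Set Implicit Arguments.
Unset Strict Implicit.
Unset Printing Implicit Defensive.

Import GRing.Theory.
Local Open Scope ring_scope.

(* A point of P^(n-1) over a field is given by a nonzero row vector with n
   homogeneous coordinates; over a finite field, the point itself is the class
   of that vector under scaling by nonzero constants. *)
Definition proj_point (F : finFieldType) (n : nat) (v : 'rV[F]_n) :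
    {set 'rV[F]_n} :=
  [set a *: v | a : F & a != 0].

(* N_q(V(f)) for f homogeneous. *)
Definition num_points (F : finFieldType) (n : nat) (f : {mpoly F[n]}) : nat :=
  #|[set proj_point v | v : 'rV[F]_n & (v != 0) && (f.@[v 0] == 0)]|.

Definition hypersurface (F : fieldType) (n d : nat) (f : {mpoly F[n]}) : Prop :=
  f != 0 /\ f \is d.-homog.

Definition algebraic_closure (F : fieldType) (K : closedFieldType)
    (iota : {rmorphism F -> K}) : Prop :=
  integralRange iota.

(* The vanishing of f itself is not redundant: the characteristic may divide
   its degree. *)
Definition nonsingular (F : fieldType) (K : closedFieldType)
    (iota : {rmorphism F -> K}) (n : nat) (f : {mpoly F[n]}) : Prop :=
  ~ exists v : 'rV[K]_n,
      [/\ v != 0,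
          (map_mpoly iota f).@[v 0] = 0
        & forall i : 'I_n, (map_mpoly iota f^`M(i)).@[v 0] = 0].

(* The row space of this matrix is the linear space underlying T_P V(f),
   namely the w with \sum_j (df/dx_j)(P) w_j = 0. *)
Definition tangent_space (F : fieldType) (n : nat) (f : {mpoly F[n]})
    (P : 'rV[F]_n) : 'M[F]_n :=
  kermx (\col_j (f^`M(j)).@[P 0]).

(* Equation of V(f) on the linear subspace spanned by the rows of A, in the
   coordinates x_0, ..., x_(m-1) relative to these rows: f(\sum_i x_i A_i). *)
Definition restrict (F : fieldType) (m n : nat) (A : 'M[F]_(m, n))
    (f : {mpoly F[n]}) : {mpoly F[m]} :=
  f \mPo [tuple \sum_(i < m) A i j *: 'X_i | j < n].

(* The section of V(f) by T_P V(f) is the cone P * Y, where Y is cut out by f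
   on the hyperplane of T_P V(f) spanned by the rows of U, and has equation
   H = restrict U f there. The rows of P and U form a basis of the tangent
   space; in the corresponding coordinates (x_0, x_1, ..., x_m), P is
   (1 : 0 : ... : 0) and f restricts to H(x_1, ..., x_m). *)
Definition tangent_section_cone (F : fieldType) (m n : nat) (f : {mpoly F[n]})
    (P : 'rV[F]_n) (U : 'M[F]_(m, n)) : Prop :=
  [/\ row_free (col_mx P U),
      (col_mx P U == tangent_space f P)%MS
    & restrict (col_mx P U) f
        = restrict U f \mPo [tuple 'X_(rshift 1 i) | i < m]].

(* Main.v *)
(* Let e = d - 1 and suppose first that e < q and that N_q(X) reaches the bound.  If no line of
   X passes through some rational point P, every line through P meets X in at most e further
   points, and in at most e - 1 if it is tangent at P, which is too few; so X contains a line L.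
   X contains no plane, so on a plane through L it is L together with a curve of degree e, which
   has at most e q rational points off L, and equality forces e concurrent lines: call such a
   plane full and the point of concurrency, which lies on L, its center.  The number of points
   of X forces many full planes, hence two with the same center.  The derivative of f along L,
   in a direction pointing into a full plane, is a multiple of the e-th power of the linear form
   vanishing at the center; so these two derivatives are proportional and some plane through L
   is tangent to X along L.  It is not full, which improves the estimate: for e > 1 it shows
   that three distinct centers occur, and the linear relation between the derivatives in four
   directions then makes x^e additive on F_q, so that e is a power of the characteristic and
   2 e <= q.  With this, two points P, Q of L are each the center of more than e full planes, and
   T_P X and T_Q X meet X in cones with vertices P and Q (for e = 1 this is automatic).  The
   plane spanned by L and a common vector of T_P X and T_Q X meets X only in L, which gives the
   bound; equality means that all other planes through L are full, and counting on T_P X gives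
   N_q(Y).

   If e > q, the bound exceeds the number of points of P^4.  If e = q > 2, sums over F_q^3 of
   polynomials of degree less than 3 (q - 1) vanish, so that the rational points off X cannot be
   too few.  If e = q = 2, the same argument shows that the set of points off X has sum zero; if
   it has the minimal cardinality 4, it is invariant under the translation by some vector P, and
   X meets T_P X in a cone with vertex P. *)
Require Import Defs.
From HB Require Import structures.
From mathcomp Require Import all_boot all_order all_algebra all_fingroup all_solvable all_field.
From mathcomp Require Import mpoly zify ring.

Set Implicit Arguments.
Unset Strict Implicit.
Unset Printing Implicit Defensive.

Import GRing.Theory.
Local Open Scope ring_scope.

(** * Homogeneous polynomials: induction, restriction to lines, directional derivatives *)

Section Homogeneous.
Variable R : comNzRingType.

(** A form is a combination of monomials of one degree, and each monomial arises from 1 by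
    multiplying by one variable at a time. A property that passes to linear combinations is
    therefore checked on these multiplications. *)
Lemma homog_ind n (Q : nat -> {mpoly R[n]} -> Prop) :
    (forall d, Q d 0) ->
    (forall d c p r, Q d p -> Q d r -> Q d (c *: p + r)) ->
    Q 0 1 ->
    (forall d i p, p \is d.-homog -> Q d p -> Q d.+1 ('X_i * p)) ->
  forall d p, p \is d.-homog -> Q d p.
Proof.
move=> Q0 Qlin Q1 QX.
have Qmon : forall d m, mdeg m = d -> Q d 'X_[m].
  elim=> [|d IH] m hm.
    by move/eqP: hm; rewrite mdeg_eq0 => /eqP ->; rewrite mpolyX0.
  have [i hi] : exists i, m i != 0%N.
    apply/existsP; apply: contraT; rewrite negb_exists => /forallP h.
    have : mdeg m = 0%N.
      by rewrite mdegE big1 // => i _; apply/eqP; have := h i; rewrite negbK.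
    by rewrite hm.
  have le_m : (U_(i) <= m)%MM by rewrite lep1mP.
  rewrite -(submK le_m) addmC mpolyXD.
  have hd : mdeg (m - U_(i))%MM = d.
    have := congr1 (@mdeg _) (submK le_m).
    by rewrite mdegD mdeg1 hm addn1 => - [].
  by apply: QX; [rewrite dhomogX /= hd | apply: IH].
move=> d p hp; rewrite [p]mpolyE.
have : {in msupp p, forall m, mdeg m = d} by move/dhomogP: hp.
elim: (msupp p) => [|m s IH] hs; first by rewrite big_nil.
rewrite big_cons; apply: Qlin; first by apply/Qmon/hs; rewrite mem_head.
by apply: IH => m' hm'; apply: hs; rewrite in_cons hm' orbT.
Qed.

(* The restriction of [p] to the parametrised line t |-> z + t y. *)
Definition line_poly n (p : {mpoly R[n]}) (z y : 'rV[R]_n) : {poly R} :=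
  mmap polyC (fun i => (z 0 i)%:P + (y 0 i)%:P * 'X) p.

Definition dirder n (y : 'rV[R]_n) (p : {mpoly R[n]}) : {mpoly R[n]} :=
  \sum_i y 0 i *: p^`M(i).

Section Fixn.
Variable n : nat.
Implicit Types (p r : {mpoly R[n]}) (z y v : 'rV[R]_n).

Lemma line_polyD p r z y : line_poly (p + r) z y = line_poly p z y + line_poly r z y.
Proof. exact: mmapD. Qed.

Lemma line_polyZ c p z y : line_poly (c *: p) z y = c *: line_poly p z y.
Proof. by rewrite /line_poly mmapZ mul_polyC. Qed.

Lemma line_polyXM i p z y :
  line_poly ('X_i * p) z y = ((z 0 i)%:P + (y 0 i)%:P * 'X) * line_poly p z y.
Proof. by rewrite /line_poly rmorphM /= mmapX mmap1U. Qed.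

Lemma line_poly1 z y : line_poly 1 z y = 1.
Proof. exact: rmorph1. Qed.

Lemma line_poly0 z y : line_poly 0 z y = 0.
Proof. exact: rmorph0. Qed.

(** Decomposition into homogeneous components reduces this to [homog_ind]. *)
Lemma meval_ind (Q : {mpoly R[n]} -> Prop) :
  Q 0 -> (forall c p r, Q p -> Q r -> Q (c *: p + r)) -> Q 1 ->
  (forall i p, Q p -> Q ('X_i * p)) -> forall p, Q p.
Proof.
move=> Q0 Ql Q1 QX p.
have H : forall d r, r \is d.-homog -> Q r.
  by apply: (@homog_ind n (fun _ => Q)) => // d i r _; exact: QX.
rewrite (@pihomog_partitionE _ _ mdeg _ _ (leqnn (msize p))).
elim/big_ind: _ => // [a b Qa Qb|i _]; first by rewrite -[a]scale1r; apply: Ql.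
exact/H/pihomogP.
Qed.

Lemma line_polyE p z y t : (line_poly p z y).[t] = p.@[(z + t *: y) 0].
Proof.
elim/meval_ind: p => [|c p r hp hr||i p hp].
- by rewrite line_poly0 horner0 meval0.
- by rewrite line_polyD line_polyZ hornerD hornerZ hp hr mevalD mevalZ.
- by rewrite line_poly1 hornerC meval1.
- rewrite line_polyXM hornerM hp mevalM mevalXU !mxE hornerD hornerM !hornerC.
  by rewrite hornerX [t * _]mulrC.
Qed.

Lemma dirderD v p r : dirder v (p + r) = dirder v p + dirder v r.
Proof.
by rewrite /dirder -big_split; apply: eq_bigr => i _; rewrite mderivD scalerDr.
Qed.

Lemma dirderZ v c p : dirder v (c *: p) = c *: dirder v p.
Proof.
rewrite /dirder scaler_sumr; apply: eq_bigr => i _.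
by rewrite mderivZ !scalerA mulrC.
Qed.

Lemma dirder0 v : dirder v 0 = 0.
Proof. by rewrite /dirder big1 // => i _; rewrite mderiv0 scaler0. Qed.

Lemma dirder1 v : dirder v 1 = 0.
Proof. by rewrite /dirder big1 // => i _; rewrite -mpolyC1 mderivC scaler0. Qed.

Lemma dirderXM v i p : dirder v ('X_i * p) = v 0 i *: p + 'X_i * dirder v p.
Proof.
rewrite /dirder mulr_sumr.
under eq_bigr do rewrite mderivM scalerDr (scalerAr _ 'X_i).
rewrite big_split /=; congr (_ + _).
rewrite (bigD1 i) //= big1 ?addr0 => [|j hj]; last first.
  by rewrite mderivX mnm1E eq_sym (negbTE hj) scale0r mul0r scaler0.
rewrite mderivX mnm1E eqxx scale1r.
suff -> : (U_(i) - U_(i) = 0)%MM by rewrite mpolyX0 mul1r.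
by apply/mnmP => k; rewrite mnmBE subnn mnm0E.
Qed.

Lemma dirder_linl p x (c : R) v w :
  (dirder (c *: v + w) p).@[x] = c * (dirder v p).@[x] + (dirder w p).@[x].
Proof.
rewrite -mevalZ -mevalD; congr (_.@[_]).
rewrite /dirder scaler_sumr -big_split; apply: eq_bigr => i _.
by rewrite !mxE scalerDl scalerA.
Qed.

Lemma dirderE p x v : (dirder v p).@[x] = \sum_i v 0 i * p^`M(i).@[x].
Proof. by rewrite /dirder raddf_sum /=; apply: eq_bigr => i _; rewrite mevalZ. Qed.

Lemma dhomog_dirder d p v : p \is d.-homog -> dirder v p \is d.-1.-homog.
Proof.
move=> hp; rewrite /dirder; apply: rpred_sum => i _; apply: dhomogZ.
apply/dhomogP => m; rewrite mcoeff_msupp mcoeff_mderiv => hm.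
have : (m + U_(i))%MM \in msupp p.
  by rewrite mcoeff_msupp; apply: contra hm => /eqP ->; rewrite mul0rn.
by move/(dhomog_mf hp) => /=; rewrite mdegD mdeg1 addn1 => <-.
Qed.

Lemma coef_linXM (a b : R) (q : {poly R}) k :
  ((a%:P + b%:P * 'X) * q)`_k = a * q`_k + b * (if k is j.+1 then q`_j else 0).
Proof.
rewrite mulrDl coefD coefCM -mulrA coefCM coefXM; case: k => //=.
Qed.

Lemma coef1_line_poly p z y : (line_poly p z y)`_1 = (dirder y p).@[z 0].
Proof.
elim/meval_ind: p => [|c p r hp hr||i p hp].
- by rewrite line_poly0 dirder0 coef0 meval0.
- by rewrite line_polyD line_polyZ coefD coefZ hp hr dirderD dirderZ mevalD mevalZ.
- by rewrite line_poly1 coefC /= dirder1 meval0.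
- rewrite line_polyXM coef_linXM hp dirderXM mevalD mevalZ mevalM mevalXU.
  by rewrite addrC -horner_coef0 line_polyE scale0r addr0.
Qed.

Lemma coef0_line_poly p z y : (line_poly p z y)`_0 = p.@[z 0].
Proof. by rewrite -horner_coef0 line_polyE scale0r addr0. Qed.

Lemma size_line_poly d p z y : p \is d.-homog -> (size (line_poly p z y) <= d.+1)%N.
Proof.
move: d p; apply: homog_ind => [d|d c p r hp hr||d i p _ hp].
- by rewrite line_poly0 size_poly0.
- rewrite line_polyD line_polyZ (leq_trans (size_polyD _ _)) // geq_max hr andbT.
  exact: leq_trans (size_scale_leq _ _) hp.
- by rewrite line_poly1 size_poly1.
- apply/leq_sizeP => j hj; rewrite line_polyXM coef_linXM.
  case: j hj => [//|j] hj; move/leq_sizeP: hp => hp.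
  by rewrite !hp ?mulr0 ?addr0 // ltnW.
Qed.

(** The substitution t -> 1/t, followed by multiplication by t^d, exchanges p(z + t y) and p(y + t
    z). *)
Lemma coef_line_poly_rev d p z y k : p \is d.-homog -> (k <= d)%N ->
  (line_poly p z y)`_k = (line_poly p y z)`_(d - k).
Proof.
move=> hp; move: d p hp k.
apply: homog_ind => [d|d c p r hp hr||d i p hom hp] k hk.
- by rewrite !line_poly0 !coef0.
- by rewrite !line_polyD !line_polyZ !coefD !coefZ hp // hr.
- by rewrite !line_poly1 !coefC subn_eq0; case: k hk.
- have szL u v : (line_poly p u v)`_d.+1 = 0.
    by have /leq_sizeP -> := @size_line_poly d p u v hom.
  rewrite !line_polyXM !coef_linXM; case: k hk => [_|k].
    by rewrite subn0 szL !mulr0 addr0 add0r hp // subn0.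
  rewrite ltnS leq_eqVlt => /orP[/eqP ->|hk].
    by rewrite subnn szL !mulr0 add0r addr0 hp // subnn.
  by rewrite (hp k.+1) // (hp k) ?(ltnW hk) // subSS -(subnSK hk) addrC.
Qed.

Lemma lead_line_poly d p z y : p \is d.-homog -> (line_poly p z y)`_d = p.@[y 0].
Proof. by move=> hp; rewrite (coef_line_poly_rev _ _ hp) // subnn coef0_line_poly. Qed.

(** Together with the leading coefficient this expresses contact at the point [y] at infinity of the
    line: the degree drops by at least one if [y] is a zero, and by at least two if the line is
    moreover tangent there. *)
Lemma sublead_line_poly d p z y : p \is d.-homog -> (0 < d)%N ->
  (line_poly p z y)`_d.-1 = (dirder z p).@[y 0].
Proof.
case: d => // d hp _.
by rewrite (coef_line_poly_rev _ _ hp) //= subSn // subnn coef1_line_poly.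
Qed.

Lemma meval_homogZ d p (c : R) z : p \is d.-homog ->
  p.@[(c *: z) 0] = c ^+ d * p.@[z 0].
Proof.
move: d p; apply: homog_ind => [d|d a p r hp hr||d i p _ hp].
- by rewrite !meval0 mulr0.
- by rewrite !mevalD !mevalZ hp hr mulrDr mulrCA.
- by rewrite !meval1 mulr1.
- by rewrite !mevalM !mevalXU hp mxE exprS mulrACA.
Qed.

Lemma meval_homog0 d p : p \is d.-homog -> (0 < d)%N -> p.@[(0 : 'rV[R]_n) 0] = 0.
Proof.
move=> hp d0; rewrite -[0](scale0r (0 : 'rV[R]_n)) (meval_homogZ _ _ hp).
by rewrite expr0n; case: d d0 {hp} => // d _; rewrite mul0r.
Qed.

Lemma euler_homog d p z : p \is d.-homog -> (dirder z p).@[z 0] = d%:R * p.@[z 0].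
Proof.
move: d p; apply: homog_ind => [d|d a p r hp hr||d i p _ hp].
- by rewrite dirder0 !meval0 mulr0.
- by rewrite dirderD dirderZ !mevalD !mevalZ hp hr mulrDr mulrCA.
- by rewrite dirder1 meval0 mul0r.
- rewrite dirderXM mevalD mevalZ !mevalM !mevalXU hp mulrCA -[d.+1]addn1 natrD.
  by rewrite mulrDl mul1r addrC.
Qed.

End Fixn.

Lemma meval_comp_linear m n (A : 'M[R]_(m, n)) (p : {mpoly R[n]}) (v : 'I_m -> R) :
  (p \mPo [tuple \sum_(i < m) A i j *: 'X_i | j < n]).@[v] =
  p.@[fun j => \sum_i A i j * v i].
Proof.
rewrite comp_mpoly_meval; apply: meval_eq => j; rewrite tnth_mktuple.
by rewrite raddf_sum /=; apply: eq_bigr => i _; rewrite mevalZ mevalXU.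
Qed.

End Homogeneous.

(** * Restriction to linear subspaces *)

Lemma meval_restrict (F : fieldType) m n (A : 'M[F]_(m, n)) (p : {mpoly F[n]}) (v : 'rV[F]_m) :
  (restrict A p).@[v 0] = p.@[(v *m A) 0].
Proof.
rewrite /restrict meval_comp_linear; apply: meval_eq => j; rewrite mxE.
by apply: eq_bigr => i _; rewrite mulrC.
Qed.

Lemma restrict_is_linear (F : fieldType) m n (A : 'M[F]_(m, n)) (c : F) p r :
  restrict A (c *: p + r) = c *: restrict A p + restrict A r.
Proof. by rewrite /restrict comp_mpolyD comp_mpolyZ. Qed.

Lemma restrictXM (F : fieldType) m n (A : 'M[F]_(m, n)) j p :
  restrict A ('X_j * p) = (\sum_(i < m) A i j *: 'X_i) * restrict A p.
Proof.
by rewrite /restrict rmorphM /= /comp_mpoly mmapX mmap1U tnth_mktuple.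
Qed.

Lemma line_poly_restrict (F : fieldType) m n (A : 'M[F]_(m, n)) (p : {mpoly F[n]}) (z y : 'rV[F]_m) :
  line_poly (restrict A p) z y = line_poly p (z *m A) (y *m A).
Proof.
elim/meval_ind: p => [|c p r hp hr||j p hp].
- by rewrite /restrict comp_mpoly0 !line_poly0.
- by rewrite restrict_is_linear !line_polyD !line_polyZ hp hr.
- by rewrite /restrict comp_mpoly1 !line_poly1.
- rewrite restrictXM line_polyXM -hp /line_poly rmorphM; congr (_ * _).
  rewrite raddf_sum /= !mxE !rmorph_sum /= mulr_suml -big_split /=.
  apply: eq_bigr => i _; rewrite mmapZ mmapX mmap1U !polyCM mulrDr mulrA.
  by rewrite ![_ * (A i j)%:P]mulrC.
Qed.

Lemma dirder_restrict (F : fieldType) m n (A : 'M[F]_(m, n)) (p : {mpoly F[n]}) (z y : 'rV[F]_m) :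
  (dirder y (restrict A p)).@[z 0] = (dirder (y *m A) p).@[(z *m A) 0].
Proof. by rewrite -!coef1_line_poly line_poly_restrict. Qed.

Lemma dhomog_restrict (F : fieldType) m n (A : 'M[F]_(m, n)) d (p : {mpoly F[n]}) :
  p \is d.-homog -> restrict A p \is d.-homog.
Proof.
move: d p; apply: homog_ind => [d|d c p r hp hr||d j p _ hp].
- by rewrite /restrict comp_mpoly0 dhomog0.
- by rewrite restrict_is_linear dhomogD // dhomogZ.
- by rewrite /restrict comp_mpoly1 dhomog1.
- rewrite restrictXM -add1n; apply: dhomogM hp.
  by apply: rpred_sum => i _; apply: dhomogZ; rewrite dhomogX /= mdeg1.
Qed.

(** * Change of the coefficient ring *)

Section BaseChange.
Variables (F K : comNzRingType) (iota : {rmorphism F -> K}).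

Lemma map_mpolyXM n i (p : {mpoly F[n]}) :
  map_mpoly iota ('X_i * p) = 'X_i * map_mpoly iota p.
Proof. by rewrite rmorphM /= map_mpolyX. Qed.

Lemma map_mpoly_lin n (c : F) (p r : {mpoly F[n]}) :
  map_mpoly iota (c *: p + r) = iota c *: map_mpoly iota p + map_mpoly iota r.
Proof. by rewrite raddfD /= map_mpolyZ. Qed.

Lemma meval_map_mpoly n (p : {mpoly F[n]}) (v : 'rV[F]_n) :
  (map_mpoly iota p).@[(map_mx iota v) 0] = iota (p.@[v 0]).
Proof.
elim/meval_ind: p => [|c p r hp hr||i p hp].
- by rewrite !raddf0.
- by rewrite map_mpoly_lin !mevalD !mevalZ rmorphD rmorphM hp hr.
- by rewrite !rmorph1.
- by rewrite map_mpolyXM !mevalM !mevalXU rmorphM hp mxE.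
Qed.

Lemma dhomog_map_mpoly n d (p : {mpoly F[n]}) :
  p \is d.-homog -> map_mpoly iota p \is d.-homog.
Proof.
move: d p; apply: homog_ind => [d|d c p r hp hr||d j p _ hp].
- by rewrite raddf0 dhomog0.
- by rewrite map_mpoly_lin dhomogD // dhomogZ.
- by rewrite rmorph1 dhomog1.
- by rewrite map_mpolyXM -add1n; apply: dhomogM hp; rewrite dhomogX /= mdeg1.
Qed.

Lemma mderiv_map_mpoly n i (p : {mpoly F[n]}) :
  (map_mpoly iota p)^`M(i) = map_mpoly iota p^`M(i).
Proof.
apply/mpolyP => m; rewrite mcoeff_mderiv !mcoeff_map_mpoly mcoeff_mderiv.
by rewrite raddfMn.
Qed.

Lemma dirder_map_mpoly n v (p : {mpoly F[n]}) :
  dirder (map_mx iota v) (map_mpoly iota p) = map_mpoly iota (dirder v p).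
Proof.
rewrite /dirder raddf_sum /=; apply: eq_bigr => i _.
by rewrite map_mpolyZ mderiv_map_mpoly mxE.
Qed.

Lemma map_line_poly n (p : {mpoly F[n]}) (z y : 'rV[F]_n) :
  line_poly (map_mpoly iota p) (map_mx iota z) (map_mx iota y) =
  map_poly iota (line_poly p z y).
Proof.
elim/meval_ind: p => [|c p r hp hr||i p hp].
- by rewrite raddf0 !line_poly0 map_poly0.
- by rewrite map_mpoly_lin !line_polyD !line_polyZ rmorphD /= map_polyZ hp hr.
- by rewrite rmorph1 !line_poly1 rmorph1.
- rewrite map_mpolyXM !line_polyXM rmorphM /= hp rmorphD rmorphM /=.
  by rewrite !map_polyC map_polyX !mxE.
Qed.

End BaseChange.

Lemma map_restrict (F K : fieldType) (iota : {rmorphism F -> K}) m n (A : 'M[F]_(m, n)) (p : {mpoly F[n]}) :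
  map_mpoly iota (restrict A p) = restrict (map_mx iota A) (map_mpoly iota p).
Proof.
elim/meval_ind: p => [|c p r hp hr||j p hp].
- by rewrite /restrict !raddf0.
- by rewrite restrict_is_linear !map_mpoly_lin restrict_is_linear hp hr.
- by rewrite /restrict !rmorph1.
- rewrite restrictXM map_mpolyXM restrictXM rmorphM /= hp; congr (_ * _).
  by rewrite raddf_sum /=; apply: eq_bigr => i _; rewrite map_mpolyZ map_mpolyX mxE.
Qed.

(** * Gradients and nonsingular points *)

Definition gradient (R : comNzRingType) n (p : {mpoly R[n]}) (z : 'rV[R]_n) : 'cV[R]_n :=
  \col_i p^`M(i).@[z 0].

Lemma gradientE (R : comNzRingType) n (p : {mpoly R[n]}) (z v : 'rV[R]_n) :
  (dirder v p).@[z 0] = (v *m gradient p z) 0 0.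
Proof. by rewrite dirderE mxE; apply: eq_bigr => i _; rewrite mxE. Qed.

Lemma gradient_eq0 (R : comNzRingType) n (p : {mpoly R[n]}) (z : 'rV[R]_n) :
  (forall v, (dirder v p).@[z 0] = 0) -> gradient p z = 0.
Proof.
move=> h; apply/colP => i; have := h (delta_mx 0 i).
by rewrite gradientE -rowE !mxE.
Qed.

Lemma nonsingular_gradient (F : fieldType) (K : closedFieldType)
    (iota : {rmorphism F -> K}) n (p : {mpoly F[n]}) (v : 'rV[K]_n) :
  nonsingular iota p -> v != 0 -> (map_mpoly iota p).@[v 0] = 0 ->
  gradient (map_mpoly iota p) v != 0.
Proof.
move=> ns v0 pv; apply/eqP => g0; case: ns; exists v; split=> // i.
by have := congr1 (fun c : 'cV_n => c i 0) g0; rewrite !mxE mderiv_map_mpoly.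
Qed.

Lemma map_gradient (F K : fieldType) (iota : {rmorphism F -> K}) n
    (p : {mpoly F[n]}) (v : 'rV[F]_n) :
  gradient (map_mpoly iota p) (map_mx iota v) = map_mx iota (gradient p v).
Proof.
by apply/colP => i; rewrite !mxE mderiv_map_mpoly meval_map_mpoly.
Qed.

Lemma nonsingular_gradient_base (F : fieldType) (K : closedFieldType)
    (iota : {rmorphism F -> K}) n (p : {mpoly F[n]}) (v : 'rV[F]_n) :
  nonsingular iota p -> v != 0 -> p.@[v 0] = 0 -> gradient p v != 0.
Proof.
move=> ns v0 pv; rewrite -(map_mx_eq0 iota) -map_gradient.
by apply: nonsingular_gradient; rewrite ?map_mx_eq0 // meval_map_mpoly pv rmorph0.
Qed.

(** The vector of variables is the generic point: a polynomial that vanishes there is zero. *)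
Lemma meval_generic (R : comNzRingType) m (io : {rmorphism R -> {mpoly R[m]}})
    (p : {mpoly R[m]}) : (forall c, io c = c%:MP) ->
  (map_mpoly io p).@[(\row_i 'X_i) 0] = p.
Proof.
move=> ioE; elim/meval_ind: p => [|c q r hq hr||i q hq].
- by rewrite !raddf0.
- rewrite map_mpoly_lin mevalD mevalZ -mul_mpolyC -ioE; congr (_ * _ + _); [exact: hq | exact: hr].
- by rewrite !rmorph1.
- rewrite map_mpolyXM mevalM mevalXU mxE; congr (_ * _); exact: hq.
Qed.

(** * Forms vanishing at all rational points *)

Section Vanishing.
Variables (F : finFieldType) (m d : nat) (p : {mpoly F[m]}).
Hypotheses (hp : p \is d.-homog) (p0 : forall v : 'rV[F]_m, p.@[v 0] = 0).

Lemma poly_eq0_on_field (A : idomainType) (iota : {rmorphism F -> A}) (r : {poly A}) :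
  injective iota -> (size r <= #|F|)%N -> (forall t, r.[iota t] = 0) -> r = 0.
Proof.
move=> inj sz r0; apply: (@roots_geq_poly_eq0 _ _ (map iota (enum F))).
- by apply/allP => _ /mapP[t _ ->]; apply/rootP.
- by rewrite map_inj_uniq ?enum_uniq.
- by rewrite size_map -cardE.
Qed.

(** The coordinates are turned from constants into variables one at a time. As a polynomial in one
    coordinate, p has coefficients of t^d and t^(d-1) given by its value and its partial derivatives
    at a coordinate vector, which vanish. So the degree is at most d - 2 < q, and q roots in F force
    the zero polynomial. *)
Lemma vanishing_homog_eq0_succ : (d <= #|F|.+1)%N ->
  (forall i j, (dirder (delta_mx 0 j) p).@[(delta_mx 0 i : 'rV_m) 0] = 0) -> p = 0.
Proof.
move=> hd dp0.
pose io : {rmorphism F -> {mpoly F[m]}} := @mpolyC m F.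
have inj : injective io by exact: fmorph_inj.
pose pA := map_mpoly io p.
have hpA : pA \is d.-homog by apply: dhomog_map_mpoly.
have deltaA i : delta_mx 0 i = map_mx io (delta_mx 0 i : 'rV_m).
  by rewrite map_delta_mx.
(* The first j coordinates are variables and the others arbitrary constants; j = m gives the generic
   point. *)
have H j (c : 'rV[F]_m) : (j <= m)%N ->
  pA.@[(\row_i (if (i < j)%N then 'X_i else io (c 0 i))) 0] = 0.
  elim: j c => [|j IH] c hj.
    have -> : \row_i (if (i < 0)%N then 'X_i else io (c 0 i)) = map_mx io c.
      by apply/rowP => i; rewrite !mxE.
    by rewrite meval_map_mpoly p0 rmorph0.
  pose jo := Ordinal hj.
  pose z : 'rV[{mpoly F[m]}]_m :=
    \row_i (if (i < j)%N then 'X_i else if i == jo then 0 else io (c 0 i)).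
  have zE t : z + t *: delta_mx 0 jo =
      \row_i (if (i < j)%N then 'X_i else if i == jo then t else io (c 0 i)).
    apply/rowP => i; rewrite !mxE eqxx /=; have [->|ne] := eqVneq i jo.
      by rewrite ltnn add0r mulr1.
    by rewrite mulr0 addr0.
  have L0 : line_poly pA z (delta_mx 0 jo) = 0.
    apply: (poly_eq0_on_field inj); last first.
      move=> t; rewrite line_polyE zE.
      rewrite -[RHS](IH (\row_i if i == jo then t else c 0 i) (ltnW hj)).
      apply: meval_eq => i; rewrite !mxE.
      by case: ifP => // _; case: ifP.
    apply: leq_trans (_ : (d.-1 <= _)%N); last by case: (d) hd.
    have topd : (line_poly pA z (delta_mx 0 jo))`_d = 0.
      by rewrite (lead_line_poly _ _ hpA) deltaA meval_map_mpoly p0 rmorph0.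
    apply/leq_sizeP => k; rewrite leq_eqVlt => /orP[/eqP <-|hk].
      case: (posnP d) topd => [->//|d0] _.
      rewrite (sublead_line_poly _ _ hpA d0) deltaA.
      rewrite dirderE big1 // => i _; rewrite mderiv_map_mpoly meval_map_mpoly.
      rewrite -[X in X.@[_]](_ : dirder (delta_mx 0 i) p = _) ?dp0 ?rmorph0 ?mulr0 //.
      rewrite /dirder (bigD1 i) //= big1 ?addr0 => [|i' hi'].
        by rewrite mxE !eqxx scale1r.
      by rewrite mxE eqxx (negbTE hi') scale0r.
    have [->//|hk'] := eqVneq k d.
    by have /leq_sizeP -> // := size_line_poly z (delta_mx 0 jo) hpA; lia.
  have := congr1 (fun r => r.['X_jo]) L0; rewrite line_polyE zE horner0 => <-.
  apply: meval_eq => i; rewrite !mxE ltnS leq_eqVlt.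
  have [->|ne] := eqVneq i jo; first by rewrite eqxx /= ltnn.
  by rewrite -val_eqE /= in ne; rewrite (negbTE ne).
have := H m 0 (leqnn m).
have -> : \row_i (if (i < m)%N then 'X_i else io ((0 : 'rV_m) 0 i)) = \row_i 'X_i.
  by apply/rowP => i; rewrite !mxE ltn_ord.
by rewrite meval_generic.
Qed.

(** For d <= q the condition on derivatives is automatic: on the line joining two coordinate vectors
    the coefficient of t^d is a value of p, so the degree is less than q and the polynomial vanishes
    on F. *)
Lemma vanishing_homog_eq0 : (d <= #|F|)%N -> p = 0.
Proof.
move=> hd; apply: vanishing_homog_eq0_succ; first exact: leqW.
move=> i j; rewrite -coef1_line_poly.
rewrite (@poly_eq0_on_field _ [the {rmorphism F -> F} of idfun] (line_poly _ _ _)) ?coef0 //.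
- apply: leq_trans hd; apply/leq_sizeP => k; rewrite leq_eqVlt => /orP[/eqP <-|hk].
    by rewrite (lead_line_poly _ _ hp) p0.
  by have /leq_sizeP -> := size_line_poly (delta_mx 0 i) (delta_mx 0 j) hp.
- by move=> t; rewrite line_polyE p0.
Qed.

End Vanishing.

(** * Common zeros of two ternary forms over an algebraically closed field *)

Section TernaryForms.

(** The Sylvester matrix of two polynomials of degree e; its determinant is their resultant up to
    sign. *)
Definition sylvester (A : nzRingType) e (p r : {poly A}) : 'M[A]_(e + e) :=
  col_mx (\matrix_(i < e, k < e + e) (p * 'X^i)`_k)
         (\matrix_(i < e, k < e + e) (r * 'X^i)`_k).

(** A vector in the left kernel amounts to polynomials A, B of degree less than e, not both zero,
    with p A + r B = 0. If p and r were coprime, p would divide B, so that B = 0 and then A = 0. *)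
Lemma sylvester_common_root (K : closedFieldType) e (p r : {poly K}) :
  (0 < e)%N -> size p = e.+1 -> size r = e.+1 -> \det (sylvester e p r) = 0 ->
  exists x, root p x /\ root r x.
Proof.
move=> e0 szp szr /eqP/det0P[v v0].
rewrite -[v]hsubmxK mul_row_col => hv.
set a := lsubmx v in hv; set b := rsubmx v in hv.
pose A := rVpoly a; pose B := rVpoly b.
have szA : (size A <= e)%N by apply: size_poly.
have szB : (size B <= e)%N by apply: size_poly.
have coefM (s : {poly K}) (c : 'rV_e) (k : 'I_(e + e)) :
    (c *m (\matrix_(i < e, k < e + e) (s * 'X^i)`_k)) 0 k = (s * rVpoly c)`_k.
  rewrite mxE /rVpoly poly_def mulr_sumr coef_sum; apply: eq_bigr => i _.
  rewrite mxE -scalerAr coefZ; congr (_ * _).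
  by rewrite insubT //= => h; congr (c _ _); apply: val_inj.
have AB : p * A + r * B = 0.
  apply/polyP => k; rewrite coef0.
  have [hk|hk] := ltnP k (e + e).
    have := congr1 (fun w : 'rV_(e + e) => w 0 (Ordinal hk)) hv.
    by rewrite mxE !coefM mxE coefD.
  rewrite coefD !nth_default ?addr0 // (leq_trans (size_polyMleq _ _)) //.
    by rewrite szr addSn /= (leq_trans _ hk) // leq_add2l.
  by rewrite szp addSn /= (leq_trans _ hk) // leq_add2l.
have : ~~ coprimep p r.
  apply/negP => cop; move/negP: v0; apply.
  have pB : p %| r * B.
    have -> : r * B = - (p * A) by apply/eqP; rewrite -addr_eq0 addrC AB.
    by rewrite dvdpNr dvdp_mulr.
  have B0 : B = 0.
    apply/eqP; apply: contraLR pB => B0; rewrite Gauss_dvdpr //.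
    apply/negP => /(dvdp_leq B0); rewrite szp; lia.
  have A0 : A = 0.
    move/eqP: AB; rewrite B0 mulr0 addr0 mulf_eq0 -size_poly_eq0 szp /=.
    by move/eqP.
  by rewrite -[v]hsubmxK -/a -/b -[a]rVpolyK -[b]rVpolyK -/A -/B A0 B0 !linear0 row_mx0.
move=> hnc; have [x hx] := closed_rootP _ hnc.
by exists x; move: hx; rewrite root_gcd => /andP[].
Qed.

Definition v3 (A : nzRingType) (x y z : A) : 'rV[A]_3 := \row_(i < 3) nth 0 [:: x; y; z] i.

Lemma v3_eq0 (A : nzRingType) (x y z : A) : (v3 x y z == 0) = [&& x == 0, y == 0 & z == 0].
Proof.
apply/eqP/and3P => [h|[/eqP-> /eqP-> /eqP->]].
  have e (i : 'I_3) : (v3 x y z) 0 i = 0 by rewrite h mxE.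
  by split; apply/eqP; [have := e 0 | have := e 1 | have := e 2%:R]; rewrite mxE.
by apply/rowP => i; rewrite !mxE; case: i => [[|[|[|]]]].
Qed.

Lemma map_v3 (A B : nzRingType) (f : {rmorphism A -> B}) x y z :
  map_mx f (v3 x y z) = v3 (f x) (f y) (f z).
Proof.
by apply/rowP => i; rewrite !mxE; case: i => [[|[|[|]]]].
Qed.

Section Family.
Variables (A : comNzRingType) (G : {mpoly A[3]}).
(** The form G(x, y, T) as a polynomial in its last variable T. *)
Definition vert (x y : A) : {poly A} := line_poly G (v3 x y 0) (v3 0 0 1).

Lemma vertE x y z : (vert x y).[z] = G.@[(v3 x y z) 0].
Proof.
rewrite line_polyE; apply: meval_eq => i; rewrite !mxE.
by case: i => [[|[|[|]]]] //= _; rewrite ?mulr0 ?addr0 // mulr1 add0r.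
Qed.

(** The coefficient of T^k is a form of degree e - k in x and y. *)
Lemma coef_vertZ e t x y k : G \is e.-homog -> (k <= e)%N ->
  (vert (t * x) (t * y))`_k = t ^+ (e - k) * (vert x y)`_k.
Proof.
move=> hG hk.
rewrite /vert (_ : v3 (t * x) (t * y) 0 = t *: v3 x y 0); last first.
  apply/rowP => i; rewrite !mxE.
  by case: i => [[|[|[|]]]] //= _; rewrite ?mulr0.
move: (v3 x y 0) (v3 0 0 1) => z w {x y}.
move: e G hG k hk; apply: homog_ind => [d|d c p r hp hr||d i p hom hp] k hk.
- by rewrite !line_poly0 !coef0 mulr0.
- by rewrite !line_polyD !line_polyZ !coefD !coefZ hp // hr // mulrDr mulrCA.
- by case: k hk => // _; rewrite !line_poly1 expr0 mul1r.
- rewrite !line_polyXM !coef_linXM !mxE.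
  have szL u v : (line_poly p u v)`_d.+1 = 0.
    by have /leq_sizeP -> := @size_line_poly A 3 d p u v hom.
  case: k hk => [_|k].
    by rewrite !subn0 hp // subn0 !mulr0 !addr0 exprS mulrACA.
  rewrite ltnS subSS leq_eqVlt => /orP[/eqP ->|hk].
    by rewrite !szL !mulr0 !add0r subnn expr0 mul1r hp // subnn expr0 mul1r.
  rewrite (hp k.+1) // (hp k) ?(ltnW hk) // mulrDr -(subnSK hk) exprS.
  by rewrite mulrACA; congr (_ + _); rewrite mulrCA.
Qed.
End Family.

Lemma map_vert (A B : comNzRingType) (f : {rmorphism A -> B}) (G : {mpoly A[3]}) x y :
  map_poly f (vert G x y) = vert (map_mpoly f G) (f x) (f y).
Proof. by rewrite /vert -map_line_poly !map_v3 !rmorph0 rmorph1. Qed.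

Lemma map_sylvester (A B : nzRingType) (f : {rmorphism A -> B}) e p r :
  map_mx f (sylvester e p r) = sylvester e (map_poly f p) (map_poly f r).
Proof.
rewrite /sylvester map_col_mx; congr col_mx; apply/matrixP => i k.
  by rewrite !mxE -coef_map rmorphM /= map_polyXn.
by rewrite !mxE -coef_map rmorphM /= map_polyXn.
Qed.

(** The resultant is homogeneous of degree e^2 in (x, y), by the usual weight argument: columns are
    scaled by t^k and rows by t^(e+i). Over a general ring the common power of t cannot be cancelled
    and stays on both sides. *)
Lemma det_sylvester_vert (A : comNzRingType) (G H : {mpoly A[3]}) e t x y :
  G \is e.-homog -> H \is e.-homog ->
  \det (sylvester e (vert G (t * x) (t * y)) (vert H (t * x) (t * y)))
    * t ^+ (\sum_(k < e + e) k)
  = t ^+ (e * e + \sum_(k < e + e) k) * \det (sylvester e (vert G x y) (vert H x y)).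
Proof.
move=> hG hH.
pose D1 : 'rV[A]_(e + e) := \row_k t ^+ k.
pose D2 : 'rV[A]_(e + e) := row_mx (\row_(i < e) t ^+ (e + i)) (\row_(i < e) t ^+ (e + i)).
have dD1 : \det (diag_mx D1) = t ^+ (\sum_(k < e + e) k).
  by rewrite det_diag expr_sum; apply: eq_bigr => k _; rewrite mxE.
have dD2 : \det (diag_mx D2) = t ^+ (e * e + \sum_(k < e + e) k).
  rewrite det_diag big_split_ord /=.
  rewrite (eq_bigr (fun i : 'I_e => t ^+ (e + i))); last first.
    by move=> i _; rewrite row_mxEl mxE.
  rewrite [X in _ * X](eq_bigr (fun i : 'I_e => t ^+ (e + i))); last first.
    by move=> i _; rewrite row_mxEr mxE.
  rewrite -!expr_sum -exprD; congr (_ ^+ _).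
  rewrite !big_split_ord /= !big_split /= !sum_nat_const card_ord; lia.
rewrite -dD1 -dD2 -!det_mulmx; congr (\det _).
rewrite mul_mx_diag mul_diag_mx; apply/matrixP => i k; rewrite !mxE.
have key (L : {mpoly A[3]}) (j : 'I_e) : L \is e.-homog ->
  (vert L (t * x) (t * y) * 'X^j)`_k * t ^+ k = t ^+ (e + j) * (vert L x y * 'X^j)`_k.
  move=> hL; rewrite !coefMXn; case: ltnP => hjk; first by rewrite mul0r mulr0.
  have [hke|hke] := leqP (k - j) e; last first.
    have /leq_sizeP s := size_line_poly (v3 (t * x) (t * y) 0) (v3 0 0 1) hL.
    have /leq_sizeP s' := size_line_poly (v3 x y 0) (v3 0 0 1) hL.
    by rewrite /vert s // s' // mul0r mulr0.
  rewrite (coef_vertZ _ _ _ hL hke) mulrAC -exprD; congr (_ ^+ _ * _); lia.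
by case: splitP => j hj; rewrite !mxE key.
Qed.

(** A root t of X^(M+2) - X + 1 works: both t = 0 and t^(M+1) = 1 would give 1 = 0. *)
Lemma closed_field_pow_neq1 (K : closedFieldType) (M : nat) :
  exists t : K, t != 0 /\ t ^+ M.+1 != 1.
Proof.
have [t ht] : exists t, root ('X^(M.+2) - 'X + 1%:P : {poly K}) t.
  apply: closed_rootP; rewrite -addrA size_polyDl size_polyXn //.
  rewrite (leq_ltn_trans (size_polyD _ _)) // gtn_max size_polyN size_polyX.
  by rewrite size_polyC oner_eq0.
exists t; move: ht; rewrite rootE !hornerE => /eqP ht; split.
  by apply/eqP => t0; move: ht; rewrite t0 expr0n subr0 add0r => /eqP; rewrite oner_eq0.
apply/eqP => t1; move: ht; rewrite exprS t1 mulr1 subrr add0r => /eqP.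
by rewrite oner_eq0.
Qed.

Lemma size_vert (A : comNzRingType) (G : {mpoly A[3]}) e x y :
  G \is e.-homog -> G.@[(v3 0 0 1) 0] != 0 -> size (vert G x y) = e.+1.
Proof.
move=> hG G1; apply/eqP; rewrite eqn_leq size_line_poly //=.
by rewrite ltnNge; apply: contra G1 => /leq_sizeP h; rewrite -(lead_line_poly (v3 x y 0) _ hG) h.
Qed.

Lemma map_det_vert (A B : comNzRingType) (phi : {rmorphism A -> B}) e (G H : {mpoly A[3]}) x y :
  phi (\det (sylvester e (vert G x y) (vert H x y)))
  = \det (sylvester e (vert (map_mpoly phi G) (phi x) (phi y))
                      (vert (map_mpoly phi H) (phi x) (phi y))).
Proof. by rewrite -det_map_mx map_sylvester !map_vert. Qed.

Lemma horner_det_vert (A : comNzRingType) e (G H : {mpoly A[3]}) (x y : {poly A}) t :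
  (\det (sylvester e (vert (map_mpoly polyC G) x y) (vert (map_mpoly polyC H) x y))).[t]
  = \det (sylvester e (vert G x.[t] y.[t]) (vert H x.[t] y.[t])).
Proof.
have E (L : {mpoly A[3]}) : map_mpoly (horner_eval t) (map_mpoly polyC L) = L.
  by apply/mpolyP => m; rewrite !mcoeff_map_mpoly /= /horner_eval hornerC.
have := map_det_vert (horner_eval t) e (map_mpoly polyC G) (map_mpoly polyC H) x y.
by rewrite !E.
Qed.

(** Eliminate the last variable. If the resultant r had no zero of the form (1 : t) or (t : 1), both
    r(1, t) and r(t, 1) would be nonzero constants, equal since they agree at t = 1. Homogeneity
    would then give t^(e^2) = 1 for every nonzero t. *)
Lemma ternary_forms_zero_generic (K : closedFieldType) e (G H : {mpoly K[3]}) :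
  (0 < e)%N -> G \is e.-homog -> H \is e.-homog ->
  G.@[(v3 0 0 1) 0] != 0 -> H.@[(v3 0 0 1) 0] != 0 ->
  exists v : 'rV[K]_3, [/\ v != 0, G.@[v 0] = 0 & H.@[v 0] = 0].
Proof.
move=> e0 hG hH G1 H1.
pose r x y := \det (sylvester e (vert G x y) (vert H x y)).
have root_r x y : (x != 0) || (y != 0) -> r x y = 0 ->
    exists v : 'rV[K]_3, [/\ v != 0, G.@[v 0] = 0 & H.@[v 0] = 0].
  move=> xy r0.
  have [z [z1 z2]] := sylvester_common_root e0 (size_vert x y hG G1) (size_vert x y hH H1) r0.
  exists (v3 x y z); rewrite v3_eq0 -!vertE; split; try exact/rootP.
  by apply: contraL xy => /and3P[/eqP-> /eqP-> _]; rewrite eqxx.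
pose GX := map_mpoly [the {rmorphism K -> {poly K}} of polyC] G.
pose HX := map_mpoly [the {rmorphism K -> {poly K}} of polyC] H.
pose R x y : {poly K} := \det (sylvester e (vert GX x y) (vert HX x y)).
have RE x y t : (R x y).[t] = r x.[t] y.[t].
  exact: horner_det_vert.
have [h1|h1] := boolP (size (R 1 'X) == 1%N); last first.
  have [t /rootP ht] := closed_rootP _ h1.
  by apply: (root_r 1 t); rewrite ?oner_eq0 // -ht RE hornerC hornerX.
have [h2|h2] := boolP (size (R 'X 1) == 1%N); last first.
  have [t /rootP ht] := closed_rootP _ h2.
  by apply: (root_r t 1); rewrite ?oner_eq0 ?orbT // -ht RE hornerC hornerX.
have [c1 c10 R1] := size_poly1P _ h1; have [c2 c20 R2] := size_poly1P _ h2.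
have r1 t : r 1 t = c1 by have := RE 1 'X t; rewrite R1 !hornerC hornerX => <-.
have r2 t : r t 1 = c2 by have := RE 'X 1 t; rewrite R2 !hornerC hornerX => <-.
have c12 : c1 = c2 by rewrite -(r1 1) r2.
have [t [t0 ht]] := closed_field_pow_neq1 K (e * e).-1.
have := det_sylvester_vert t t^-1 1 hG hH.
rewrite mulfV // mulr1 -/(r _ _) -/(r _ _) r1 r2 c12 mulrC => /(mulIf c20).
rewrite -{1}[t ^+ _]mul1r exprD => /mulIf; rewrite expf_eq0 (negbTE t0) andbF.
move=> /(_ isT) /esym /eqP; rewrite prednK ?muln_gt0 ?e0 // in ht.
by rewrite (negbTE ht).
Qed.

(** The point (0 : 0 : 1) is either a common zero, or one of the forms, say G, does not vanish
    there. If H does, it is replaced by G + H, which has the same common zeros with G. *)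
Lemma ternary_forms_zero (K : closedFieldType) e (G H : {mpoly K[3]}) :
  (0 < e)%N -> G \is e.-homog -> H \is e.-homog ->
  exists v : 'rV[K]_3, [/\ v != 0, G.@[v 0] = 0 & H.@[v 0] = 0].
Proof.
move=> e0 hG hH.
have v0 : v3 0 0 1 != 0 :> 'rV[K]_3 by rewrite v3_eq0 oner_eq0 !andbF.
wlog G1 : G H hG hH / G.@[(v3 0 0 1) 0] != 0.
  move=> W; have [G1|] := eqVneq (G.@[(v3 0 0 1) 0]) 0; last exact: W.
  have [H1|] := eqVneq (H.@[(v3 0 0 1) 0]) 0; first by exists (v3 0 0 1).
  by move=> H1; have [v [? ? ?]] := W H G hH hG H1; exists v.
have [H1|H1] := eqVneq (H.@[(v3 0 0 1) 0]) 0; last exact: ternary_forms_zero_generic e0 hG hH G1 H1.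
have hGH : G + H \is e.-homog by apply: dhomogD.
have [|v [? Gv]] := ternary_forms_zero_generic e0 hG hGH G1; first by rewrite mevalD H1 addr0.
by rewrite mevalD Gv add0r => Hv; exists v.
Qed.
End TernaryForms.

(** * Bases and complements; zeros of forms on a line *)

Lemma row_free_extend (F : fieldType) m k n (A : 'M[F]_(m, n)) :
  row_free A -> (m + k = n)%N -> exists B : 'M[F]_(k, n), row_free (col_mx A B).
Proof.
move=> rfA mkn.
have rk : \rank (A^C)%MS = k by rewrite mxrank_compl (eqP rfA) -mkn addKn.
suff : exists B : 'M[F]_(\rank (A^C)%MS, n), row_free (col_mx A B) by rewrite rk.
exists (row_base (A^C)%MS); rewrite /row_free eqn_leq rank_leq_row /= -addsmxE.
apply: leq_trans (_ : (\rank (A + A^C)%MS <= _)%N).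
  by have /eqP -> := addsmx_compl_full A; rewrite rk mkn.
by apply: mxrankS; rewrite addsmxS // eq_row_base.
Qed.

Lemma row_free_full_sub (F : fieldType) m n (A : 'M[F]_(m, n)) (v : 'rV[F]_n) :
  row_free A -> (n <= m)%N -> exists x, v = x *m A.
Proof.
move=> rfA nm; have fA : row_full A.
  by rewrite /row_full eqn_leq rank_leq_col /= (eqP rfA).
by have /submxP[x ->] := submx_full v fA; exists x.
Qed.

Lemma row_free_ker (F : fieldType) m n (A : 'M[F]_(m, n)) :
  (forall y : 'rV[F]_m, y *m A = 0 -> y = 0) -> row_free A.
Proof.
move=> h; rewrite -kermx_eq0; apply/rowV0P => v /sub_kermxP; exact: h.
Qed.

Lemma row_free_mul_eq0 (F : fieldType) m n (A : 'M[F]_(m, n)) (x : 'rV[F]_m) :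
  row_free A -> (x *m A == 0) = (x == 0).
Proof. by move=> rfA; rewrite -[RHS](inj_eq (row_free_inj rfA)) mul0mx. Qed.

Lemma binary_form_zero (K : closedFieldType) n e (p : {mpoly K[n]}) (u v : 'rV[K]_n) :
  (0 < e)%N -> p \is e.-homog -> p.@[v 0] != 0 ->
  exists t, p.@[(u + t *: v) 0] = 0.
Proof.
move=> e0 hp pv; have /closed_rootP[t /rootP ht] : size (line_poly p u v) != 1%N.
  apply: contra pv => /eqP sz; rewrite -(lead_line_poly u v hp).
  by rewrite nth_default // sz.
by exists t; rewrite -line_polyE.
Qed.

Lemma binary_form_zero_mx (K : closedFieldType) n e (p : {mpoly K[n]}) (L : 'M[K]_(2, n)) :
  (0 < e)%N -> p \is e.-homog -> exists2 x : 'rV[K]_2, x != 0 & p.@[(x *m L) 0] = 0.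
Proof.
move=> e0 hp; have [h|h] := eqVneq (p.@[(row 1 L) 0]) 0.
  exists (delta_mx 0 1); last by rewrite -rowE.
  apply/eqP => /matrixP /(_ 0 1); rewrite !mxE !eqxx; exact/eqP/oner_neq0.
have [t ht] := binary_form_zero (row 0 L) e0 hp h.
exists (delta_mx 0 0 + t *: delta_mx 0 1).
  apply/eqP => /matrixP /(_ 0 0); rewrite !mxE !eqxx /= mulr0 addr0.
  exact/eqP/oner_neq0.
by rewrite mulmxDl -scalemxAl -!rowE.
Qed.

Lemma dirder_lin_mx (R : comNzRingType) m n (A : 'M[R]_(m, n)) (p : {mpoly R[n]}) (z : 'rV[R]_n) :
  (forall i, (dirder (row i A) p).@[z 0] = 0) -> A *m gradient p z = 0.
Proof.
move=> h; apply/colP => i; have := h i; rewrite gradientE !mxE => {2}<-.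
by apply: eq_bigr => j _; rewrite !mxE.
Qed.

(** * Nonsingular hypersurfaces: cones and planes *)

Section Geometry.
Variables (F : finFieldType) (K : closedFieldType) (iota : {rmorphism F -> K}).
Variables (n d : nat) (f : {mpoly F[n]}).
Hypotheses (hf : f \is d.-homog) (ns : nonsingular iota f) (d2 : (1 < d)%N).

Let fK := map_mpoly iota f.
Let hfK : fK \is d.-homog. Proof. exact: dhomog_map_mpoly. Qed.

Lemma gradient_full_eq0 m (A : 'M[K]_(m, n)) z :
  row_free A -> (n <= m)%N -> A *m gradient fK z = 0 -> gradient fK z = 0.
Proof.
move=> rfA nm Ag; apply: gradient_eq0 => v.
have [x ->] := row_free_full_sub v rfA nm.
by rewrite gradientE -mulmxA Ag mulmx0 mxE.
Qed.

(** The cone condition becomes an equality of two restrictions of f, which can be compared at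
    rational points. *)
Lemma cone_equation m (U : 'M[F]_(m, n)) :
  restrict U f \mPo [tuple 'X_(rshift 1 i) | i < m] = restrict (col_mx 0 U) f.
Proof.
elim/meval_ind: (f) => [|c p r hp hr||j p hp].
- by rewrite /restrict !comp_mpoly0.
- by rewrite !restrict_is_linear comp_mpolyD comp_mpolyZ hp hr.
- by rewrite /restrict !comp_mpoly1.
- rewrite !restrictXM rmorphM /= hp; congr (_ * _).
  rewrite raddf_sum [RHS]big_split_ord /= [X in _ = X + _]big1 ?add0r => [|i _]; last first.
    by rewrite col_mxEu mxE scale0r.
  apply: eq_bigr => i _; rewrite col_mxEd comp_mpolyZ.
  by rewrite /comp_mpoly mmapX mmap1U tnth_mktuple.
Qed.

(** Let a be a singular point of the base. At every point of the line joining P to a, other than P,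
    the derivatives of f along T_P vanish. The derivative along a direction u outside T_P is a form
    of degree d - 1 > 0 on this line that does not vanish at P, so it has a zero z different from P,
    and z is singular on the hypersurface. *)
Lemma cone_base_nonsingular m (P : 'rV[F]_n) (U : 'M[F]_(m, n)) :
  P != 0 -> f.@[P 0] = 0 ->
  row_free (col_mx P U) -> (tangent_space f P <= col_mx P U)%MS ->
  restrict (col_mx P U) f = restrict (col_mx 0 U) f ->
  nonsingular iota (restrict U f).
Proof.
move=> P0 fP rf tan cone [a [a0 fa da]].
have gP : gradient f P != 0 := nonsingular_gradient_base ns P0 fP.
have [u uP] : exists u : 'rV[F]_n, (dirder u f).@[P 0] != 0.
  have /rowV0Pn[w /submxP[u wE] w0] : (gradient f P)^T != 0 by rewrite trmx_eq0.
  apply/existsP; apply: contraT; rewrite negb_exists => /forallP h.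
  by case/eqP: gP; apply: gradient_eq0 => v; apply/eqP; have := h v; rewrite negbK.
pose PK := map_mx iota P; pose UK := map_mx iota U; pose uK := map_mx iota u.
have coneK : restrict (col_mx PK UK) fK = restrict (col_mx 0 UK) fK.
  have := congr1 (map_mpoly iota) cone.
  by rewrite !map_restrict !map_col_mx map_mx0.
have rfK : row_free (col_mx PK UK) by rewrite -map_col_mx /row_free mxrank_map.
have fUK : map_mpoly iota (restrict U f) = restrict UK fK by rewrite map_restrict.
have [t ht] : exists t, (dirder uK fK).@[(a *m UK + t *: PK) 0] = 0.
  apply: (@binary_form_zero _ _ d.-1); first by case: (d) d2 => [|[]].
    exact: dhomog_dirder.
  by rewrite dirder_map_mpoly meval_map_mpoly fmorph_eq0.
set z := a *m UK + t *: PK in ht.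
have zE : z = row_mx t%:M a *m col_mx PK UK.
  by rewrite mul_row_col mul_scalar_mx addrC.
have z0 : z != 0.
  rewrite zE row_free_mul_eq0 //; apply: contra a0 => /eqP h.
  by rewrite -[a](row_mxKr t%:M) h linear0.
have fz : fK.@[z 0] = 0.
  rewrite zE -meval_restrict coneK meval_restrict mul_row_col mulmx0 add0r.
  by rewrite -meval_restrict -fUK.
have dz v : (dirder (v *m col_mx PK UK) fK).@[z 0] = 0.
  rewrite zE -dirder_restrict coneK dirder_restrict !mul_row_col -[v]hsubmxK.
  rewrite mul_row_col !mulmx0 !add0r -dirder_restrict -fUK dirderE big1 // => i _.
  by rewrite mderiv_map_mpoly da mulr0.
have /eqP := nonsingular_gradient ns z0 fz; apply; apply: gradient_eq0 => v.
(* Any direction differs from a multiple of [uK] by a vector tangent at P, along which the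
   derivative at z is already known to vanish. *)
set c := (dirder v fK).@[PK 0] / (dirder uK fK).@[PK 0].
have : (v - c *: uK <= kermx (gradient fK PK))%MS.
  apply/sub_kermxP/rowP => i; rewrite ord1 -gradientE addrC -scaleNr dirder_linl.
  rewrite mulNr divfK ?addNr ?mxE //.
  by rewrite dirder_map_mpoly meval_map_mpoly fmorph_eq0.
rewrite map_gradient -map_kermx => /submx_trans /(_ (_ : _ <= col_mx PK UK)%MS).
rewrite -map_col_mx map_submx => /(_ tan) /submxP[x].
rewrite map_col_mx => /(canRL (subrK _)) ->.
by rewrite addrC dirder_linl ht dz mulr0 addr0.
Qed.

(* The two derivatives of [f] transversal to a plane in V(f) are forms of the same degree on
   it, hence have a common zero there, which is a singular point. *)
Lemma no_plane (A : 'M[F]_(3, n)) : n = 5 -> row_free A -> restrict A f <> 0.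
Proof.
move=> n5 rfA A0.
have [B rfB] := @row_free_extend F 3 2 n A rfA (esym n5).
pose AK := map_mx iota A; pose BK := map_mx iota B.
have rfK : row_free (col_mx AK BK) by rewrite -map_col_mx /row_free mxrank_map.
have rfAK : row_free AK by rewrite /row_free mxrank_map.
have A0K : restrict AK fK = 0 by rewrite -map_restrict A0 raddf0.
pose G i := restrict AK (dirder (row i BK) fK).
have hG i : G i \is d.-1.-homog by apply/dhomog_restrict/dhomog_dirder.
have [x [x0 G0 G1]] := ternary_forms_zero (ltac:(lia) : (0 < d.-1)%N) (hG 0) (hG 1).
have z0 : x *m AK != 0 by rewrite row_free_mul_eq0.
have fz : fK.@[(x *m AK) 0] = 0 by rewrite -meval_restrict A0K meval0.
have /eqP := nonsingular_gradient ns z0 fz; apply.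
apply: (gradient_full_eq0 rfK); first by rewrite n5.
rewrite mul_col_mx.
have -> : AK *m gradient fK (x *m AK) = 0.
  apply: dirder_lin_mx => i; rewrite rowE -dirder_restrict A0K dirder0.
  exact: meval0.
have -> : BK *m gradient fK (x *m AK) = 0.
  apply: dirder_lin_mx => i; rewrite -meval_restrict.
  have [->|->] : i = 0 \/ i = 1 by case: i => [[|[|//]]] hi; [left|right]; exact: val_inj.
    exact: G0.
  exact: G1.
by rewrite col_mx0.
Qed.
End Geometry.

(* [polfun e g]: the function [g] is given by a polynomial of degree at most e. *)
Inductive polfun (F : fieldType) n : nat -> ('rV[F]_n -> F) -> Prop :=
| polfun_const e c g of (forall x, g x = c) : polfun e g
| polfun_add e g h k of polfun e g & polfun e h & (forall x, k x = g x + h x) : polfun e k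
| polfun_mul e (c : 'cV[F]_n) (a : F) g k of polfun e g
    & (forall x, k x = ((x *m c) 0 0 + a) * g x) : polfun e.+1 k.

(** * Polynomial functions on affine spaces *)

Section PolFun.
Variables (F : fieldType).

Lemma polfun_ext n e (g h : 'rV[F]_n -> F) : polfun e g -> (forall x, h x = g x) -> polfun e h.
Proof.
by case=> [e' c g' g'c|e' g' h' k pg ph hk|e' c a g' k pg hk] hh;
  [apply: (polfun_const _ (c := c))|apply: (polfun_add pg ph)|apply: (polfun_mul (c := c) (a := a) pg)]
  => x; rewrite hh.
Qed.

Lemma polfun_affine n m e (g : 'rV[F]_n -> F) (A : 'M[F]_(m, n)) b :
  polfun e g -> polfun e (fun x => g (x *m A + b)).
Proof.
elim=> {e g} [e c g gc|e g h k _ IHg _ IHh hk|e c a g k _ IH hk].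
- exact: (polfun_const _ (c := c)).
- exact: polfun_add IHg IHh _.
- apply: (polfun_mul (c := A *m c) (a := (b *m c) 0 0 + a) IH) => x.
  by rewrite hk mulmxDl mxE -mulmxA addrA.
Qed.

Lemma polfun_scale n e (g : 'rV[F]_n -> F) c : polfun e g -> polfun e (fun x => c * g x).
Proof.
elim=> {e g} [e b g gc|e g h k _ IHg _ IHh hk|e b a g k _ IH hk].
- by apply: (polfun_const _ (c := c * b)) => x; rewrite gc.
- by apply: polfun_add IHg IHh _ => x; rewrite hk mulrDr.
- by apply: (polfun_mul (c := b) (a := a) IH) => x; rewrite hk mulrCA.
Qed.

Lemma polfun_homog n d (p : {mpoly F[n]}) : p \is d.-homog -> polfun d (fun x => p.@[x 0]).
Proof.
move: d p; apply: homog_ind => [d|d c p r hp hr||d i p _ hp].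
- by apply: (polfun_const _ (c := 0)) => x; rewrite meval0.
- by apply: polfun_add (polfun_scale c hp) hr _ => x; rewrite mevalD mevalZ.
- by apply: (polfun_const _ (c := 1)) => x; rewrite meval1.
- apply: (polfun_mul (c := delta_mx i 0) (a := 0) hp) => x.
  by rewrite mevalM mevalXU addr0 -colE mxE.
Qed.

(* The degree e part of a polynomial function of degree at most e, for e > 0. *)
Lemma polfun_top n e (g : 'rV[F]_n -> F) : polfun e g ->
  exists G : 'rV[F]_n -> F,
    (if e is e'.+1 then polfun e' (fun x => g x - G x) else forall x, g x = G x) /\
    forall z u, exists r : {poly F}, [/\ (size r <= e.+1)%N, r`_e = G u &
      forall t, r.[t] = g (z + t *: u)].
Proof.
elim=> {e g} [e c g gc|e g h k _ [G [pG hG]] _ [H [pH hH]] hk|e c a g k pg [G [pG hG]] hk].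
- exists (fun=> if e is 0 then c else 0); split; first case: e => // e.
    by apply: (polfun_const _ (c := c)) => x; rewrite subr0.
  move=> z u; exists c%:P; split; first by rewrite size_polyC; case: (c != 0).
    by rewrite coefC; case: e.
  by move=> t; rewrite hornerC gc.
- exists (fun x => G x + H x); split.
    case: e pG pH {hG hH} => [gG hH x|e pG pH]; first by rewrite hk gG hH.
    by apply: polfun_add pG pH _ => x; rewrite hk opprD addrACA.
  move=> z u; have [r [r1 r2 r3]] := hG z u; have [s [s1 s2 s3]] := hH z u.
  exists (r + s); split; last by move=> t; rewrite hornerD r3 s3 hk.
    by rewrite (leq_trans (size_polyD _ _)) // geq_max r1 s1.
  by rewrite coefD r2 s2.
- exists (fun x => (x *m c) 0 0 * G x); split.
    apply: (polfun_ext (g := fun x => a * g x + (x *m c) 0 0 * (g x - G x))); last first.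
      by move=> x; rewrite hk mulrDl mulrBr addrA [a * _ + _]addrC.
    case: e pg pG {hG} => [|e] pg pG.
      apply: polfun_ext (polfun_scale a pg) _ => x.
      by rewrite pG subrr mulr0 addr0.
    apply: polfun_add (polfun_scale a pg) _ (fun=> erefl).
    by apply: (polfun_mul (c := c) (a := 0) pG) => x; rewrite addr0.
  move=> z u; have [r [r1 r2 r3]] := hG z u.
  exists ((((z *m c) 0 0 + a)%:P + ((u *m c) 0 0)%:P * 'X) * r); split.
  + apply/leq_sizeP => j hj; rewrite coef_linXM; case: j hj => // j hj.
    by move/leq_sizeP: r1 => r1; rewrite !r1 ?mulr0 ?addr0 // ltnW.
  + by rewrite coef_linXM r2; move/leq_sizeP: r1 => -> //; rewrite mulr0 add0r.
  + move=> t; rewrite hornerM r3 hornerD hornerM !hornerC hornerX hk.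
    by rewrite mulmxDl -scalemxAl !mxE addrAC [_ * t]mulrC.
Qed.

Lemma polfun_line n e (g : 'rV[F]_n -> F) z u : polfun e g ->
  exists2 r : {poly F}, (size r <= e.+1)%N & forall t, r.[t] = g (z + t *: u).
Proof. by case/polfun_top => G [_ /(_ z u)[r [r1 _ r3]]]; exists r. Qed.

(** Division by the affine form [lam]: [pr] is the projection along [y] onto the hyperplane [lam] =
    0. By induction on its construction, g differs from its composite with [pr] by a multiple of
    [lam], and this composite vanishes by hypothesis. *)
Lemma polfun_div n e (g : 'rV[F]_n -> F) (c : 'cV[F]_n) (R y : 'rV[F]_n) :
  polfun e.+1 g -> (y *m c) 0 0 = 1 ->
  (forall x, ((x - R) *m c) 0 0 = 0 -> g x = 0) ->
  exists2 g' : 'rV[F]_n -> F, polfun e g' & forall x, g x = ((x - R) *m c) 0 0 * g' x.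
Proof.
move=> pg yc; pose lam x := ((x - R) *m c) 0 0.
pose pr x := x - lam x *: y.
have addE (A B : 'M[F]_1) : (A + B) 0 0 = A 0 0 + B 0 0 by rewrite mxE.
have subE (A B : 'M[F]_1) : (A - B) 0 0 = A 0 0 - B 0 0 by rewrite !mxE.
have scE b (A : 'M[F]_1) : (b *: A) 0 0 = b * A 0 0 by rewrite mxE.
have lamE x : lam x = (x *m c) 0 0 - (R *m c) 0 0 by rewrite /lam mulmxBl subE.
have prE x : pr x = x *m (1%:M - c *m y) + (R *m c) 0 0 *: y.
  rewrite /pr lamE scalerBl opprB mulmxBr mulmx1 mulmxA addrA addrAC.
  by rewrite [x *m c]mx11_scalar mul_scalar_mx mxE eqxx.
suff H : forall e' (h : 'rV[F]_n -> F), polfun e' h -> exists h' : 'rV[F]_n -> F,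
    (if e' is e''.+1 then polfun e'' h' else forall x, h' x = 0) /\
    forall x, h x = h (pr x) + lam x * h' x.
  have [g' [pg' gg']] := H _ _ pg; move=> g0; exists g' => // x.
  rewrite gg' g0 ?add0r // -/(lam _) lamE /pr mulmxBl -scalemxAl subE scE yc mulr1.
  by rewrite lamE addrAC subrr.
move=> e' h; elim=> {e' h} [e' b h hb|e' h1 h2 k _ [h1' [p1 E1]] _ [h2' [p2 E2]] hk|e' b a h k ph [h' [p' E]] hk].
- exists (fun=> 0); split=> [|x]; last by rewrite !hb mulr0 addr0.
  by case: e' => // e'; apply: (polfun_const _ (c := 0)).
- exists (fun x => h1' x + h2' x); split.
    case: e' p1 p2 => [z1 z2 x|e' p1 p2]; first by rewrite z1 z2 addr0.
    exact: polfun_add p1 p2 _.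
  by move=> x; rewrite !hk E1 E2 mulrDr addrACA.
- exists (fun x => (y *m b) 0 0 * h (pr x) + ((x *m b) 0 0 + a) * h' x); split.
    apply: (polfun_add (g := fun x => (y *m b) 0 0 * h (pr x))
      (h := fun x => ((x *m b) 0 0 + a) * h' x)) => //.
      apply: polfun_scale; apply: polfun_ext (polfun_affine (1%:M - c *m y) ((R *m c) 0 0 *: y) ph) _.
      by move=> x /=; rewrite prE.
    case: e' ph p' => [|e'] ph p'; last exact: polfun_mul p' _.
    by apply: (polfun_const _ (c := 0)) => x; rewrite p' mulr0.
  move=> x; rewrite !hk [in LHS]E mulrDr mulrDr {1}(_ : x = pr x + lam x *: y); last by rewrite /pr subrK.
  rewrite mulmxDl -scalemxAl addE scE.
  by rewrite addrAC mulrDl -addrA -!mulrA mulrA; congr (_ + (_ + _)); rewrite mulrCA.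
Qed.

End PolFun.

Lemma sum_neq0_const (T : finZmodType) c : (\sum_(k : T | k != 0%R) c = #|T|.-1 * c)%N.
Proof. by rewrite sum_nat_const; congr muln; apply: (cardC1 (0 : T)). Qed.

(** * Zeros of polynomial functions on an affine plane *)

Section PlaneCount.
Variables (F : finFieldType) (q : nat).
Hypothesis Fq : #|F| = q.

Lemma q_gt1 : (1 < q)%N.
Proof. by rewrite -Fq; apply: finNzRing_gt1. Qed.

Lemma card_roots_line (r : {poly F}) e : (size r <= e.+1)%N -> r != 0 ->
  (#|[set t | r.[t] == 0%R]| <= e)%N.
Proof.
move=> sz r0; rewrite cardE -ltnS; apply: leq_trans sz.
apply: max_poly_roots r0 _ (enum_uniq _).
by apply/allP => t; rewrite mem_enum inE.
Qed.

(** The column [c] is an equation of the line spanned by [u], and [y] is normalised as [polfun_div]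
    requires. *)
Lemma orth_line (u : 'rV[F]_2) : u != 0 ->
  exists c : 'cV[F]_2, exists y : 'rV[F]_2, [/\ u *m c = 0, y *m c = 1%:M &
    forall x : 'rV[F]_2, x *m c = 0 -> exists t, x = t *: u].
Proof.
move=> u0.
have rfu : row_free u by rewrite /row_free rank_rV u0.
have [v rfuv] := @row_free_extend F 1 1 2 u rfu erefl.
have uM : col_mx u v \in unitmx by rewrite -row_free_unit.
exists (invmx (col_mx u v) *m col_mx 0 1%:M), v.
have uvM : col_mx u v *m (invmx (col_mx u v) *m col_mx 0 1%:M) = col_mx 0 1%:M :> 'M[F]_(1 + 1, 1).
  by rewrite mulKVmx.
move: uvM; rewrite mul_col_mx => /eq_col_mx[-> ->]; split => // x.
have [w ->] := row_free_full_sub x rfuv (leqnn 2).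
rewrite mulmxA mulmxK // -[w]hsubmxK mul_row_col mulmx0 add0r mulmx1 => ->.
rewrite mul_row_col mul0mx addr0 [lsubmx w]mx11_scalar mul_scalar_mx.
by exists (lsubmx w 0 0).
Qed.

Lemma card_rV (n : nat) : #|{: 'rV[F]_n}| = (q ^ n)%N.
Proof. by rewrite card_mx mul1n Fq. Qed.

(* Count pairs (u, k), k != 0, with g (R + k u) = 0 in two ways. *)
Lemma no_line_count e (g : 'rV[F]_2 -> F) (R : 'rV[F]_2) :
  polfun e.+1 g -> g R = 0 -> (forall u, u != 0 -> exists k, g (R + k *: u) != 0) ->
  (#|[set x | g x == 0%R]| <= 1 + (q + 1) * e)%N.
Proof.
move=> pg gR nl; pose Z := [set x | g x == 0].
have q1 := q_gt1.
have sh k : k != 0 -> #|[set u : 'rV[F]_2 | (u != 0) && (g (R + k *: u) == 0)]| = (#|Z| - 1)%N.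
  move=> k0; rewrite (cardsD1 R Z) inE gR eqxx add1n subn1 /=.
  rewrite -(card_imset _ (_ : injective (fun u => R + k *: u))); last first.
    by move=> u v /addrI /(scalerI k0).
  apply: eq_card => x; rewrite !inE; apply/imsetP/andP => [[u]|[xR gx]].
    rewrite inE => /andP[u0 gu] ->; rewrite gu; split=> //.
    by rewrite -subr_eq0 addrC addKr scaler_eq0 negb_or k0 u0.
  exists (k^-1 *: (x - R)).
    rewrite inE scalerA divff // scale1r [R + _]addrC subrK gx andbT.
    by rewrite scaler_eq0 negb_or invr_eq0 k0 subr_eq0 xR.
  by rewrite scalerA divff // scale1r [RHS]addrC subrK.
have cnt u : u != 0 -> (#|[set k | (k != 0%R) && (g (R + k *: u)%R == 0%R)]| <= e)%N.
  move=> u0; have [r sz rE] := polfun_line R u pg.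
  have r0 : r != 0.
    by have [k hk] := nl u u0; apply: contra hk => /eqP r0; rewrite -rE r0 horner0.
  have := card_roots_line sz r0.
  rewrite (cardsD1 (0 : F)) [0 \in _]inE rE scale0r addr0 gR eqxx add1n ltnS.
  by apply: leq_trans; apply: subset_leq_card; apply/subsetP => k; rewrite !inE rE.
have dbl : (\sum_(k : F | k != 0%R) #|[set u : 'rV[F]_2 | (u != 0%R) && (g (R + k *: u)%R == 0%R)]|
     = \sum_(u : 'rV[F]_2 | u != 0%R) #|[set k : F | (k != 0%R) && (g (R + k *: u)%R == 0%R)]|)%N.
  under eq_bigr do rewrite -sum1dep_card big_mkcondr.
  rewrite exchange_big /=; apply: eq_bigr => u _.
  by rewrite -big_mkcondr sum1dep_card.
have := leq_sum (P := fun u : 'rV[F]_2 => u != 0) (index_enum _) cnt.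
rewrite -dbl (eq_bigr (fun=> (#|Z| - 1)%N) sh) !sum_neq0_const card_rV Fq -[(q ^ 2).-1]subn1.
have -> : (q ^ 2 - 1 = q.-1 * (q + 1))%N by rewrite -subn1 -(subn_sqr q 1).
rewrite -mulnA leq_pmul2l; last by rewrite -subn1 subn_gt0.
by move=> h; rewrite -leq_subLR.
Qed.

(** Induction on e. If a line through a zero R consists of zeros, dividing by its equation leaves a
    function of smaller degree, and the line adds at most q zeros. Without such a line there are at
    most 1 + (q + 1) e zeros, fewer than (e + 1) q as e + 1 < q. In case of equality the line is
    disjoint from the zeros of the quotient, hence parallel to the direction in which the quotient
    is constant. *)
Lemma polfun2_zeros e (g : 'rV[F]_2 -> F) : (e < q)%N -> polfun e g ->
  (exists x, g x != 0) ->
  (#|[set x | g x == 0%R]| <= e * q)%N /\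
  (#|[set x | g x == 0%R]| = (e * q)%N -> exists2 u, u != 0 & forall x k, g (x + k *: u) = g x).
Proof.
elim: e g => [|e IH] g hq pg [x0 gx0].
  have [c gc] : exists c, forall x, g x = c.
    have [G [gG hG]] := polfun_top pg; exists (g x0) => x.
    have [r [r1 r2 r3]] := hG x0 (x - x0).
    have := r3 1; rewrite scale1r addrC subrK => <-.
    by have := r3 0; rewrite scale0r addr0 (size1_polyC r1) !hornerC => ->.
  have -> : [set x | g x == 0] = set0.
    by apply/setP => x; rewrite !inE gc -(gc x0) (negbTE gx0).
  rewrite cards0; split=> // _; exists (delta_mx 0 0) => [|x k]; last by rewrite !gc.
  by apply/eqP => /matrixP/(_ 0 0); rewrite !mxE !eqxx => /eqP; rewrite oner_eq0.
pose Z := [set x | g x == 0]; rewrite -/Z.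
have [Z0|[R]] := set_0Vmem Z.
  by rewrite Z0 cards0; split=> //; nia.
rewrite inE => /eqP gR.
have [/existsP[u /andP[u0 /forallP hu]]|nl] :=
    boolP [exists u : 'rV[F]_2, (u != 0) && [forall k, g (R + k *: u) == 0]]; last first.
  have lt : (#|Z| < e.+1 * q)%N.
    apply: leq_ltn_trans (_ : 1 + (q + 1) * e < _)%N; last by lia.
    apply: no_line_count pg gR _ => u u0; apply/existsP; apply: contraR nl.
    rewrite negb_exists => /forallP h; apply/existsP; exists u; rewrite u0 /=.
    by apply/forallP => k; have := h k; rewrite negbK.
  by split; [exact: ltnW | move=> h; rewrite h ltnn in lt].
have [c [y [uc yc kerc]]] := orth_line u0.
have [|x hx|g' pg' gg'] := @polfun_div _ _ _ g c R y pg.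
- by rewrite yc mxE eqxx.
- have [|t ht] := kerc (x - R); first by rewrite [_ *m c]mx11_scalar hx raddf0.
  by apply/eqP; have := hu t; rewrite -ht addrC subrK.
have ex' : exists x, g' x != 0.
  by exists x0; apply: contra gx0; rewrite gg' => /eqP ->; rewrite mulr0.
have [le1 eq1] := IH g' (ltnW hq) pg' ex'.
pose Z' := [set x | g' x == 0]; rewrite -/Z' in le1 eq1.
pose M := [set R + t *: u | t : F].
have cM : #|M| = q.
  by rewrite card_imset ?Fq // => s t /addrI /eqP; rewrite -subr_eq0 -scalerBl scaler_eq0 (negbTE u0) orbF subr_eq0 => /eqP.
have ZE : Z = M :|: Z'.
  apply/setP => x; rewrite !inE gg' mulf_eq0; congr (_ || _).
  apply/eqP/imsetP => [h|[t _ ->]].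
    have [|t ht] := kerc (x - R); first by rewrite [_ *m c]mx11_scalar h raddf0.
    by exists t; rewrite // -ht addrC subrK.
  by rewrite addrC addKr -scalemxAl uc scaler0 mxE.
have cU : (#|Z| + #|M :&: Z'| = q + #|Z'|)%N by rewrite ZE cardsUI cM.
split.
  by rewrite -(leq_add2r #|M :&: Z'|) cU mulSn -addnA leq_add2l (leq_trans le1) // leq_addr.
move=> cZ; have cZ' : #|Z'| = (e * q)%N.
  by move: cU le1 cZ; move: #|Z| #|M :&: Z'| #|Z'| => a b k; rewrite mulSn; lia.
have MZ : M :&: Z' = set0.
  apply/eqP; rewrite -cards_eq0; move: cU cZ cZ'.
  by move: #|Z| #|M :&: Z'| #|Z'| => a b k; rewrite mulSn; lia.
have [u' u'0 hu'] := eq1 cZ'.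
(* If the quotient has no zeros then e = 0 and it is constant, so the direction of the removed line
   serves. *)
have [Z'0|[R']] := set_0Vmem Z'.
  have e0 : e = 0%N by move: cZ'; rewrite Z'0 cards0; case: (e) => // e'; lia.
  exists u => // x k; rewrite !gg'; congr (_ * _).
    by rewrite addrAC mulmxDl -scalemxAl uc scaler0 addr0.
  have [r sz rE] := polfun_line x u pg'.
  have := rE 0; rewrite scale0r addr0 => <-; rewrite -rE.
  by rewrite e0 in sz; rewrite (size1_polyC sz) !hornerC.
rewrite inE => gR'.
exists u' => // x k; rewrite !gg' hu'; congr (_ * _).
suff -> : (x + k *: u' - R) *m c = (x - R) *m c by [].
rewrite addrAC mulmxDl -scalemxAl.
suff -> : u' *m c = 0 by rewrite scaler0 addr0.
apply/eqP; apply: contraT => u'c.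
have u'c0 : (u' *m c) 0 0 != 0.
  by apply: contra u'c; rewrite {2}[_ *m c]mx11_scalar => /eqP ->; rewrite raddf0.
(* The parameter at which the line through R' in the direction u' would meet the removed line. *)
pose k0 := - ((R' - R) *m c) 0 0 / (u' *m c) 0 0.
have : R' + k0 *: u' \in M :&: Z'.
  rewrite !inE hu' gR' andbT; apply/imsetP.
  have [|t ht] := kerc (R' + k0 *: u' - R).
    rewrite addrAC mulmxDl -scalemxAl; apply/rowP => i; rewrite !ord1 [LHS]mxE [X in _ + X]mxE.
    by rewrite divfK // subrr mxE.
  by exists t; rewrite // -ht [RHS]addrC subrK.
by rewrite MZ inE.
Qed.
End PlaneCount.

(** * Counting vectors and projective points *)

Section Counting.
Variables (F : finFieldType) (q : nat).
Hypothesis Fq : #|F| = q.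

Let q1 : (1 < q)%N := q_gt1 Fq.

Definition zeros n (f : {mpoly F[n]}) : {set 'rV[F]_n} := [set v : 'rV[F]_n | f.@[v 0] == 0].

Lemma card_proj_point n (v : 'rV[F]_n) : v != 0 -> #|proj_point v| = q.-1.
Proof.
move=> v0; rewrite /proj_point card_in_imset => [|a b _ _ /eqP].
  by rewrite -(eq_card (A := predC1 (0 : F))) ?cardC1 ?Fq // => a; rewrite !inE.
by rewrite -subr_eq0 -scalerBl scaler_eq0 (negbTE v0) orbF subr_eq0 => /eqP.
Qed.

(** The affine cone consists of 0 and of q - 1 vectors for each point. All later counts are of
    vectors. *)
Lemma num_pointsE n d (f : {mpoly F[n]}) : f \is d.-homog -> (0 < d)%N ->
  (num_points f * q.-1 + 1 = #|zeros f|)%N.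
Proof.
move=> hf d0; pose S := [set v : 'rV[F]_n | (v != 0) && (f.@[v 0] == 0)].
have -> : #|zeros f| = (1 + #|S|)%N.
  rewrite (cardsD1 0) inE (meval_homog0 hf d0) eqxx; congr (_ + _)%N.
  by apply: eq_card => v; rewrite !inE.
have mem (v w : 'rV[F]_n) : w \in proj_point v -> exists2 a, a != 0 & w = a *: v.
  by case/imsetP => a; rewrite inE => a0 ->; exists a.
have self (v : 'rV[F]_n) : v \in proj_point v.
  by apply/imsetP; exists 1; rewrite ?inE ?oner_neq0 // scale1r.
have ppS (v w : 'rV[F]_n) : w \in proj_point v -> proj_point w = proj_point v.
  case/mem => a a0 ->; apply/setP => x; apply/imsetP/imsetP => -[b]; rewrite inE => b0 ->.
    by exists (b * a); rewrite ?inE ?mulf_neq0 // scalerA.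
  by exists (b / a); rewrite ?inE ?mulf_neq0 ?invr_eq0 // scalerA divfK.
pose Q := [set proj_point v | v in S].
have part : partition Q S.
  apply/and3P; split.
  - apply/eqP/setP => v; apply/bigcupP/idP => [[B /imsetP[w]]|vS]; last first.
      by exists (proj_point v); rewrite ?self // imset_f.
    rewrite inE => /andP[w0 fw] -> /mem[a a0 ->].
    by rewrite inE scaler_eq0 negb_or a0 w0 (meval_homogZ _ _ hf) (eqP fw) mulr0 /=.
  - apply/trivIsetP => A B /imsetP[v _ ->] /imsetP[w _ ->] ne.
    rewrite -setI_eq0; apply/eqP/setP => x; rewrite !inE; apply/negP => /andP[xv xw].
    by case/eqP: ne; rewrite -(ppS _ _ xv) (ppS _ _ xw).
  - by apply/negP => /imsetP[v _ h]; have := self v; rewrite -h inE.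
have sizes : {in Q, forall A : {set 'rV[F]_n}, #|A| = q.-1}.
  by move=> A /imsetP[v]; rewrite inE => /andP[v0 _] ->; apply: card_proj_point.
by rewrite (card_uniform_partition sizes part) addnC; congr (_ + _ * _)%N.
Qed.

Lemma card_split (X : finType) n k (h : X -> 'rV[F]_n) (B : 'M[F]_(k, n)) (P : pred 'rV[F]_n) :
  injective (fun z : 'rV[F]_k * X => h z.2 + z.1 *m B) -> (#|X| * q ^ k = q ^ n)%N ->
  #|[set v | P v]| = (\sum_(w : 'rV[F]_k) #|[set x : X | P (h x + w *m B)%R]|)%N.
Proof.
move=> inj cX.
have bij : bijective (fun z : 'rV[F]_k * X => h z.2 + z.1 *m B).
  by apply: inj_card_bij inj _; rewrite card_prod !(card_rV Fq) -cX mulnC.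
rewrite -sum1dep_card (reindex _ (onW_bij _ bij)) /=.
under [RHS]eq_bigr do rewrite -sum1dep_card.
by rewrite pair_big_dep.
Qed.

Lemma card_split_mx m n k (A : 'M[F]_(m, n)) (B : 'M[F]_(k, n)) (P : pred 'rV[F]_n) :
  row_free (col_mx A B) -> (m + k = n)%N ->
  #|[set v | P v]| = (\sum_(w : 'rV[F]_k) #|[set x : 'rV[F]_m | P (x *m A + w *m B)%R]|)%N.
Proof.
move=> rf mk; apply: card_split; last by rewrite (card_rV Fq) -expnD mk.
move=> [w x] [w' x'] /=; rewrite -!mul_row_col => /(row_free_inj rf).
by move/eq_row_mx => [-> ->].
Qed.

Lemma card_split_vec n k (P0 : 'rV[F]_n) (B : 'M[F]_(k, n)) (P : pred 'rV[F]_n) :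
  row_free (col_mx P0 B) -> (1 + k = n)%N ->
  #|[set v | P v]| = (\sum_(w : 'rV[F]_k) #|[set t : F | P (t *: P0 + w *m B)%R]|)%N.
Proof.
move=> rf mk; apply: card_split; last by rewrite Fq -expnS -mk.
move=> [w x] [w' x'] /=; rewrite -!mul_scalar_mx -!mul_row_col => /(row_free_inj rf).
by move/eq_row_mx => [/matrixP/(_ 0 0)]; rewrite !mxE eqxx !mulr1n => -> ->.
Qed.

Lemma card_ker k (c : 'cV[F]_k) : c != 0 -> (#|[set w : 'rV[F]_k | w *m c == 0%R]| * q = q ^ k)%N.
Proof.
move=> c0.
have [i ci] : exists i, c i 0 != 0.
  apply/existsP; apply: contraT; rewrite negb_exists => /forallP h.
  by case/eqP: c0; apply/colP => i; rewrite mxE; apply/eqP; have := h i; rewrite negbK.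
pose y : 'rV[F]_k := (c i 0)^-1 *: delta_mx 0 i.
have yc : y *m c = 1%:M.
  by apply/rowP => j; rewrite !ord1 -scalemxAl -rowE !mxE mulVf.
have fib (a : F) : #|[set w : 'rV[F]_k | w *m c == a%:M]| = #|[set w : 'rV[F]_k | w *m c == 0]|.
  rewrite -[RHS](card_imset _ (addrI (a *: y))); apply: eq_card => w; rewrite inE.
  apply/eqP/imsetP => [h|[v]].
    exists (w - a *: y); last by rewrite addrC subrK.
    by rewrite inE mulmxBl -scalemxAl yc h scalemx1 subrr.
  by rewrite inE => /eqP vc ->; rewrite mulmxDl -scalemxAl yc vc scalemx1 addr0.
rewrite -(card_rV Fq) -cardsT -[RHS]sum1_card.
rewrite [RHS](partition_big (fun w : 'rV[F]_k => (w *m c) 0 0) predT) //=.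
rewrite [RHS](eq_bigr (fun=> #|[set w : 'rV[F]_k | w *m c == 0]|)) => [|a _].
  by rewrite sum_nat_const -Fq mulnC.
rewrite -(fib a) sum1dep_card; apply: eq_card => w; rewrite !inE /=.
by apply/eqP/eqP => [<-|->]; rewrite -?mx11_scalar // mxE eqxx mulr1n.
Qed.

Lemma poly_few_roots (r : {poly F}) e : (size r <= e)%N -> (e <= #|[set t | r.[t] == 0%R]|)%N -> r = 0.
Proof.
move=> sz ge; apply/eqP; apply: contraT => r0; case: e sz ge => [|e] sz ge.
  by move: sz; rewrite leqn0 size_poly_eq0 (negbTE r0).
by have := card_roots_line sz r0; rewrite leqNgt ge.
Qed.

Lemma poly_eq0_all (r : {poly F}) : (size r <= q)%N -> (forall t, r.[t] = 0) -> r = 0.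
Proof.
move=> sz h; apply: (poly_few_roots sz); rewrite -Fq -cardsT.
by apply: subset_leq_card; apply/subsetP => t _; rewrite inE h.
Qed.

Lemma size_ltS (r : {poly F}) n : (size r <= n.+1)%N -> r`_n = 0 -> (size r <= n)%N.
Proof.
move=> /leq_sizeP h rn; apply/leq_sizeP => j; rewrite leq_eqVlt => /orP[/eqP <-//|].
exact: h.
Qed.

(** * Threefolds: lines through a point, sections by a tangent space *)

Section Threefold.
Variables (K : closedFieldType) (iota : {rmorphism F -> K}) (d : nat) (f : {mpoly F[5]}).
Hypotheses (hf : f \is d.-homog) (ns : nonsingular iota f) (d2 : (1 < d)%N).

(** Lines through P are indexed by vectors w of a complement. For w nonzero, t -> f(w + t P) is a
    nonzero polynomial whose coefficient of t^d is f(P) = 0 and whose coefficient of t^(d-1) is the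
    derivative at P along w. It has at most d - 1 roots, and at most d - 2 for the q^3 tangent
    vectors w; w = 0 contributes at most q. *)
Lemma no_line_bound (P : 'rV[F]_5) : P != 0 -> f.@[P 0] = 0 ->
  (forall y, row_free (col_mx P y) -> exists t, f.@[(y + t *: P) 0] != 0) ->
  (#|zeros f| <= q + (q ^ 4 - q ^ 3) * d.-1 + (q ^ 3 - 1) * d.-2)%N.
Proof.
move=> P0 fP nl.
have rfP : row_free P by rewrite /row_free rank_rV P0.
have [W rfW] := @row_free_extend F 1 4 5 P rfP erefl.
rewrite (card_split_vec _ rfW erefl).
pose c := W *m gradient f P.
have gP := nonsingular_gradient_base ns P0 fP.
have Pg : P *m gradient f P = 0.
  apply/rowP => i; rewrite ord1 -gradientE (euler_homog _ hf) fP mulr0 mxE //.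
have c0 : c != 0.
  apply: contra gP => /eqP cW; apply/eqP; apply: gradient_eq0 => v.
  have [x ->] := row_free_full_sub v rfW (leqnn 5).
  by rewrite gradientE -mulmxA mul_col_mx Pg -/c cW col_mx0 mulmx0 mxE.
have bnd w : w != 0 -> (#|[set t : F | f.@[(t *: P + w *m W)%R 0%R] == 0%R]| <=
    if w *m c == 0%R then d.-2 else d.-1)%N.
  move=> w0; pose r := line_poly f (w *m W) P.
  have rE t : r.[t] = f.@[(t *: P + w *m W) 0] by rewrite line_polyE addrC.
  have r0 : r != 0.
    have [|t ht] := nl (w *m W).
      apply: row_free_ker => y; rewrite -[y]hsubmxK mul_row_col mulmxA -mul_row_col => /eqP.
      rewrite row_free_mul_eq0 // => /eqP /(congr1 (fun z => (lsubmx z, rsubmx z))).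
      rewrite row_mxKl row_mxKr !linear0 => -[-> yw].
      suff -> : rsubmx y = 0 by rewrite row_mx0.
      move: yw; rewrite [rsubmx y]mx11_scalar mul_scalar_mx => /eqP.
      by rewrite scaler_eq0 (negbTE w0) orbF => /eqP ->; rewrite raddf0.
    by apply: contra ht => /eqP r0; rewrite addrC -rE r0 horner0.
  have sz : (size r <= d)%N.
    by apply: size_ltS; [exact: size_line_poly | rewrite (lead_line_poly _ _ hf)].
  rewrite (eq_card (B := [set t | r.[t] == 0])); last by move=> t; rewrite !inE rE.
  apply: card_roots_line r0; case: eqP => wc; last by rewrite prednK // ltnW.
  rewrite prednK; last by case: (d) d2 => [|[]].
  apply: size_ltS; first by rewrite prednK // ltnW.
  by rewrite (sublead_line_poly _ _ hf) 1?ltnW // gradientE -mulmxA wc mxE.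
rewrite (bigD1 0) //= -addnA leq_add //.
  by rewrite -Fq; apply: max_card.
apply: leq_trans (leq_sum _ bnd) _.
have cK := card_ker c0; rewrite expnS mulnC in cK.
have {}cK : #|[set w : 'rV[F]_4 | w *m c == 0]| = (q ^ 3)%N.
  by apply/eqP; rewrite -(@eqn_pmul2l q) ?cK // ltnW.
rewrite (bigID (fun w : 'rV[F]_4 => w *m c == 0)) /= addnC.
rewrite (eq_bigr (fun=> d.-1)) => [|w /andP[_ /negbTE->]] //.
rewrite [X in (_ + X <= _)%N](eq_bigr (fun=> d.-2)) => [|w /andP[_ ->]] //.
rewrite !sum_nat_const; apply: leq_add; rewrite leq_mul2r; apply/orP; right.
  rewrite (eq_card (B := ~: [set w : 'rV[F]_4 | w *m c == 0])).
    by rewrite cardsCs setCK cK (card_rV Fq).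
  move=> w; rewrite -topredE /= !inE; have [->|_ //] := eqVneq w 0.
  by rewrite mul0mx eqxx.
rewrite (eq_card (B := [set w : 'rV[F]_4 | w *m c == 0] :\ 0)).
  by rewrite -(leq_add2l 1) -{1}[1%N](_ : (0 \in [set w : 'rV[F]_4 | w *m c == 0]) = 1%N :> nat)
     -?cardsD1 ?cK ?inE ?mul0mx ?eqxx // subnKC // expn_gt0 ltnW.
by move=> w; rewrite !inE.
Qed.

(** Completing P to a basis of T_P provides U. A vector t P + a U of T_P is a zero exactly when a is
    a zero on the base, whatever t is; this explains the factor q. *)
Lemma cone_output (P : 'rV[F]_5) : P != 0 -> f.@[P 0] = 0 ->
  (forall U : 'M[F]_(3, 5), (col_mx P U == tangent_space f P)%MS ->
     restrict (col_mx P U) f = restrict (col_mx 0 U) f) ->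
  exists U : 'M[F]_(3, 5),
   [/\ tangent_section_cone f P U,
       hypersurface d (restrict U f) /\ nonsingular iota (restrict U f)
     & (#|zeros (restrict U f)| * q = #|[set v : 'rV[F]_5 | (f.@[v 0%R] == 0%R) && ((dirder v f).@[P 0%R] == 0%R)]|)%N].
Proof.
move=> P0 fP cone.
have gP := nonsingular_gradient_base ns P0 fP.
pose T := tangent_space f P.
have rkT : \rank T = 4.
  rewrite mxrank_ker; have -> // : \rank (gradient f P) = 1%N.
  by rewrite -mxrank_tr rank_rV trmx_eq0 gP.
have PT : (P <= T)%MS.
  apply/sub_kermxP/rowP => i.
  by rewrite ord1 -gradientE (euler_homog _ hf) fP mulr0 mxE.
have [B BT rfB] : exists2 B : 'M[F]_(4, 5), (B :=: T)%MS & row_free B.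
  suff : exists2 B : 'M[F]_(\rank T, 5), (B :=: T)%MS & row_free B by rewrite rkT.
  by exists (row_base T); [exact: eq_row_base | exact: row_base_free].
have /submxP[x Px] : (P <= B)%MS by rewrite BT.
have rfx : row_free x.
  rewrite /row_free rank_rV; suff -> : x != 0 by [].
  by apply: contra P0 => /eqP x0; rewrite Px x0 mul0mx.
have [X rfX] := @row_free_extend F 1 3 4 x rfx erefl.
pose U := X *m B.
have PUE : col_mx P U = col_mx x X *m B by rewrite mul_col_mx -Px.
have rfU : row_free (col_mx P U).
  by rewrite PUE /row_free mxrankMfree.
have eqT : (col_mx P U == T)%MS.
  have sub : (col_mx P U <= T)%MS by rewrite -BT PUE submxMl.
  by rewrite sub /= -(mxrank_leqif_sup sub) (eqP rfU) rkT.
have coneU := cone U eqT.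
have nsU : nonsingular iota (restrict U f).
  by apply: (cone_base_nonsingular hf ns d2 P0 fP rfU _ coneU); case/andP: eqT.
exists U; split.
- by split=> //; rewrite cone_equation.
- split=> //; split; last exact: dhomog_restrict.
  apply/eqP => U0; case: nsU; exists (delta_mx 0 0); rewrite U0; split.
  + by apply/eqP => /matrixP/(_ 0 0); rewrite !mxE !eqxx => /eqP; rewrite oner_eq0.
  + by rewrite raddf0 meval0.
  + by move=> i; rewrite mderiv0 raddf0 meval0.
(* A direction [u] transversal to T_P: in the splitting of F^5 only the zero multiple of [u]
   contributes to the count on T_P. *)
have [u rfu] := @row_free_extend F 4 1 5 (col_mx P U) rfU erefl.
have up : (dirder u f).@[P 0] != 0.
  apply: contra gP => /eqP du; apply/eqP; apply: gradient_eq0 => v.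
  have [y ->] := row_free_full_sub v rfu (leqnn 5).
  have /sub_kermxP PU0 : (col_mx P U <= T)%MS by case/andP: eqT.
  rewrite gradientE -[y]hsubmxK mul_row_col mulmxDl -!mulmxA PU0 mulmx0 add0r.
  have -> : u *m gradient f P = 0 by apply/rowP => i; rewrite ord1 -gradientE du mxE.
  by rewrite mulmx0 mxE.
rewrite (card_split_mx _ rfu erefl) (bigD1 0) //= [X in (_ + X)%N]big1 ?addn0 => [|w w0]; last first.
  apply/eqP; rewrite cards_eq0; apply/eqP/setP => y; rewrite !inE; apply/negbTE.
  rewrite negb_and; apply/orP; right.
  have /sub_kermxP PU0 : (col_mx P U <= T)%MS by case/andP: eqT.
  rewrite gradientE mulmxDl -!mulmxA PU0 mulmx0 add0r [w]mx11_scalar mul_scalar_mx.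
  rewrite mxE -gradientE mulf_neq0 //; apply: contra w0 => /eqP w0.
  by rewrite [w]mx11_scalar w0 raddf0.
pose h (z : F * 'rV[F]_3) : 'rV[F]_(1 + 3) := row_mx z.1%:M z.2.
have inj : injective h.
  move=> [s a] [s' a']; rewrite /h /= => hh; have [/matrixP/(_ 0 0)] := @eq_row_mx _ 1 1 3 _ _ _ _ hh.
  by rewrite !mxE eqxx !mulr1n => -> ->.
rewrite -Fq mulnC -cardsT -cardsX -(card_imset _ inj).
apply: eq_card => y; rewrite !inE mul0mx addr0; apply/imsetP/andP => [[[s a]]|[fy dy]].
  rewrite !inE /= => fa ->; rewrite meval_restrict in fa; split.
    by rewrite -(meval_restrict (col_mx P U)) coneU meval_restrict /h /= (@mul_row_col _ 1 1 3) mulmx0 add0r.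
  have /sub_kermxP PU0 : (col_mx P U <= T)%MS by case/andP: eqT.
  by rewrite gradientE -mulmxA PU0 mulmx0 mxE.
exists (lsubmx y 0 0, rsubmx y); last by rewrite /h /= -mx11_scalar hsubmxK.
rewrite !inE /= meval_restrict.
by move: fy; rewrite -(meval_restrict (col_mx P U)) coneU meval_restrict -{1}[y](@hsubmxK _ 1 1 3) (@mul_row_col _ 1 1 3) mulmx0 add0r.
Qed.
End Threefold.
End Counting.

(* A multiplicative and additive power map is a power of Frobenius. *)
Lemma additive_power_bound (F : finFieldType) e : (0 < e)%N -> (e < #|F|)%N ->
  (forall s t : F, (s + t) ^+ e = s ^+ e + t ^+ e) -> (2 * e <= #|F|)%N.
Proof.
move=> e0 eq add.
have polyE : (1 + 'X) ^+ e = 1 + 'X^e :> {poly F}.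
  apply/eqP; rewrite -subr_eq0; apply/eqP; apply: (poly_eq0_all (erefl #|F|)).
    apply: leq_trans eq; rewrite (leq_trans (size_polyD _ _)) // geq_max size_polyN.
    apply/andP; split; last first.
      by rewrite (leq_trans (size_polyD _ _)) // geq_max size_poly1 size_polyXn /=.
    rewrite (leq_trans (size_poly_exp_leq _ _)) // addrC size_XaddC /= mul1n //.
  by move=> t; rewrite !hornerE add expr1n subrr.
have [p pp pF] := finPcharP F.
(* With e = P m, P a power of p and m prime to p, one has (1 + X)^e = (1 + X^P)^m, whose coefficient
   of X^P is m, nonzero in F. In 1 + X^e this coefficient is zero unless m = 1. *)
pose P := (e`_p)%N; pose m := (e`_p^')%N.
have eE : e = (P * m)%N by rewrite partnC.
have P0 : (0 < P)%N := part_gt0 _ _.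
have m0 : (0 < m)%N := part_gt0 _ _.
have m1 : m = 1%N.
  apply/eqP; rewrite eqn_leq m0 andbT leqNgt; apply/negP => m1.
  have := congr1 (fun r : {poly F} => r`_P) polyE.
  rewrite coefD coefC coefXn eqn0Ngt P0 add0r.
  have -> : (P == e) = false by rewrite eE; apply/negbTE; rewrite neq_ltn ltn_Pmulr.
  have PF : [pchar {poly F}].-nat P.
    apply: sub_in_pnat (part_pnat p e) => r _; rewrite inE => /eqP ->.
    by rewrite pchar_poly.
  rewrite {1}eE exprM (exprDn_pchar _ _ PF).
  rewrite expr1n exprDn coef_sum (bigD1 (inord 1)) //= inordK ?ltnS // big1 ?addr0; last first.
    move=> i hi; rewrite expr1n mul1r -exprM coefMn coefXn.
    have -> : (P == P * i)%N = false; last by rewrite mul0rn.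
    apply: contraNF hi => /eqP h; apply/eqP/val_inj; rewrite /= inordK ?ltnS //.
    by apply/eqP; rewrite -(eqn_pmul2l P0) -h muln1.
  rewrite expr1n mul1r expr1 coefMn coefXn eqxx bin1 => /eqP.
  rewrite -(dvdn_pcharf pF) => /(dvdn_trans (dvdnn p)).
  have : p^'.-nat m := part_pnat _ _.
  by rewrite p'natE // => /negP.
have eP : (e = p ^ logn p e)%N by rewrite -p_part {1}eE m1 muln1.
have [n qE] : exists n, #|F| = (p ^ n)%N.
  have : (p.-group [set: F])%g by apply/abelem_pgroup/fin_ring_pchar_abelem.
  by move/card_pgroup; rewrite cardsT => ->; eexists.
(* Both e and q are powers of p and e < q, so p e <= q. *)
move: eq; rewrite eP qE ltn_exp2l ?prime_gt1 // => kn.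
apply: leq_trans (_ : (p ^ (logn p e).+1 <= _)%N); last by rewrite leq_exp2l ?prime_gt1.
by rewrite expnS leq_mul2r prime_gt1 // orbT.
Qed.

Lemma card_span_vec (F : finFieldType) n (v : 'rV[F]_n) : v != 0 ->
  #|[set c *: v | c : F]| = #|F|.
Proof.
move=> v0; rewrite card_imset // => a b /eqP.
by rewrite -subr_eq0 -scalerBl scaler_eq0 (negbTE v0) orbF subr_eq0 => /eqP.
Qed.

(** * Planes through a line contained in the threefold *)

Section Line.
Variables (F : finFieldType) (q : nat).
Hypothesis Fq : #|F| = q.
Variables (K : closedFieldType) (iota : {rmorphism F -> K}) (e : nat) (f : {mpoly F[5]}).
Local Notation d := e.+1.
Hypotheses (hf : f \is d.-homog) (ns : nonsingular iota f) (e0 : (0 < e)%N) (eq : (e < q)%N).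
Variables (L : 'M[F]_(2, 5)) (W : 'M[F]_(3, 5)).
Hypotheses (rf : row_free (col_mx L W)) (fL : forall x : 'rV_2, f.@[(x *m L) 0] = 0).

Let q1 : (1 < q)%N := q_gt1 Fq.

(* The equation of V(f), off the line [L], on the plane spanned by [L] and [w *m W]. *)
Definition slice (w : 'rV[F]_3) (x : 'rV[F]_2) : F := f.@[(x *m L + w *m W) 0].

Definition slice_zeros (w : 'rV[F]_3) : nat := #|[set x | slice w x == 0]|.

(** The derivative of f in the direction w at the point x of the line. It is also the part of degree
    e of [slice w], and it is linear in w. *)
Definition slope (x : 'rV[F]_2) (w : 'rV[F]_3) : F := (dirder (w *m W) f).@[(x *m L) 0].

(** Translation by u moves along lines through the point u of L; under this invariance the zeros off
    L form a union of such lines. *)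
Definition slice_inv (u : 'rV[F]_2) (w : 'rV[F]_3) :=
  [forall x, forall k : F, slice w (x + k *: u) == slice w x].

Lemma slice_invP u w : reflect (forall x (k : F), slice w (x + k *: u) = slice w x) (slice_inv u w).
Proof.
apply: (iffP forallP) => [h x k|h x]; first by have /forallP/(_ k)/eqP := h x.
by apply/forallP => k; rewrite h.
Qed.

Lemma slice0 x : slice 0 x = 0.
Proof. by rewrite /slice mul0mx addr0 fL. Qed.

Lemma sliceZ (r : F) w x : r != 0 -> slice (r *: w) x = r ^+ d * slice w (r^-1 *: x).
Proof.
move=> r0; rewrite /slice -(meval_homogZ r _ hf); congr (meval _ _).
by rewrite scalerDr -!scalemxAl scalerA divff // scale1r.
Qed.

Lemma slice_invZ u w r : slice_inv u w -> slice_inv u (r *: w).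
Proof.
move/slice_invP => h; apply/slice_invP => x k.
have [->|r0] := eqVneq r 0; first by rewrite scale0r !slice0.
by rewrite !sliceZ // scalerDr scalerA h.
Qed.

Lemma slice_zerosZ r w : r != 0 -> slice_zeros (r *: w) = slice_zeros w.
Proof.
move=> r0; rewrite /slice_zeros -[RHS](card_imset _ (scalerI r0 : injective (fun x => r *: x))).
apply: eq_card => x; rewrite inE sliceZ // mulf_eq0 expf_eq0 (negbTE r0) andbF /=.
apply/idP/imsetP => [h|[y]]; last by rewrite inE => h ->; rewrite scalerA mulVf // scale1r.
by exists (r^-1 *: x); rewrite ?inE // scalerA divff // scale1r.
Qed.

(** Otherwise f would vanish at all rational points of a plane; as e + 1 <= q it would vanish
    identically there, against [no_plane]. *)
Lemma slice_neq0 w : w != 0 -> exists x, slice w x != 0.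
Proof.
move=> w0; apply/existsP; apply: contraT; rewrite negb_exists => /forallP h.
have g0 x : slice w x = 0 by apply/eqP; have := h x; rewrite negbK.
pose A : 'M[F]_(2 + 1, 5) := col_mx L (w *m W).
have rfA : row_free A.
  apply: row_free_ker => y; rewrite -[y]hsubmxK mul_row_col mulmxA -mul_row_col => /eqP.
  rewrite row_free_mul_eq0 // => /eqP /(congr1 (fun z => (lsubmx z, rsubmx z))).
  rewrite row_mxKl row_mxKr !linear0 => -[-> yw].
  suff -> : rsubmx y = 0 by rewrite row_mx0.
  move: yw; rewrite [rsubmx y]mx11_scalar mul_scalar_mx => /eqP.
  by rewrite scaler_eq0 (negbTE w0) orbF => /eqP ->; rewrite raddf0.
case: (no_plane hf ns (e0 : (1 < d)%N) (A := A) erefl rfA).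
apply: (vanishing_homog_eq0 (dhomog_restrict A hf)); last by rewrite Fq.
move=> y; rewrite meval_restrict -[y](@hsubmxK _ 1 2 1) (@mul_row_col _ 1 2 1).
rewrite [rsubmx y]mx11_scalar mul_scalar_mx scalemxAl.
set r := rsubmx y 0 0; rewrite -/(slice _ _).
have [->|r0] := eqVneq r 0; first by rewrite scale0r slice0.
by rewrite sliceZ // g0 mulr0.
Qed.

(** In the plane spanned by L and w, f vanishes on L and is divisible by the coordinate along w. The
    slice is the quotient at the value 1 of this coordinate, whence degree e instead of e + 1. *)
Lemma slice_polfun w : polfun e (slice w).
Proof.
pose A : 'M[F]_(2 + 1, 5) := col_mx L (w *m W).
pose c : 'cV[F]_(2 + 1) := col_mx 0 1%:M.
have := @polfun_div F (2 + 1) e (fun y : 'rV_(2 + 1) => f.@[(y *m A) 0]) c 0 (row_mx 0 1%:M).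
case=> [||y|g' pg' gg'].
- apply: polfun_ext (polfun_affine A 0 (polfun_homog hf)) _ => y /=.
  by rewrite addr0.
- by rewrite mul_row_col mul0mx mul1mx add0r mxE eqxx.
- rewrite subr0 -[y]hsubmxK !mul_row_col mulmx0 add0r mulmx1 => h.
  by rewrite [rsubmx y]mx11_scalar h raddf0 mul0mx addr0 fL.
apply: polfun_ext (polfun_affine (row_mx 1%:M 0 : 'M_(2, 2 + 1)) (row_mx 0 1%:M) pg') _ => x /=.
have := gg' (x *m row_mx 1%:M 0 + row_mx 0 1%:M).
rewrite mul_mx_row mulmx1 mulmx0 add_row_mx addr0 add0r subr0 !mul_row_col.
by rewrite mulmx0 add0r mulmx1 mul1mx [_ 0 0]mxE eqxx mul1r.
Qed.

(** The slope is the top-degree part of the slice, so its vanishing lowers the degree. *)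
Lemma slice_polfun_drop w : (forall x, slope x w = 0) -> polfun e.-1 (slice w).
Proof.
move=> s0; have [G [pG hG]] := polfun_top (slice_polfun w).
case: e e0 eq hf s0 pG hG => // e' _ eq' hf' s0 pG hG /=.
apply: polfun_ext pG _ => u; suff -> : G u = 0 by rewrite subr0.
have [r [szr ru rE]] := hG 0 u.
pose p := line_poly f (w *m W) (u *m L).
have szp : (size p <= e'.+1)%N.
  apply: size_ltS; first apply: size_ltS; first exact: size_line_poly.
    by rewrite (lead_line_poly _ _ hf').
  by rewrite (sublead_line_poly _ _ hf') //; apply: s0.
suff rp : r = p by rewrite -ru rp nth_default.
apply/eqP; rewrite -subr_eq0; apply/eqP; apply: (poly_eq0_all Fq) => [|t].
  rewrite (leq_trans (size_polyD _ _)) // geq_max size_polyN.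
  by rewrite (leq_trans szr) // (leq_trans szp) // ltnW.
by rewrite hornerD hornerN rE line_polyE add0r /slice -scalemxAl [w *m W + _]addrC subrr.
Qed.

Lemma slice_zeros_le w : w != 0 -> (slice_zeros w <= e * q)%N.
Proof. by move/slice_neq0 => nz; case: (polfun2_zeros Fq eq (slice_polfun w) nz). Qed.

Lemma slice_zeros_eq w : w != 0 -> slice_zeros w = (e * q)%N ->
  exists2 u, u != 0 & slice_inv u w.
Proof.
move/slice_neq0 => nz zw; have [_ /(_ zw)[u u0 hu]] := polfun2_zeros Fq eq (slice_polfun w) nz.
by exists u => //; apply/slice_invP.
Qed.

Lemma slice_zeros_drop w : w != 0 -> (forall x, slope x w = 0) -> (slice_zeros w <= e.-1 * q)%N.
Proof.
move=> /slice_neq0 nz s0.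
have lt : (e.-1 < q)%N by apply: leq_ltn_trans (leq_pred _) eq.
by case: (polfun2_zeros Fq lt (slice_polfun_drop s0) nz).
Qed.

Lemma slope_coef x w : (line_poly f (x *m L) (w *m W))`_1 = slope x w.
Proof. exact: coef1_line_poly. Qed.

(** The polynomials t -> f(x L + t w W) for x and for x + k u agree on F and have the same leading
    coefficient. As their difference has degree at most e < q, they are equal, and so are their
    coefficients of t. *)
Lemma slope_inv u w x k : slice_inv u w -> slope (x + k *: u) w = slope x w.
Proof.
move=> hu; rewrite -!slope_coef.
suff -> : line_poly f ((x + k *: u) *m L) (w *m W) = line_poly f (x *m L) (w *m W) by [].
apply/eqP; rewrite -subr_eq0; apply/eqP; apply: (poly_eq0_all Fq) => [|t].
  apply: leq_trans eq; apply: size_ltS.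
    by rewrite (leq_trans (size_polyD _ _)) // geq_max size_polyN !size_line_poly.
  by rewrite coefB !(lead_line_poly _ _ hf) subrr.
rewrite hornerD hornerN !line_polyE !scalemxAl -!/(slice _ _).
by have /slice_invP-> := slice_invZ t hu; rewrite subrr.
Qed.

Lemma slopeZ a x w : slope (a *: x) w = a ^+ e * slope x w.
Proof. by rewrite /slope -scalemxAl (meval_homogZ _ _ (dhomog_dirder _ hf)). Qed.

Lemma slope_lin x a w v : slope x (a *: w + v) = a * slope x w + slope x v.
Proof. by rewrite /slope mulmxDl -scalemxAl dirder_linl. Qed.

Lemma slope_scale x a w : slope x (a *: w) = a * slope x w.
Proof.
rewrite -[a *: w]addr0 slope_lin [X in _ + X]/slope mul0mx dirderE.
by rewrite big1 ?addr0 // => i _; rewrite mxE mul0r.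
Qed.

Lemma slope0 w : slope 0 w = 0.
Proof. by rewrite -(scale0r (0 : 'rV_2)) slopeZ expr0n eqn0Ngt e0 mul0r. Qed.

Lemma slope_inv0 u w : slice_inv u w -> slope u w = 0.
Proof. by move=> h; rewrite -(slope0 w) -(slope_inv 0 1 h) scale1r add0r. Qed.

Lemma dirder_line (x y : 'rV[F]_2) : (dirder (y *m L) f).@[(x *m L) 0] = 0.
Proof.
rewrite -coef1_line_poly (poly_eq0_all Fq (r := line_poly _ _ _)) ?coef0 // => [|t].
  apply: leq_trans eq; apply: size_ltS; first exact: size_line_poly.
  by rewrite (lead_line_poly _ _ hf) fL.
by rewrite line_polyE scalemxAl -mulmxDl fL.
Qed.

Lemma dirder_slope (x y : 'rV[F]_2) w : (dirder (y *m L + w *m W) f).@[(x *m L) 0] = slope x w.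
Proof. by rewrite -[y *m L]scale1r dirder_linl dirder_line mulr0 add0r. Qed.

(** At a point of L the derivatives along L vanish, so nonsingularity makes the slope a nonzero
    linear form in w. *)
Lemma slope_ker_card u : u != 0 -> #|[set w | slope u w == 0]| = (q ^ 2)%N.
Proof.
move=> u0; have rfL : row_free L.
  apply: row_free_ker => y yL; have : row_mx y 0 *m col_mx L W = 0.
    by rewrite mul_row_col yL mul0mx addr0.
  move/eqP; rewrite row_free_mul_eq0 // => /eqP h.
  by rewrite -[y](row_mxKl _ (0 : 'rV_3)) h linear0.
pose c := W *m gradient f (u *m L).
have sE w : slope u w = (w *m c) 0 0 by rewrite /slope gradientE mulmxA.
have c0 : c != 0.
  have := nonsingular_gradient_base ns (_ : u *m L != 0) (fL u).
  rewrite row_free_mul_eq0 // => /(_ u0); apply: contra => /eqP cW.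
  apply/eqP; apply: gradient_eq0 => v.
  have [x ->] := row_free_full_sub v rf (leqnn 5).
  rewrite -[x]hsubmxK mul_row_col dirder_slope sE cW mulmx0 mxE //.
have := card_ker Fq c0; rewrite expnS mulnC => /eqP.
rewrite eqn_pmul2l ?(ltnW q1) // => /eqP <-; apply: eq_card => w; rewrite !inE sE.
apply/eqP/eqP => [h|->]; last by rewrite mxE.
by rewrite [w *m c]mx11_scalar h raddf0.
Qed.

Lemma card_zeros_slice : #|zeros f| = (q ^ 2 + \sum_(w | w != 0%R) slice_zeros w)%N.
Proof.
rewrite /zeros (card_split_mx Fq _ rf erefl) (bigD1 0) //=; congr (_ + _)%N.
rewrite (eq_card (B := setT)) ?cardsT ?(card_rV Fq) // => x.
by rewrite !inE mul0mx addr0 fL eqxx.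
Qed.
Definition full w := (w != 0) && (slice_zeros w == (e * q)%N).

(* [option F] indexes the q + 1 points of the line [L]. *)
Definition direction (o : option F) : 'rV[F]_2 :=
  if o is Some a then a *: delta_mx 0 0 + delta_mx 0 1 else delta_mx 0 0.

Lemma directionE o : direction o = \row_(i < 2) (if o is Some a then [:: a; 1]`_i else [:: 1; 0]`_i).
Proof.
by apply/rowP => i; rewrite !mxE; case: o => [a|]; rewrite ?mxE; case: i => [[|[|]]] //= _;
  rewrite ?mulr1 ?mulr0 ?addr0 ?add0r.
Qed.

Lemma row2P (u v : 'rV[F]_2) : u 0 0 = v 0 0 -> u 0 1 = v 0 1 -> u = v.
Proof.
move=> h0 h1; apply/rowP => -[[|[|//]] hi].
  by rewrite (_ : Ordinal hi = 0) //; apply: val_inj.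
by rewrite (_ : Ordinal hi = 1) //; apply: val_inj.
Qed.

Lemma direction_cover u : u != 0 -> exists o (c : F), c != 0 /\ u = c *: direction o.
Proof.
move=> u0; have [y0|y0] := eqVneq (u 0 1) 0.
  exists None, (u 0 0); split; last by apply: row2P; rewrite directionE !mxE ?mulr1 ?mulr0.
  by apply: contra u0 => /eqP x0; apply/eqP/row2P; rewrite mxE.
exists (Some (u 0 0 / u 0 1)), (u 0 1); split=> //.
by apply: row2P; rewrite directionE !mxE /= ?mulr1 // mulrC divfK.
Qed.

Lemma direction_prop o1 o2 c : direction o1 = c *: direction o2 -> o1 = o2.
Proof.
rewrite !directionE => /rowP h; have := h 0; have := h 1; rewrite !mxE /=.
case: o1 o2 {h} => [a|] [b|] /=; rewrite ?mulr1 ?mulr0 => // h1 h2.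
- by rewrite h2 -h1 mul1r.
- by move/eqP: h1; rewrite oner_eq0.
- by rewrite -h1 mul0r in h2; move/eqP: h2; rewrite oner_eq0.
Qed.

Lemma direction_span o1 o2 v : o1 != o2 -> exists s t, v = s *: direction o1 + t *: direction o2.
Proof.
case: o1 o2 => [a|] [b|] // ne.
- have ab : a - b != 0 by rewrite subr_eq0; apply: contra ne => /eqP ->.
  pose s := (v 0 0 - v 0 1 * b) / (a - b); exists s, (v 0 1 - s).
  apply: row2P; rewrite !directionE !mxE /=; last by rewrite !mulr1 addrC subrK.
  by rewrite mulrBl addrCA -mulrBr divfK // addrC subrK.
- exists (v 0 1), (v 0 0 - v 0 1 * a).
  by apply: row2P; rewrite !directionE !mxE /= ?mulr1 ?mulr0 ?addr0 // addrC subrK.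
- exists (v 0 0 - v 0 1 * b), (v 0 1).
  by apply: row2P; rewrite !directionE !mxE /= ?mulr1 ?mulr0 ?add0r // subrK.
Qed.

Lemma direction_neq0 o : direction o != 0.
Proof.
apply/eqP => /rowP h; have := h 0; have := h 1; rewrite directionE !mxE.
by case: o {h} => [a|] /= /eqP h1 /eqP h2; move: h1 h2; rewrite ?oner_eq0.
Qed.

(** Planes are counted through vectors: each plane through L accounts for q - 1 vectors w. *)
Definition centered o := [set w | full w && slice_inv (direction o) w].

Lemma full_centered w : full w -> exists o, w \in centered o.
Proof.
move=> fw; have /andP[w0 /eqP zw] := fw.
have [u u0 hu] := slice_zeros_eq w0 zw; have [o [c [c0 uE]]] := direction_cover u0.
exists o; rewrite inE fw; apply/slice_invP => x k; move/slice_invP: hu => hu.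
by rewrite -(hu x (k / c)) uE scalerA divfK.
Qed.

Lemma fullZ c w : c != 0 -> full w -> full (c *: w).
Proof.
by move=> c0 /andP[w0 zw]; rewrite /full scaler_eq0 negb_or c0 w0 slice_zerosZ.
Qed.

Lemma centeredZ o c w : c != 0 -> w \in centered o -> c *: w \in centered o.
Proof. by move=> c0; rewrite !inE => /andP[fw iw]; rewrite fullZ // slice_invZ. Qed.

(** With zero slope the slice would have degree e - 1 and at most (e - 1) q zeros. *)
Lemma full_slope w : full w -> exists x, slope x w != 0.
Proof.
move=> /andP[w0 /eqP zw]; apply/existsP; apply: contraT; rewrite negb_exists => /forallP h.
have := slice_zeros_drop w0 (fun x => eqP (negbNE (h x))).
by rewrite zw leq_mul2r => /orP[|]; lia.
Qed.

Lemma full_le_sum : (#|[set w | full w]| <= \sum_o #|centered o|)%N.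
Proof.
have -> : (\sum_o #|centered o| = \sum_(w : 'rV[F]_3) #|[set o | w \in centered o]|)%N.
  under eq_bigr do rewrite -sum1_card big_mkcond.
  rewrite exchange_big; apply: eq_bigr => w _.
  by rewrite -big_mkcond /= sum1dep_card.
rewrite -sum1dep_card big_mkcond /=; apply: leq_sum => w _; case: ifP => // fw.
by have [o ho] := full_centered fw; apply/card_gt0P; exists o; rewrite inE.
Qed.

(** * Full planes on a threefold with many points *)

Section ManyPoints.
Hypothesis many : (q ^ 2 + e * q * (q ^ 3 - q) <= #|zeros f|)%N.

Lemma sum_slices : (e * q * (q ^ 3 - q) <= \sum_(w | w != 0%R) slice_zeros w)%N.
Proof. by move: many; rewrite card_zeros_slice leq_add2l. Qed.

Lemma sum_full : (\sum_(w | w != 0%R) full w = #|[set w | full w]|)%N.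
Proof.
rewrite -sum1dep_card -big_mkcondr /=; apply: eq_bigl => w.
by rewrite /full andbA andbb.
Qed.

(** A plane that is not full misses the maximum e q by at least 1. *)
Lemma sum_slices_full : (\sum_(w | w != 0%R) slice_zeros w + (q ^ 3 - 1)
   <= e * q * (q ^ 3 - 1) + #|[set w | full w]|)%N.
Proof.
rewrite -sum_full.
have cst c : (\sum_(w : 'rV[F]_3 | w != 0%R) c = (q ^ 3 - 1) * c)%N.
  by rewrite sum_neq0_const (card_rV Fq) subn1.
rewrite -[X in (_ + X <= _)%N]muln1 -(cst 1%N) [(e * q * _)%N]mulnC -cst -!big_split /=.
apply: leq_sum => w w0; have := slice_zeros_le w0; rewrite /full w0 /=.
by case: eqP => h; lia.
Qed.

Lemma full_many : (q ^ 3 - 1 <= #|[set w | full w]| + e * q * (q - 1))%N.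
Proof.
have := sum_slices; have := sum_slices_full; have : (q <= q ^ 3)%N by nia.
move: (\sum_(w | _) _)%N #|[set w | full w]| (q ^ 3)%N (e * q)%N => S N c M; nia.
Qed.

(** Two independent full vectors [w1] and [w2] with the same center have slopes that are multiples
    of t^e, for the same coordinate t on L vanishing at the center; some combination of them has
    slope zero. *)
Lemma pencil_base : exists2 w0, w0 != 0 & forall x, slope x w0 = 0.
Proof.
(* Pigeonhole over the q + 1 points of L: since e < q, there are more than (q + 1)(q - 1) full
   vectors. *)
have [o ho] : exists o, (q - 1 < #|centered o|)%N.
  apply/existsP; apply: contraT; rewrite negb_exists => /forallP h.
  have h' o : true -> (#|centered o| <= q - 1)%N by rewrite leqNgt h.
  have := leq_trans full_le_sum (leq_sum (index_enum _) h').
  rewrite sum_nat_const card_option Fq => le.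
  have := full_many; move: #|[set w | full w]| le => N; nia.
have [w1 hw1] : exists w1, w1 \in centered o by apply/card_gt0P; lia.
have w10 : w1 != 0 by move: hw1; rewrite inE => /andP[/andP[]].
have [w2 hw2 nw2] : exists2 w2, w2 \in centered o & w2 \notin [set c *: w1 | c : F].
  apply/exists_inP; apply: contraLR ho; rewrite negb_exists_in => /forall_inP h.
  pose A := [set c *: w1 | c : F] :\ 0.
  have sub : centered o \subset A.
    apply/subsetP => w hw; rewrite in_setD1.
    have := h w hw; rewrite negbK => ->; rewrite andbT.
    by move: hw; rewrite inE => /andP[/andP[]].
  rewrite -leqNgt (leq_trans (subset_leq_card sub)) //.
  have := card_span_vec w10; rewrite (cardsD1 0) Fq.
  have -> : (0 \in [set c *: w1 | c : F]) by apply/imsetP; exists 0; rewrite ?scale0r.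
  by move=> <-; rewrite addKn.
have [o' oo'] : exists o', o != o'.
  by case: (o) => [a|]; [exists None | exists (Some 0)].
pose u' := direction o'.
have sE w s t : w \in centered o -> slope (s *: direction o + t *: u') w = t ^+ e * slope u' w.
  by rewrite inE => /andP[_ iw]; rewrite addrC slope_inv // slopeZ.
have [c10|c10] := eqVneq (slope u' w1) 0.
  exists w1 => // x; have [s [t ->]] := direction_span x oo'.
  by rewrite sE // c10 mulr0.
exists (slope u' w2 *: w1 - slope u' w1 *: w2).
  rewrite subr_eq0; apply: contra nw2 => /eqP h; apply/imsetP.
  exists ((slope u' w1)^-1 * slope u' w2); rewrite // -scalerA h scalerA mulVf //.
  by rewrite scale1r.
move=> x; have [s [t ->]] := direction_span x oo'.
rewrite slope_lin -scaleNr slope_scale !sE // mulNr mulrCA [X in _ - X]mulrCA.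
by rewrite [slope u' w1 * _]mulrC subrr.
Qed.

(** * A plane tangent along the line, and the centers of the full planes *)

Section Base.
Variable w0 : 'rV[F]_3.
Hypotheses (w00 : w0 != 0) (sw0 : forall x, slope x w0 = 0).
Local Notation M := [set c *: w0 | c : F].

Lemma base_slope w x : w \in M -> slope x w = 0.
Proof. by case/imsetP => c _ ->; rewrite slope_scale sw0 mulr0. Qed.

Lemma base_not_full w : w \in M -> full w = false.
Proof.
by move=> wM; apply/negP => /full_slope[x]; rewrite base_slope // eqxx.
Qed.

Lemma card_base : #|M :\ 0| = (q - 1)%N.
Proof.
have := card_span_vec w00; rewrite (cardsD1 0) Fq.
have -> : (0 \in M) by apply/imsetP; exists 0; rewrite ?scale0r.
by move=> <-; rewrite addKn.
Qed.

(** The slices of the q - 1 nonzero multiples of [w0] have at most (e - 1) q zeros, so each falls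
    short by at least q, that is by q - 1 more than counted before. *)
Lemma full_many_base :
  (q ^ 3 - 1 + (q - 1) * (q - 1) <= #|[set w | full w]| + e * q * (q - 1))%N.
Proof.
have cst c : (\sum_(w : 'rV[F]_3 | w != 0%R) c = (q ^ 3 - 1) * c)%N.
  by rewrite sum_neq0_const (card_rV Fq) subn1.
have sumM : (\sum_(w : 'rV[F]_3 | w != 0%R) (w \in M) * (q - 1) = (q - 1) * (q - 1))%N.
  rewrite -big_distrl /= -{2}card_base -sum1_card; congr (_ * _)%N.
  rewrite [RHS]big_mkcond [LHS]big_mkcond /=; apply: eq_bigr => w _.
  by rewrite in_setD1; case: (w != 0); case: (w \in M).
have : (\sum_(w | w != 0%R) slice_zeros w + (q ^ 3 - 1) + (q - 1) * (q - 1)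
   <= e * q * (q ^ 3 - 1) + #|[set w | full w]|)%N.
  rewrite -sum_full -[X in (_ + X + _ <= _)%N]muln1 -(cst 1%N) -sumM.
  rewrite [(e * q * _)%N]mulnC -cst -!big_split /=.
  apply: leq_sum => w w0'; case wM: (w \in M); last first.
    rewrite mul0n addn0; have := slice_zeros_le w0'; rewrite /full w0' /=.
    by case: (slice_zeros w =P _) => h; lia.
  rewrite base_not_full // mul1n addn0.
  have := slice_zeros_drop w0' (fun x => base_slope x wM).
  by case: (e) e0 => // e' _ /=; rewrite mulSn; lia.
have := sum_slices; have : (q <= q ^ 3)%N by nia.
move: (\sum_(w | _) _)%N #|[set w | full w]| (q ^ 3)%N (e * q)%N => S N c m; nia.
Qed.

(** Vectors centered at o lie in the kernel of the slope at o, which has q^2 elements, and avoid the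
    q multiples of [w0], which lie in this kernel too. *)
Lemma card_centered_le o : (#|centered o| <= q ^ 2 - q)%N.
Proof.
have sub : centered o \subset [set w | slope (direction o) w == 0] :\: M.
  apply/subsetP => w; rewrite in_setD inE => /andP[fw iw].
  rewrite [_ \in [set _ | _]]inE slope_inv0 // eqxx andbT.
  by apply/negP => /base_not_full; rewrite fw.
apply: leq_trans (subset_leq_card sub) _.
rewrite cardsD slope_ker_card ?direction_neq0 // leq_sub2l //.
rewrite (setIidPr _) ?card_span_vec ?Fq //.
by apply/subsetP => w wM; rewrite inE base_slope.
Qed.

(** In coordinates (s, t) on L the slopes of w1, w2, w3 are nonzero multiples of the e-th powers of
    t, s and s - z t, and that of [w0] is zero. A linear relation between these four vectors of F^3
    gives b1 t^e + b2 s^e + b3 (s - z t)^e = 0, where b3 is nonzero. *)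
Lemma three_centers_additive o1 o2 o3 : o1 != o2 -> o2 != o3 -> o3 != o1 ->
  centered o1 != set0 -> centered o2 != set0 -> centered o3 != set0 ->
  forall s t : F, (s + t) ^+ e = s ^+ e + t ^+ e.
Proof.
move=> o12 o23 o31 /set0Pn[w1 hw1] /set0Pn[w2 hw2] /set0Pn[w3 hw3].
have inv o w : w \in centered o -> slice_inv (direction o) w by rewrite inE => /andP[].
have fll o w : w \in centered o -> full w by rewrite inE => /andP[].
pose u1 := direction o1; pose u2 := direction o2.
have [x [y u3E]] := direction_span (direction o3) o12.
have x0 : x != 0.
  apply: contra o23 => /eqP x0; apply/eqP/esym; apply: (direction_prop (c := y)).
  by rewrite u3E x0 scale0r add0r.
have y0 : y != 0.
  apply: contra o31 => /eqP y0; apply/eqP; apply: (direction_prop (c := x)).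
  by rewrite u3E y0 scale0r addr0.
pose a1 := slope u2 w1; pose a2 := slope u1 w2; pose a3 := slope u1 w3.
have E1 s t : slope (s *: u1 + t *: u2) w1 = t ^+ e * a1.
  by rewrite addrC slope_inv ?inv // slopeZ.
have E2 s t : slope (s *: u1 + t *: u2) w2 = s ^+ e * a2.
  by rewrite slope_inv ?inv // slopeZ.
have E3 s t : slope (s *: u1 + t *: u2) w3 = (s - t * (x / y)) ^+ e * a3.
  have -> : s *: u1 + t *: u2 = (s - t * (x / y)) *: u1 + (t / y) *: direction o3.
    rewrite u3E scalerDr !scalerA divfK // addrA -scalerDl; congr (_ *: _ + _).
    by rewrite [t / y * x]mulrAC -mulrA subrK.
  by rewrite slope_inv ?inv // slopeZ.
have nz w a (E : F -> F -> F) : full w ->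
    (forall s t, slope (s *: u1 + t *: u2) w = E s t * a) -> a != 0.
  move=> /full_slope[v]; have [s [t ->]] := direction_span v o12; move=> h hE.
  by apply: contra h => /eqP a0; rewrite hE a0 mulr0.
have a10 : a1 != 0 := nz _ _ _ (fll _ _ hw1) E1.
have a20 : a2 != 0 := nz _ _ _ (fll _ _ hw2) E2.
have a30 : a3 != 0 := nz _ _ _ (fll _ _ hw3) E3.
have [al [al0 rel]] : exists al : 'I_4 -> F, (exists i, al i != 0) /\
    al 0 *: w0 + (al 1 *: w1 + (al 2%:R *: w2 + al 3%:R *: w3)) = 0.
  pose A : 'M[F]_(4, 3) := \matrix_(i < 4) [:: w0; w1; w2; w3]`_i.
  have kA : kermx A != 0.
    rewrite kermx_eq0 /row_free; apply/eqP => h.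
    by have := rank_leq_col A; rewrite h.
  have /rowV0Pn[v /sub_kermxP vA v0] := kA.
  exists (fun i => v 0 i); split.
    apply/existsP; apply: contraT; rewrite negb_exists => /forallP h.
    by case/eqP: v0; apply/rowP => i; rewrite mxE; apply/eqP; have := h i; rewrite negbK.
  rewrite -[RHS]vA mulmx_sum_row !big_ord_recl big_ord0 !rowK addr0 /=.
  by congr (v 0 _ *: _ + (v 0 _ *: _ + (v 0 _ *: _ + v 0 _ *: _))); apply: val_inj.
pose b1 := al 1 * a1; pose b2 := al 2%:R * a2; pose b3 := al 3%:R * a3.
have R s t : t ^+ e * b1 + s ^+ e * b2 + (s - t * (x / y)) ^+ e * b3 = 0.
  have := congr1 (slope (s *: u1 + t *: u2)) rel.
  rewrite -[al 3%:R *: w3]addr0 !slope_lin sw0 mulr0 add0r E1 E2 E3.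
  have -> : slope (s *: u1 + t *: u2) 0 = 0 by rewrite -(scale0r w0) slope_scale mul0r.
  by rewrite addr0 !(mulrCA (al _)) !addrA.
set z := x / y in R.
have z0 : z != 0 by rewrite mulf_neq0 ?invr_eq0.
(* Evaluation at the zeros of the first and of the third linear form expresses b2 and b1 through
   b3. *)
have b23 : b2 = - b3.
  have := R 1 0; rewrite expr0n eqn0Ngt e0 mul0r add0r mul0r subr0 expr1n !mul1r.
  by move/eqP; rewrite addr_eq0 => /eqP.
have b13 : b1 = z ^+ e * b3.
  have := R z 1; rewrite expr1n !mul1r subrr expr0n eqn0Ngt e0 mul0r addr0 b23 mulrN.
  by move/eqP; rewrite subr_eq0 => /eqP.
have b30 : b3 != 0.
  apply/eqP => b30; rewrite b30 mulr0 in b13; rewrite b30 oppr0 in b23.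
  have c1 : al 1 = 0 by move/eqP: b13; rewrite mulf_eq0 (negbTE a10) orbF => /eqP.
  have c2 : al 2%:R = 0 by move/eqP: b23; rewrite mulf_eq0 (negbTE a20) orbF => /eqP.
  have c3 : al 3%:R = 0 by move/eqP: b30; rewrite mulf_eq0 (negbTE a30) orbF => /eqP.
  have c0 : al 0 = 0.
    move/eqP: rel; rewrite c1 c2 c3 !scale0r !addr0 scaler_eq0 (negbTE w00) orbF.
    by move/eqP.
  have [i /eqP[]] := al0; case: i => [[|[|[|[|//]]]] hi].
  - by rewrite -[RHS]c0; congr al; apply: val_inj.
  - by rewrite -[RHS]c1; congr al; apply: val_inj.
  - by rewrite -[RHS]c2; congr al; apply: val_inj.
  - by rewrite -[RHS]c3; congr al; apply: val_inj.
(* At this argument the three linear forms take the values t / z, s + t and s. *)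
move=> s t; have := R (s + t) (t / z).
rewrite divfK // addrK b13 b23 mulrA -exprMn divfK // mulrN -mulrBl -mulrDl.
move/eqP; rewrite mulf_eq0 (negbTE b30) orbF addrAC subr_eq0 => /eqP <-.
by rewrite addrC.
Qed.

(** With at most two centers there would be at most 2 (q^2 - q) full vectors, against
    [full_many_base]; hence three centers occur and 2 e <= q. If at most one center had more than e
    (q - 1) vectors, there would be at most (q + 1) e (q - 1) + (q^2 - q - e (q - 1)) full vectors,
    which 2 e <= q excludes. *)
Lemma two_centers : (1 < e)%N -> exists o1 o2, [/\ o1 != o2,
  (e * (q - 1) < #|centered o1|)%N & (e * (q - 1) < #|centered o2|)%N].
Proof.
move=> e1; have fm := full_many_base.
have e2 : (2 * e <= q)%N.
  pose C := [set o | centered o != set0].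
  have leC : (#|[set w | full w]| <= #|C| * (q ^ 2 - q))%N.
    apply: leq_trans full_le_sum _; rewrite -sum_nat_const [X in (_ <= X)%N]big_mkcond /=.
    apply: leq_sum => o _; case: ifP => [_|]; first exact: card_centered_le.
    by rewrite inE => /negbT; rewrite negbK => /eqP ->; rewrite cards0.
  have : (2 < #|C|)%N.
    rewrite ltnNge; apply/negP => C2.
    have : (#|[set w | full w]| <= 2 * (q ^ 2 - q))%N.
      by apply: leq_trans leC _; rewrite leq_mul2r C2 orbT.
    move: #|[set w | full w]| fm => N; case: (q) q1 eq => // r r0; rewrite ltnS => er h1 h2.
    have : (e * r.+1 * r <= r * r.+1 * r)%N by rewrite !leq_mul2r er !orbT.
    have c3 : (r.+1 ^ 3 - 1 = r * r * r + 3 * (r * r) + 3 * r)%N by rewrite !expnS expn0; lia.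
    have c2 : (r.+1 ^ 2 - r.+1 = r * r + r)%N by rewrite !expnS expn0; lia.
    by move: h1 h2; rewrite c3 c2 !subn1 /=; lia.
  case/card_gt2P => o1 [o2 [o3 [[]]]]; rewrite !inE => h1 h2 h3 [o12 o23 o31].
  rewrite -Fq; apply: additive_power_bound; rewrite ?Fq //.
  exact: three_centers_additive o12 o23 o31 h1 h2 h3.
pose B := [set o | (e * (q - 1) < #|centered o|)%N].
suff /card_gt1P[o1 [o2 []]] : (1 < #|B|)%N.
  by rewrite !inE => h1 h2 o12; exists o1, o2.
rewrite ltnNge; apply/negP => B1.
have le : (#|[set w | full w]| <= (q + 1) * (e * (q - 1)) + #|B| * (q ^ 2 - q - e * (q - 1)))%N.
  apply: leq_trans full_le_sum _.
  have -> : ((q + 1) * (e * (q - 1)) = \sum_(o : option F) e * (q - 1))%N.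
    by rewrite sum_nat_const card_option Fq addn1.
  rewrite -sum_nat_const [X in (_ <= _ + X)%N]big_mkcond /= -big_split /=.
  apply: leq_sum => o _; rewrite inE; have := card_centered_le o.
  case: ltnP => h h'; last by rewrite addn0.
  by rewrite subnKC // ltnW // (leq_trans h).
have {}le : (#|[set w | full w]| <= (q + 1) * (e * (q - 1)) + (q ^ 2 - q - e * (q - 1)))%N.
  by apply: leq_trans le _; rewrite leq_add2l -[X in (_ <= X)%N]mul1n leq_mul2r B1 orbT.
move: #|[set w | full w]| fm le => N; case: (q) q1 eq e2 => // r r0 _ e2.
have c3 : (r.+1 ^ 3 - 1 = r * r * r + 3 * (r * r) + 3 * r)%N by rewrite !expnS expn0; lia.
have c2 : (r.+1 ^ 2 - r.+1 = r * r + r)%N by rewrite !expnS expn0; lia.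
rewrite c3 c2 !subn1 /= => h1 h2.
have er : (2 * e * r * r.+1 <= r.+1 * r * r.+1)%N by rewrite !leq_mul2r e2 !orbT.
have er' : (e * r <= r * r + r)%N by nia.
lia.
Qed.
End Base.
End ManyPoints.

(** The section by the tangent space at P = u L is a cone with vertex P, as far as values at
    rational vectors are concerned. *)
Definition cone_at (u : 'rV[F]_2) := forall (y : 'rV[F]_5) (k : F),
  (dirder y f).@[(u *m L) 0] = 0 -> f.@[(y + k *: (u *m L)) 0] = f.@[y 0].

(** The polynomial t -> f(y + t P) has degree at most 2; its coefficients of t^2 and t are f(P) and
    the derivative at P along y, both zero. *)
Lemma quadric_cone u : e = 1%N -> cone_at u.
Proof.
move=> e1 y k dy; rewrite -line_polyE -[RHS](coef0_line_poly _ _ (u *m L)).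
set p := line_poly _ _ _; suff -> : p = (p`_0)%:P by rewrite hornerC coefC.
apply: size1_polyC; apply: size_ltS; first apply: size_ltS.
- by have := size_line_poly y (u *m L) hf; rewrite e1.
- by have := lead_line_poly y (u *m L) hf; rewrite e1 fL.
- by have := sublead_line_poly y (u *m L) hf isT; rewrite e1 dy.
Qed.

(** Let w be tangent at P = u L, and w1 centered there. Moving from w in the direction w1 gives two
    polynomials in t, for the points x and x + k u; they agree at every t with w + t w1 centered.
    There are at least e such t, and the difference has degree less than e. *)
Lemma centered_cone o : (1 < e)%N -> (e * (q - 1) < #|centered o|)%N -> cone_at (direction o).
Proof.
move=> e1 many_o y k; set u := direction o.
have [z ->] := row_free_full_sub y rf (leqnn 5).
rewrite -[z]hsubmxK mul_row_col dirder_slope; set x := lsubmx z; set w := rsubmx z.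
move=> uw; rewrite addrAC scalemxAl -mulmxDl -!/(slice _ _).
have [w1 hw1] : exists w1, w1 \in centered o by apply/card_gt0P; apply: leq_ltn_trans many_o.
have inv1 : slice_inv u w1 by move: hw1; rewrite inE => /andP[].
have w10 : w1 != 0 by move: hw1; rewrite inE => /andP[/andP[]].
have [/imsetP[c _ ->]|nw] := boolP (w \in [set c *: w1 | c : F]).
  by have /slice_invP-> := slice_invZ c inv1.
have indep a b : a *: w + b *: w1 = 0 -> a = 0 /\ b = 0.
  have [->|a0] := eqVneq a 0.
    by rewrite scale0r add0r => /eqP; rewrite scaler_eq0 (negbTE w10) orbF => /eqP ->.
  move=> /eqP; rewrite addr_eq0 -scaleNr => /eqP h; case/imsetP: nw.
  by exists (a^-1 * - b); rewrite // -scalerA -h scalerA mulVf // scale1r.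
pose S := [set t | w + t *: w1 \in centered o].
(* The kernel of the slope is spanned by w and w1. At most q - 1 centered vectors are multiples of
   w1, and each of the others is a multiple of some w + t w1. *)
have cS : (e <= #|S|)%N.
  pose h (p : F * F) := p.1 *: w + p.2 *: w1.
  have hinj : injective h.
    move=> [a b] [a' b'] /eqP; rewrite -subr_eq0 opprD addrACA -!scalerBl /= => /eqP /indep[].
    by move=> /eqP h1 /eqP h2; move: h1 h2; rewrite !subr_eq0 => /eqP -> /eqP ->.
  have kerE : [set w' | slope u w' == 0] = h @: setT.
    apply/esym/eqP; rewrite eqEcard slope_ker_card ?direction_neq0 // card_imset // cardsT card_prod Fq.
    rewrite mulnn leqnn andbT; apply/subsetP => _ /imsetP[[a b] _ ->].
    by rewrite inE slope_lin slope_scale uw (slope_inv0 inv1) !mulr0 addr0.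
  pose A := [set c *: w1 | c in [set~ (0 : F)]].
  pose B := (fun p : F * F => p.1 *: (w + p.2 *: w1)) @: setX [set~ (0 : F)] S.
  have sub : centered o \subset A :|: B.
    apply/subsetP => w' hw'.
    have : w' \in [set w' | slope u w' == 0].
      by move: hw'; rewrite !inE => /andP[_ /slope_inv0 ->].
    rewrite kerE => /imsetP[[a b] _ w'E]; rewrite inE; apply/orP.
    have [a0|a0] := eqVneq a 0.
      left; apply/imsetP; exists b; last by rewrite w'E /h a0 scale0r add0r.
      rewrite !inE; apply/eqP => b0; move: hw'.
      by rewrite w'E /h a0 b0 !scale0r addr0 inE /full eqxx.
    right; apply/imsetP; exists (a, b / a); last first.
      by rewrite w'E /h /= scalerDr scalerA mulrCA divff // mulr1.
    rewrite inE /= !inE a0 /=; have := centeredZ (c := a^-1) _ hw'.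
    rewrite invr_eq0 w'E /h scalerDr !scalerA mulVf // scale1r mulrC => /(_ a0).
    by rewrite !inE.
  have cF : #|[set~ (0 : F)]| = (q - 1)%N by rewrite cardsC1 Fq subn1.
  have := subset_leq_card sub; move/(leq_trans many_o).
  have cA : (#|A| <= q - 1)%N by rewrite -cF leq_imset_card.
  have cB : (#|B| <= (q - 1) * #|S|)%N by rewrite -cF -cardsX leq_imset_card.
  have [le _] := leq_card_setU A B; move: le.
  move: (#|A :|: B|) cA cB; move: #|A| #|B| #|S| => a b s; nia.
(* The invariance of the slice of w1 makes f constant along the line through w1 W in the direction
   P. Hence the coefficients of t^e of the two polynomials compared below agree. *)
have d1 : (dirder (u *m L) f).@[(w1 *m W) 0] = 0.
  rewrite -coef1_line_poly; set p := line_poly _ _ _.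
  suff -> : p = (slice w1 0)%:P by rewrite coefC.
  apply/eqP; rewrite -subr_eq0; apply/eqP; apply: (poly_eq0_all Fq) => [|t].
    apply: leq_trans eq; rewrite (leq_trans (size_polyD _ _)) // geq_max size_polyN.
    apply/andP; split; last by rewrite (leq_trans (size_polyC_leq1 _)).
    by apply: size_ltS; [exact: size_line_poly | rewrite (lead_line_poly _ _ hf) fL].
  rewrite hornerD hornerN hornerC line_polyE.
  have -> : w1 *m W + t *: (u *m L) = (0 + t *: u) *m L + w1 *m W.
    by rewrite add0r scalemxAl addrC.
  by rewrite -/(slice _ _); have /slice_invP-> := inv1; rewrite subrr.
pose p z := line_poly f (z *m L + w *m W) (w1 *m W).
have pE z' t : (p z').[t] = slice (w + t *: w1) z'.
  by rewrite line_polyE scalemxAl -addrA -mulmxDl.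
suff P0 : p (x + k *: u) - p x = 0.
  have := congr1 (fun r => r.[0]) P0; rewrite hornerD hornerN !pE horner0 scale0r addr0.
  by move/eqP; rewrite subr_eq0 => /eqP.
apply: (poly_few_roots (e := e)); last first.
  apply: leq_trans cS _; apply: subset_leq_card; apply/subsetP => t; rewrite !inE.
  by move=> /andP[_ /slice_invP h]; rewrite hornerD hornerN !pE h subrr.
apply: size_ltS; first apply: size_ltS.
- by rewrite (leq_trans (size_polyD _ _)) // geq_max size_polyN !size_line_poly.
- by rewrite coefB !(lead_line_poly _ _ hf) subrr.
- rewrite coefB !(sublead_line_poly _ _ hf isT).
  have -> : (x + k *: u) *m L + w *m W = k *: (u *m L) + (x *m L + w *m W).
    by rewrite mulmxDl -scalemxAl addrAC addrC.
  by rewrite dirder_linl d1 mulr0 add0r subrr.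
Qed.

Lemma two_cone_points : (q ^ 2 + e * q * (q ^ 3 - q) <= #|zeros f|)%N ->
  exists o1 o2, [/\ o1 != o2, cone_at (direction o1) & cone_at (direction o2)].
Proof.
move=> many; have [e1|e1] := eqVneq e 1%N.
  by exists None, (Some 0); split => //; apply: quadric_cone.
have {}e1 : (1 < e)%N by lia.
have [w0 w00 sw0] := pencil_base many.
have [o1 [o2 [o12 h1 h2]]] := two_centers many w00 sw0 e1.
by exists o1, o2; split=> //; apply: centered_cone.
Qed.

(** * Two conical tangent sections with vertices on the line *)

Section TwoCones.
Variables (o1 o2 : option F).
Hypotheses (o12 : o1 != o2) (cone1 : cone_at (direction o1)) (cone2 : cone_at (direction o2)).

(** Two linear conditions on F^3 leave a nonzero w0 tangent at both points. Invariance under both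
    translations, which generate L, makes its slice constant, and the constant is not zero by
    [slice_neq0]. *)
Lemma cone_axis : exists w0, [/\ w0 != 0, slope (direction o1) w0 = 0
  & forall c, c != 0 -> slice_zeros (c *: w0) = 0%N].
Proof.
pose c o := W *m gradient f (direction o *m L).
have sE o w : slope (direction o) w = (w *m c o) 0 0 by rewrite /slope gradientE mulmxA.
have kB : kermx (row_mx (c o1) (c o2)) != 0.
  rewrite kermx_eq0 /row_free; apply/eqP => h.
  by have := rank_leq_col (row_mx (c o1) (c o2)); rewrite h.
have /rowV0Pn[w0 /sub_kermxP wB w00] := kB.
have [s1 s2] : slope (direction o1) w0 = 0 /\ slope (direction o2) w0 = 0.
  move: wB; rewrite mul_mx_row => /(congr1 (fun z => (lsubmx z, rsubmx z))).
  by rewrite row_mxKl row_mxKr !linear0 !sE => -[-> ->]; rewrite mxE.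
exists w0; split=> // a a0; rewrite slice_zerosZ //.
have sl x : slice w0 x = f.@[(w0 *m W) 0].
  have [s [t ->]] := direction_span x o12.
  rewrite /slice mulmxDl -!scalemxAl addrC addrA.
  rewrite cone2; last by rewrite addrC scalemxAl dirder_slope.
  by rewrite cone1 // -[w0 *m W]add0r -(mul0mx _ L) dirder_slope.
have [x hx] := slice_neq0 w00.
apply/eqP; rewrite cards_eq0; apply/eqP/setP => x'; rewrite !inE sl -(sl x).
exact: negbTE.
Qed.

(** The q multiples of w0 contribute no zeros off L, and each of the other q^3 - q vectors at most e
    q. Equality makes all of these full; the tangent space at the first point contains q^2 - q of
    them. *)
Lemma two_cones_bound : (#|zeros f| <= q ^ 2 + e * q * (q ^ 3 - q))%N /\
  (#|zeros f| = (q ^ 2 + e * q * (q ^ 3 - q))%N ->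
   #|[set v : 'rV[F]_5 | (f.@[v 0%R] == 0%R) && ((dirder v f).@[(direction o1 *m L) 0%R] == 0%R)]|
     = (q ^ 2 + e * q * (q ^ 2 - q))%N).
Proof.
have [w0 [w00 sw0 z0]] := cone_axis.
pose M := [set c *: w0 | c : F].
have cM : #|M| = q by rewrite card_span_vec.
have M0 : 0 \in M by apply/imsetP; exists 0; rewrite ?scale0r.
have zM w : w != 0 -> w \in M -> slice_zeros w = 0%N.
  by move=> wn /imsetP[c _ wE]; rewrite wE z0 //; apply: contra wn => /eqP c0; rewrite wE c0 scale0r.
have splitM : (\sum_(w | w != 0%R) slice_zeros w = \sum_(w in ~: M) slice_zeros w)%N.
  rewrite (bigID (mem M)) /= big1 ?add0n => [|w /andP[]]; last exact: zM.
  apply: eq_bigl => w; rewrite inE; have [->|//] := eqVneq w 0.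
  by rewrite M0.
have cC : #|~: M| = (q ^ 3 - q)%N by rewrite cardsCs setCK cM (card_rV Fq).
have le w : w \in ~: M -> (slice_zeros w <= e * q)%N.
  rewrite inE => wM; apply: slice_zeros_le; apply: contra wM => /eqP ->; exact: M0.
have cst : (\sum_(w in ~: M) e * q = e * q * (q ^ 3 - q))%N.
  by rewrite sum_nat_const cC mulnC.
rewrite card_zeros_slice splitM; split; first by rewrite leq_add2l -cst leq_sum.
move/eqP; rewrite eqn_add2l -cst => /eqP tot.
have zfull w : w \in ~: M -> slice_zeros w = (e * q)%N.
  move=> wM; apply/eqP; rewrite eqn_leq le //= leqNgt; apply/negP => lt.
  suff : (\sum_(w in ~: M) slice_zeros w < \sum_(w in ~: M) e * q)%N by rewrite tot ltnn.
  rewrite (bigD1 w) //= [X in (_ < X)%N](bigD1 w) //= -addSn leq_add //.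
  by apply: leq_sum => w' /andP[w'M _]; apply: le.
rewrite (card_split_mx Fq _ rf erefl).
have E w : #|[set x : 'rV[F]_2 | (f.@[(x *m L + w *m W) 0] == 0) &&
    ((dirder (x *m L + w *m W) f).@[(direction o1 *m L) 0] == 0)]|
    = (if slope (direction o1) w == 0%R then slice_zeros w else 0)%N.
  case: eqP => sw.
    by apply: eq_card => x; rewrite !inE dirder_slope sw eqxx andbT.
  apply/eqP; rewrite cards_eq0; apply/eqP/setP => x; rewrite !inE dirder_slope.
  by apply/negbTE; rewrite negb_and; apply/orP; right; apply/eqP.
under eq_bigr do rewrite E; rewrite -big_mkcond /= (bigD1 0) /=; last first.
  by rewrite -(scale0r w0) slope_scale mul0r.
congr (_ + _)%N.
  rewrite /slice_zeros (eq_card (B := setT)) ?cardsT ?(card_rV Fq) // => x.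
  by rewrite !inE slice0 eqxx.
pose Ker := [set w | slope (direction o1) w == 0].
have MK : M \subset Ker.
  by apply/subsetP => _ /imsetP[c _ ->]; rewrite inE slope_scale sw0 mulr0.
rewrite (bigID (mem M)) /= big1 ?add0n => [|w /andP[/andP[_]]]; last exact: zM.
rewrite (eq_bigl (mem (Ker :\: M))) => [|w]; last first.
  rewrite !inE; case: (boolP (w \in M)) => wM; rewrite /= ?andbF // !andbT.
  suff -> : w != 0 by rewrite andbT.
  by apply: contraNneq wM => ->.
rewrite (eq_bigr (fun=> e * q)%N) => [|w]; last first.
  by rewrite !inE => /andP[wM _]; apply: zfull; rewrite inE.
by rewrite sum_nat_const cardsD (setIidPr MK) cM slope_ker_card ?direction_neq0 // mulnC.
Qed.
End TwoCones.
End Line.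

(** * Existence of a line, and the theorem for degree at most q *)

Section Main.
Variables (F : finFieldType) (q : nat).
Hypothesis Fq : #|F| = q.
Variables (K : closedFieldType) (iota : {rmorphism F -> K}) (e : nat) (f : {mpoly F[5]}).
Local Notation d := e.+1.
Hypotheses (hf : f \is d.-homog) (ns : nonsingular iota f) (e0 : (0 < e)%N).

Let q1 : (1 < q)%N := q_gt1 Fq.

Lemma line_vanish (P y : 'rV[F]_5) : f.@[P 0] = 0 -> (forall t : F, f.@[(y + t *: P) 0] = 0) ->
  forall x : 'rV_2, f.@[(x *m (col_mx P y : 'M_(2, 5))) 0] = 0.
Proof.
move=> fP fy x; rewrite -(@hsubmxK F 1 1 1 x) (@mul_row_col _ 1 1 1).
rewrite (mx11_scalar (lsubmx _)) (mx11_scalar (rsubmx _)) !mul_scalar_mx.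
move: (lsubmx _ 0 0) (rsubmx _ 0 0) => s t.
have [->|t0] := eqVneq t 0.
  by rewrite scale0r addr0 (meval_homogZ _ _ hf) fP mulr0.
have -> : s *: P + t *: y = t *: (y + (s / t) *: P).
  by rewrite scalerDr scalerA addrC mulrCA divff // mulr1.
by rewrite (meval_homogZ _ _ hf) fy mulr0.
Qed.

(** A rational point on no line of the threefold would give the estimate [no_line_bound], which is
    below the assumed number of zeros when e <= q. *)
Lemma exists_line : (e <= q)%N -> (q ^ 2 + e * q * (q ^ 3 - q) <= #|zeros f|)%N ->
  exists L : 'M[F]_(2, 5), row_free L /\ forall x : 'rV_2, f.@[(x *m L) 0] = 0.
Proof.
move=> leq many.
have [P P0 fP] : exists2 P : 'rV[F]_5, P != 0 & f.@[P 0] = 0.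
  have : (0 < #|zeros f :\ 0%R|)%N.
    have zq : (1 < #|zeros f|)%N.
      apply: leq_trans (leq_trans (leq_addr _ _) many); rewrite expnS expn1.
      exact: leq_trans q1 (leq_pmulr _ (ltnW q1)).
    rewrite (cardsD1 (0 : 'rV_5)) in zq.
    by rewrite -(ltn_add2l 1) addn0 (leq_trans zq) // leq_add2r; case: (_ \in _).
  by case/card_gt0P => P; rewrite !inE => /andP[P0 /eqP fP]; exists P.
have [/existsP[y /andP[rf /forallP fy]]|nl] :=
    boolP [exists y, row_free (col_mx P y) && [forall t : F, f.@[(y + t *: P) 0] == 0]].
  exists (col_mx P y); split => //; apply: line_vanish fP _ => t; apply/eqP; exact: fy.
have := no_line_bound Fq hf ns (e0 : (1 < d)%N) P0 fP.
have nl' y : row_free (col_mx P y) -> exists t : F, f.@[(y + t *: P) 0] != 0.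
  move=> rf; apply/existsP; apply: contraR nl; rewrite negb_exists => /forallP h.
  apply/existsP; exists y; rewrite rf; apply/forallP => t.
  by have := h t; rewrite negbK.
move=> /(_ nl'); rewrite leqNgt => /negP[]; apply: leq_trans many; rewrite /=.
case: e e0 leq => // k _ leq /=.
(* The powers q^2, q^3, q^4 become variables a, b, c, so that the comparison is linear in the
   products listed below. *)
have [a aE] : exists a, a = (q * q)%N by exists (q * q)%N.
have [b bE] : exists b, b = (q * a)%N by exists (q * a)%N.
have [c cE] : exists c, c = (q * b)%N by exists (q * b)%N.
have -> : (q ^ 4 = c)%N by rewrite cE bE aE !expnS expn0 muln1.
have -> : (q ^ 3 = b)%N by rewrite bE aE !expnS expn0 muln1.
have -> : (q ^ 2 = a)%N by rewrite aE !expnS expn0 muln1.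
have qa : (q < a)%N by rewrite aE -[X in (X < _)%N]muln1 ltn_pmul2l // ltnW.
have ab : (a <= b)%N by rewrite bE leq_pmull // ltnW.
have bc : (b <= c)%N by rewrite cE leq_pmull // ltnW.
have h1 : ((c - b) * k.+1 + b * k.+1 = c * k.+1)%N by rewrite -mulnDl subnK.
have h2 : ((b - 1) * k + k = b * k)%N by rewrite -{2}[k]mul1n -mulnDl subnK //; lia.
have h3 : (k.+1 * q * (b - q) + k.+1 * a = c * k.+1)%N.
  by rewrite aE -mulnA -mulnDr -mulnDr subnK -?cE 1?mulnC // ltnW // (leq_trans qa).
have h4 : (k.+1 * a <= b)%N by rewrite bE leq_mul2r leq orbT.
move: h1 h2 h3 h4; move: ((c - b) * k.+1)%N ((b - 1) * k)%N (k.+1 * q * (b - q))%N => x y z.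
rewrite !mulnS !mulSn; lia.
Qed.

Lemma small_degree_bound : (e < q)%N ->
  (#|zeros f| <= q ^ 2 + e * q * (q ^ 3 - q))%N /\
  (#|zeros f| = (q ^ 2 + e * q * (q ^ 3 - q))%N ->
   exists (P : 'rV[F]_5) (U : 'M[F]_(3, 5)),
     [/\ P != 0, f.@[P 0] = 0, tangent_section_cone f P U,
         hypersurface d (restrict U f) /\ nonsingular iota (restrict U f)
       & #|zeros (restrict U f)| = (q + e * (q ^ 2 - q))%N]).
Proof.
move=> eq.
have [lt|many] := ltnP #|zeros f| (q ^ 2 + e * q * (q ^ 3 - q))%N.
  by split; [exact: ltnW | move=> h; rewrite h ltnn in lt].
have [L [rfL fL]] := exists_line (ltnW eq) many.
have [W rf] := @row_free_extend F 2 3 5 L rfL erefl.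
have [o1 [o2 [o12 cone1 cone2]]] := two_cone_points Fq hf ns e0 eq rf fL many.
have [le eqc] := two_cones_bound Fq hf ns e0 eq rf fL o12 cone1 cone2.
split=> // /eqc cT.
pose P := direction o1 *m L.
have coneP : forall y k, (dirder y f).@[P 0] = 0 -> f.@[(y + k *: P) 0] = f.@[y 0] := cone1.
have P0 : P != 0 by rewrite row_free_mul_eq0 // direction_neq0.
have fP : f.@[P 0] = 0 by apply: fL.
have [|U [tsc hU cU]] := cone_output Fq hf ns (e0 : (1 < d)%N) P0 fP.
  move=> U /andP[PUT _]; apply/eqP; rewrite -subr_eq0; apply/eqP.
  (* Invariance at rational points suffices for an identity of forms because d = e + 1 <= q. *)
  apply: (vanishing_homog_eq0 (d := d)); last by rewrite Fq.
    by rewrite rpredB // dhomog_restrict.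
  move=> v; rewrite mevalB !meval_restrict -(@hsubmxK F 1 1 3 v) !(@mul_row_col _ 1 1 3).
  rewrite mulmx0 add0r (mx11_scalar (lsubmx _)) mul_scalar_mx [_ *: P + _]addrC coneP ?subrr //.
  have UT : (U <= tangent_space f P)%MS by apply: submx_trans PUT; rewrite -addsmxE addsmxSr.
  have /sub_kermxP h : (rsubmx (v : 'rV_(1 + 3)) *m U <= tangent_space f P)%MS by rewrite (submx_trans (submxMl _ _)).
  by rewrite gradientE h mxE.
exists P, U; split=> //; apply/eqP; rewrite -(@eqn_pmul2r q) ?(ltnW q1) // cU cT.
apply/eqP; rewrite mulnDl mulnn; congr (_ + _)%N; nia.
Qed.
End Main.

(** * Power sums over a finite field *)

Section PowerSums.
Variables (F : finFieldType) (q : nat).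
Hypothesis Fq : #|F| = q.

(** For k = 0 the translation x -> x + 1 shows that the sum of ones is zero. For k > 0 there is a
    nonzero a with a^k different from 1, and scaling by a multiplies the sum by a^k. *)
Lemma sum_powers k : (k < q.-1)%N -> \sum_(x : F) x ^+ k = 0.
Proof.
case: k => [_|k hk].
  have : \sum_(x : F) (x + 1) = \sum_(x : F) x.
    rewrite [RHS](reindex_inj (addIr 1)) //.
  rewrite big_split /= -[RHS]addr0 => /addrI h.
  by rewrite -[RHS]h; apply: eq_bigr => x _; rewrite expr0.
have [a [a0 ak]] : exists a : F, a != 0 /\ a ^+ k.+1 != 1.
  suff /existsP[a /andP[]] : [exists a : F, (a != 0) && (a ^+ k.+1 != 1)] by exists a.
  apply: contraT; rewrite negb_exists => /forallP h.
  pose r : {poly F} := 'X^(k.+1) - 1%:P.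
  have szr : size r = k.+2 by rewrite size_XnsubC.
  have r0 : r != 0 by rewrite -size_poly_eq0 szr.
  have := card_roots_line (e := k.+1) (eq_leq szr) r0.
  rewrite leqNgt => /negP[]; apply: leq_trans hk _; rewrite -Fq -(cardsC1 (0 : F)).
  apply: subset_leq_card; apply/subsetP => a; rewrite !inE => a0.
  by have := h a; rewrite a0 /= negbK => /eqP h'; rewrite !hornerE h' subrr.
set S := \sum_x _; have : S = a ^+ k.+1 * S.
  rewrite {1}/S (reindex_inj (mulfI a0)) /= mulr_sumr.
  by apply: eq_bigr => x _; rewrite exprMn.
move/eqP; rewrite -subr_eq0 -{1}[S]mul1r -mulrBl mulf_eq0 subr_eq0 eq_sym (negbTE ak) /=.
by move/eqP.
Qed.

(** The argument of Chevalley and Warning: a monomial of degree less than n (q - 1) has some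
    exponent less than q - 1, and the sum factors over the coordinates. *)
Lemma sum_meval n d (p : {mpoly F[n]}) : p \is d.-homog -> (d < n * q.-1)%N ->
  \sum_(v : 'rV[F]_n) p.@[v 0] = 0.
Proof.
move=> hp hd; under eq_bigr do rewrite mevalE.
rewrite exchange_big big_seq big1 //= => m /(dhomog_mf hp) /= md.
rewrite -mulr_sumr; suff -> : \sum_(v : 'rV[F]_n) \prod_i v 0 i ^+ m i = 0 by rewrite mulr0.
have bij : bijective (fun h : {ffun 'I_n -> F} => \row_i h i).
  exists (fun v : 'rV_n => [ffun i => v 0 i]) => [h|v].
    by apply/ffunP => i; rewrite ffunE mxE.
  by apply/rowP => i; rewrite mxE ffunE.
rewrite (reindex _ (onW_bij _ bij)) /=.
have -> : \sum_(j : {ffun 'I_n -> F}) \prod_i (\row_i j i) 0 i ^+ m i =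
    \sum_(j : {ffun 'I_n -> F}) \prod_i j i ^+ m i.
  by apply: eq_bigr => h _; apply: eq_bigr => i _; rewrite mxE.
rewrite -(bigA_distr_bigA (fun i (x : F) => x ^+ m i)) /=.
have [i hi] : exists i, (m i < q.-1)%N.
  apply/existsP; apply: contraLR hd; rewrite negb_exists => /forallP h.
  rewrite -leqNgt -md mdegE -[X in (X * _ <= _)%N]card_ord -sum_nat_const.
  by apply: leq_sum => i _; rewrite leqNgt h.
by rewrite (bigD1 i) //= sum_powers // mul0r.
Qed.
End PowerSums.

Lemma row_free_col_vec (F : fieldType) m n (A : 'M[F]_(m, n)) (v : 'rV[F]_n) :
  row_free A -> ~~ (v <= A)%MS -> row_free (col_mx A v).
Proof.
move=> rfA nv; apply: row_free_ker => y; rewrite -[y]hsubmxK mul_row_col.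
rewrite [rsubmx y]mx11_scalar mul_scalar_mx; set b := rsubmx y 0 0; set a := lsubmx y => h.
have b0 : b = 0.
  apply/eqP; apply: contraNT nv => b0; apply/submxP; exists (- b^-1 *: a).
  have /eqP := h; rewrite addr_eq0 => /eqP h'.
  by rewrite -scalemxAl h' scaleNr scalerN opprK scalerA mulVf // scale1r.
move: h; rewrite b0 scale0r addr0 => /eqP; rewrite row_free_mul_eq0 // => /eqP ->.
by rewrite raddf0 row_mx0.
Qed.

Lemma exists_vec_notin (F : fieldType) m k n (A : 'M[F]_(m, n)) (B : 'M[F]_(k, n)) :
  (\rank B < \rank A)%N -> exists2 v : 'rV[F]_n, (v <= A)%MS & ~~ (v <= B)%MS.
Proof.
move=> lt; have : ~~ (A <= B)%MS by apply: contraL lt => /mxrankS; rewrite leqNgt.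
by case/row_subPn => i hi; exists (row i A); rewrite ?row_sub.
Qed.

(** * Degree q + 1 *)

Section LargeDegree.
Variables (F : finFieldType) (q : nat).
Hypothesis Fq : #|F| = q.
Variables (K : closedFieldType) (iota : {rmorphism F -> K}).
Let q1 : (1 < q)%N := q_gt1 Fq.

(* On a line all of whose rational points are zeros, a form of degree q + 1
   restricts to a multiple of s^q t - s t^q. *)
Lemma dirder_antisym n (p : {mpoly F[n]}) (u v : 'rV[F]_n) : p \is q.+1.-homog ->
  (forall t : F, p.@[(u + t *: v) 0] = 0) -> p.@[v 0] = 0 ->
  (dirder v p).@[u 0] = - (dirder u p).@[v 0].
Proof.
move=> hp puv pv; rewrite -coef1_line_poly -(sublead_line_poly _ _ hp) //=.
set r := line_poly p u v; pose s := r - r`_q *: ('X^q - 'X).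
have szr : (size r <= q.+1)%N.
  by apply: size_ltS; [exact: size_line_poly | rewrite (lead_line_poly _ _ hp)].
have q0 : (q == 1)%N = false by apply/eqP; lia.
suff s0 : s = 0.
  have := congr1 (fun t : {poly F} => t`_1) s0; rewrite coef0 coefB coefZ coefB coefXn coefX.
  by rewrite eq_sym q0 eqxx sub0r mulrN1 opprK => /eqP; rewrite addr_eq0 => /eqP.
apply: (poly_eq0_all Fq); last first.
  move=> t; rewrite hornerD hornerN hornerZ hornerD hornerN hornerXn hornerX.
  by rewrite -Fq expf_card subrr mulr0 subr0 line_polyE puv.
apply: size_ltS.
  rewrite (leq_trans (size_polyD _ _)) // geq_max szr size_polyN /=.
  rewrite (leq_trans (size_scale_leq _ _)) // (leq_trans (size_polyD _ _)) //.
  by rewrite geq_max size_polyXn size_polyN size_polyX leqnn /= ltnW.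
by rewrite coefB coefZ coefB coefXn coefX eqxx q0 subr0 mulr1 subrr.
Qed.

Variable f : {mpoly F[5]}.
Hypotheses (hf : f \is q.+1.-homog) (ns : nonsingular iota f).

(** If f vanished at all rational vectors, the derivative at u along v would be an alternating
    bilinear form [b] on F^5, with a totally isotropic subspace of dimension 3. On this plane f and
    the relevant derivatives vanish, so f is zero there, against [no_plane]. *)
Lemma not_all_zeros : exists v : 'rV[F]_5, f.@[v 0] != 0.
Proof.
apply/existsP; apply: contraT; rewrite negb_exists => /forallP h.
have f0 (v : 'rV[F]_5) : f.@[v 0] = 0 by apply/eqP; have := h v; rewrite negbK.
pose b (u v : 'rV[F]_5) := (dirder v f).@[u 0].
have asym u v : b u v = - b v u by apply: dirder_antisym.
have diag u : b u u = 0 by rewrite /b (euler_homog _ hf) f0 mulr0.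
pose u1 : 'rV[F]_5 := delta_mx 0 0.
have rk1 : row_free u1.
  rewrite /row_free rank_rV; suff -> : u1 != 0 by [].
  by apply/eqP => /rowP h1; have := h1 0; rewrite !mxE !eqxx => /eqP; rewrite oner_eq0.
have [|u2 u2k u21] := @exists_vec_notin F 5 1 5 (kermx (gradient f u1)) u1.
  by rewrite mxrank_ker (eqP rk1); have := rank_leq_col (gradient f u1); lia.
have rf2 := row_free_col_vec rk1 u21.
have [|u3 u3k u32] := @exists_vec_notin F 5 2 5
  (kermx (row_mx (gradient f u1) (gradient f u2))) (col_mx u1 u2).
  rewrite mxrank_ker (eqP rf2).
  by have := rank_leq_col (row_mx (gradient f u1) (gradient f u2)); lia.
have rf3 := row_free_col_vec rf2 u32.
have b12 : b u1 u2 = 0 by rewrite /b gradientE (sub_kermxP u2k) mxE.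
have [b13 b23] : b u1 u3 = 0 /\ b u2 u3 = 0.
  have := sub_kermxP u3k; rewrite mul_mx_row /b !gradientE.
  by move/(congr1 (fun z => (lsubmx z, rsubmx z))); rewrite row_mxKl row_mxKr !linear0 => -[-> ->]; rewrite mxE.
pose A : 'M[F]_(1 + 1 + 1, 5) := col_mx (col_mx u1 u2) u3.
have Ag u : b u u1 = 0 -> b u u2 = 0 -> b u u3 = 0 -> A *m gradient f u = 0.
  have E v : v *m gradient f u = (b u v)%:M by rewrite /b gradientE -mx11_scalar.
  by move=> h1 h2 h3; rewrite /A !mul_col_mx !E h1 h2 h3 raddf0 !col_mx0.
have bA u x : A *m gradient f u = 0 -> b u (x *m A) = 0.
  by move=> h0; rewrite /b gradientE -mulmxA h0 mulmx0 mxE.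
have Ag1 : A *m gradient f u1 = 0 by apply: Ag.
have Ag2 : A *m gradient f u2 = 0 by apply: Ag => //; rewrite asym b12 oppr0.
have Ag3 : A *m gradient f u3 = 0 by apply: Ag => //; rewrite asym ?b13 ?b23 oppr0.
have bAA x y : b (x *m A) (y *m A) = 0.
  by apply/bA/Ag; rewrite asym bA ?oppr0.
case: (no_plane hf ns (ltnW q1 : (1 < q.+1)%N) (A := A) erefl rf3).
apply: (vanishing_homog_eq0_succ (dhomog_restrict A hf)) => [v||i j]; rewrite ?Fq //.
  by rewrite meval_restrict.
by rewrite dirder_restrict; apply: bAA.
Qed.

(** There are q^5 vectors, so more than q^3 - q^2 of them must be shown to lie off the threefold;
    starting from one such z, at least q - 1 + q^3 - 1 are found. *)
Lemma large_degree_bound : (2 < q)%N -> (#|zeros f| < q ^ 2 + q * q * (q ^ 3 - q))%N.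
Proof.
move=> q2; have [z fz] := not_all_zeros.
have z0 : z != 0.
  by apply: contra fz => /eqP ->; rewrite (meval_homog0 hf).
have rz : row_free z by rewrite /row_free rank_rV z0.
(* Otherwise s^(q-3) f would be a form of degree 2q - 2 < 3(q - 1) supported on the multiples of z. *)
have plane y w : row_free (col_mx z (col_mx y w)) ->
    exists s t r, ((t != 0) || (r != 0)) && (f.@[(s *: z + (t *: y + r *: w)) 0] != 0).
  move=> rf; pose Q s t r := ((t != 0) || (r != 0)) && (f.@[(s *: z + (t *: y + r *: w)) 0] != 0).
  have [/existsP[s /existsP[t /existsP[r hr]]]|nQ] :=
    boolP [exists s, [exists t, [exists r, Q s t r]]]; first by exists s, t, r.
  have h s t r : (t != 0) || (r != 0) -> f.@[(s *: z + (t *: y + r *: w)) 0] = 0.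
    move=> tr; apply/eqP; apply: contraR nQ => fn.
    apply/existsP; exists s; apply/existsP; exists t; apply/existsP; exists r.
    by rewrite /Q tr.
  pose A : 'M[F]_(1 + (1 + 1), 5) := col_mx z (col_mx y w).
  pose p : {mpoly F[1 + (1 + 1)]} := 'X_0 ^+ (q - 3) * restrict A f.
  have hp : p \is ((1 * (q - 3) + q.+1)%N).-homog.
    apply: dhomogM (dhomog_restrict A hf); apply: dhomogMn.
    by rewrite dhomogX /= mdeg1.
  have := sum_meval Fq hp; rewrite (_ : _ < _)%N; last by lia.
  move=> /(_ isT) S0; case/eqP: (fz).
  have E (v : 'rV[F]_(1 + (1 + 1))) : p.@[v 0] =
      (if v == v 0 0 *: delta_mx 0 0 then f.@[z 0] * v 0 0 ^+ (q - 3 + q.+1) else 0).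
    rewrite mevalM rmorphXn /= mevalXU meval_restrict.
    set s := v 0 0; pose t := v 0 1; pose r := v 0 (1 + 1).
    have vA : v *m A = s *: z + (t *: y + r *: w).
      rewrite -[v]hsubmxK mul_row_col -[rsubmx v]hsubmxK mul_row_col.
      rewrite (mx11_scalar (lsubmx v)) (mx11_scalar (lsubmx (rsubmx v))) (mx11_scalar (rsubmx (rsubmx v))).
      rewrite !mul_scalar_mx !mxE; congr (_ *: _ + (_ *: _ + _ *: _)); congr (v 0 _); exact: val_inj.
    rewrite vA; case: eqP => [vE|ne].
      have -> : t = 0 by rewrite /t vE !mxE mulr0.
      have -> : r = 0 by rewrite /r vE !mxE mulr0.
      by rewrite !scale0r !addr0 (meval_homogZ _ _ hf) [RHS]mulrC exprD mulrA.
    rewrite h ?mulr0 //; apply: contraT; rewrite negb_or !negbK => /andP[/eqP t0 /eqP r0].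
    case: ne; apply/rowP => i; rewrite !mxE eqxx /=.
    have [->|i0] := eqVneq i 0; first by rewrite mulr1.
    rewrite mulr0; have [->|i1] := eqVneq i 1; first exact: t0.
    rewrite -[RHS]r0; congr (v 0 _); apply: val_inj.
    by case: i i0 i1 => [[|[|[|]]]].
  move: S0; rewrite (eq_bigr _ (fun v _ => E v)) -big_mkcond /=.
  rewrite (reindex_onto (fun s : F => s *: delta_mx 0 0) (fun v => v 0 0)) /=; last first.
    by move=> v /eqP <-.
  rewrite (eq_bigl predT) => [|s]; last by rewrite !mxE !eqxx mulr1 !eqxx.
  rewrite -mulr_sumr (bigD1 0) //= !mxE !mulr1 expr0n addn_eq0 andbF add0r.
  rewrite (eq_bigr (fun=> 1)) => [|s s0]; last first.
    rewrite !mxE !eqxx mulr1 (_ : q - 3 + q.+1 = q.-1 * 2)%N; last by lia.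
    rewrite exprM; suff -> : s ^+ q.-1 = 1 by rewrite expr1n.
    by apply: (mulfI s0); rewrite -exprS prednK ?(ltnW q1) // -Fq expf_card mulr1.
  have s1 : \sum_(s : F) 1 = 0 :> F.
    by rewrite -[RHS](sum_powers Fq (_ : 0 < q.-1)%N); [apply: eq_bigr|lia].
  move: s1; rewrite (bigD1 0) //= => /eqP; rewrite addrC addr_eq0 => /eqP ->.
  by move/eqP; rewrite mulrN1 oppr_eq0 => /eqP.
have [W rfW] := @row_free_extend F 1 4 5 z rz erefl.
(* The nonzero classes modulo z that contain a vector off the threefold. By [plane], this set meets
   every two-dimensional subspace of F^4. *)
pose B := [set w : 'rV[F]_4 | (w != 0) && [exists s : F, f.@[(s *: z + w *m W) 0] != 0]].
have BZ (c : F) w : c != 0 -> c *: w \in B -> w \in B.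
  move=> c0; rewrite !inE scaler_eq0 negb_or c0 /= => /andP[-> /existsP[s hs]].
  apply/existsP; exists (s / c); apply: contra hs => /eqP h0.
  rewrite -scalemxAl -[s](divfK c0) [s / c * c]mulrC -scalerA -scalerDr.
  by rewrite (meval_homogZ _ _ hf) h0 mulr0.
have B2 (y w : 'rV[F]_4) : row_free (col_mx y w) ->
    exists t r : F, ((t != 0) || (r != 0)) && (t *: y + r *: w \in B).
  move=> rf; have rf' : row_free (col_mx z (col_mx (y *m W) (w *m W))).
    apply: row_free_ker => v; rewrite -mul_col_mx -[v]hsubmxK mul_row_col mulmxA -mul_row_col => /eqP.
    rewrite row_free_mul_eq0 // => /eqP /(congr1 (fun z => (lsubmx z, rsubmx z))).
    rewrite row_mxKl row_mxKr !linear0 => -[-> /eqP].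
    by rewrite row_free_mul_eq0 // => /eqP ->; rewrite row_mx0.
  have [s [t [r /andP[tr fs]]]] := plane _ _ rf'.
  exists t, r; rewrite tr inE /=; apply/andP; split.
    apply/eqP => h0; have : row_mx t%:M r%:M *m col_mx y w = 0.
      by rewrite mul_row_col !mul_scalar_mx.
    move/eqP; rewrite row_free_mul_eq0 // => /eqP /(congr1 (fun z => (lsubmx z 0 0, rsubmx z 0 0))).
    rewrite row_mxKl row_mxKr !linear0 !mxE eqxx !mulr1n => -[t0 r0].
    by rewrite t0 r0 eqxx in tr.
  by apply/existsP; exists s; rewrite mulmxDl -!scalemxAl.
(* If a nonzero y is outside B, each of the q^3 - 1 nonzero classes modulo y contains an element of
   B. *)
have cB : (q ^ 3 - 1 <= #|B|)%N.
  have [/forallP all|] := boolP [forall y : 'rV[F]_4, (y != 0) ==> (y \in B)].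
    have sub : [set~ (0 : 'rV[F]_4)] \subset B.
      by apply/subsetP => y; rewrite in_setC1; apply/implyP.
    apply: leq_trans (subset_leq_card sub); rewrite cardsC1 (card_rV Fq) -subn1 leq_sub2r //.
    by rewrite leq_exp2l // ltnW.
  rewrite negb_forall => /existsP[y]; rewrite negb_imply => /andP[y0 yB].
  have ry : row_free y by rewrite /row_free rank_rV y0.
  have [Y rfY] := @row_free_extend F 1 3 4 y ry erefl.
  have -> : B = [set w | w \in B] by apply/setP => w; rewrite inE.
  rewrite (card_split_vec Fq (fun w => w \in B) rfY erefl).
  rewrite (bigD1 0) //=; apply: leq_trans (leq_addl _ _).
  have pos (a : 'rV[F]_3) : a != 0 -> (1 <= #|[set t : F | (t *: y + a *m Y)%R \in B]|)%N.
    move=> a0; apply/card_gt0P.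
    have rf : row_free (col_mx y (a *m Y)).
      apply: row_free_ker => v; rewrite -[v]hsubmxK mul_row_col mulmxA -mul_row_col => /eqP.
      rewrite row_free_mul_eq0 // => /eqP /(congr1 (fun z => (lsubmx z, rsubmx z))).
      rewrite row_mxKl row_mxKr !linear0 => -[-> yw].
      suff -> : rsubmx v = 0 by rewrite row_mx0.
      move: yw; rewrite [rsubmx v]mx11_scalar mul_scalar_mx => /eqP.
      by rewrite scaler_eq0 (negbTE a0) orbF => /eqP ->; rewrite raddf0.
    have [t [r /andP[tr hB]]] := B2 _ _ rf.
    have r0 : r != 0.
      apply/eqP => r0; rewrite r0 scale0r addr0 eqxx orbF in tr hB.
      by move/negP: yB; apply; apply: BZ hB.
    exists (r^-1 * t); rewrite inE; apply: (BZ r) => //.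
    by rewrite scalerDr scalerA mulrA divff // mul1r.
  have := leq_sum (P := fun a : 'rV_3 => a != 0) (index_enum _) pos.
  by rewrite sum_neq0_const (card_rV Fq) muln1 subn1.
(* The nonzero multiples of z, and at least one vector over each element of B. *)
have nz : (q - 1 + #|B| <= #|~: zeros f|)%N.
  have -> : ~: zeros f = [set v : 'rV[F]_5 | f.@[v 0] != 0] by apply/setP => v; rewrite !inE.
  rewrite (card_split_vec Fq (fun v : 'rV[F]_5 => f.@[v 0] != 0) rfW erefl).
  rewrite (bigD1 0) //=; apply: leq_add.
    rewrite -Fq subn1 -(cardsC1 (0 : F)); apply: subset_leq_card; apply/subsetP => s.
    rewrite !inE mul0mx addr0 => s0.
    by rewrite (meval_homogZ _ _ hf) mulf_neq0 // expf_neq0.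
  have -> : #|B| = (\sum_(w : 'rV[F]_4 | w != 0%R) (w \in B))%N.
    rewrite -sum1_card big_mkcond [RHS]big_mkcond /=; apply: eq_bigr => w _.
    by rewrite inE; case: (w != 0).
  apply: leq_sum => w w0; case: (boolP (w \in B)) => // wB; apply/card_gt0P.
  by move: wB; rewrite inE w0 => /existsP[s hs]; exists s; rewrite inE.
have := cardsC (zeros f); rewrite (card_rV Fq).
have [a aE] : exists a, a = (q * q)%N by exists (q * q)%N.
have [c cE] : exists c, c = (q * a)%N by exists (q * a)%N.
have [b bE] : exists b, b = (a * c)%N by exists (a * c)%N.
have c3 : (q ^ 3 = c)%N by rewrite cE aE !expnS expn0 muln1.
have -> : (q ^ 5 = b)%N by rewrite bE cE aE !expnS expn0 muln1 -!mulnA.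
rewrite c3 (_ : q ^ 2 = a)%N; last by rewrite aE !expnS expn0 muln1.
have -> : (q * q * (c - q) = b - c)%N by rewrite bE mulnBr -aE -[X in (_ - X)%N]mulnC -cE.
rewrite c3 in cB.
have qa : (q <= a)%N by rewrite aE leq_pmulr // ltnW.
have cb : (c <= b)%N by rewrite bE leq_pmull // (leq_trans _ qa) // ltnW.
have ac : (a <= c)%N by rewrite cE leq_pmull // ltnW.
move: nz cB; move: #|B| #|~: _| #|zeros f| => x y t; lia.
Qed.
End LargeDegree.

(** On a line in the curve, the derivative in a transversal direction is a form of degree d - 1 > 0;
    its zero on the line would be a singular point. *)
Lemma no_line_in_curve (F : finFieldType) (K : closedFieldType) (iota : {rmorphism F -> K})
    d (g : {mpoly F[3]}) (L : 'M[F]_(2, 3)) :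
  g \is d.-homog -> nonsingular iota g -> (1 < d)%N -> row_free L -> restrict L g <> 0.
Proof.
move=> hg ns d2 rfL L0.
have [w rfw] := @row_free_extend F 2 1 3 L rfL erefl.
pose LK := map_mx iota L; pose wK := map_mx iota w; pose gK := map_mpoly iota g.
have rfK : row_free (col_mx LK wK) by rewrite -map_col_mx /row_free mxrank_map.
have rfLK : row_free LK by rewrite /row_free mxrank_map.
have hgK : gK \is d.-homog by apply: dhomog_map_mpoly.
have L0K : restrict LK gK = 0 by rewrite -map_restrict L0 raddf0.
have [x x0 hx] := @binary_form_zero_mx K 3 d.-1 (dirder wK gK) LK
   ltac:(lia) (dhomog_dirder _ hgK).
have z0 : x *m LK != 0 by rewrite row_free_mul_eq0.
have gz : gK.@[(x *m LK) 0] = 0 by rewrite -meval_restrict L0K meval0.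
have /eqP := nonsingular_gradient ns z0 gz; apply.
apply: (gradient_full_eq0 rfK) => //; rewrite mul_col_mx.
have -> : LK *m gradient gK (x *m LK) = 0.
  by apply: dirder_lin_mx => i; rewrite rowE -dirder_restrict L0K dirder0 meval0.
have -> : wK *m gradient gK (x *m LK) = 0.
  by apply/rowP => i; rewrite ord1 -gradientE hx mxE.
by rewrite col_mx0.
Qed.

(** * Plane cubics over the field with two elements *)

Section Binary.
Variable F : finFieldType.
Hypothesis F2 : #|F| = 2.
Variables (K : closedFieldType) (iota : {rmorphism F -> K}).

Lemma F2_cases (x : F) : x = 0 \/ x = 1.
Proof.
have := expf_card x; rewrite F2 expr2 -[X in _ = X]mulr1 => /eqP.
rewrite -subr_eq0 -mulrBr mulf_eq0 subr_eq0 => /orP[] /eqP; by [left|right].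
Qed.

Lemma F2_neq0 (x : F) : x != 0 -> x = 1.
Proof. by case: (F2_cases x) => ->; rewrite ?eqxx. Qed.

Lemma F2_pchar : 2%N \in [pchar F].
Proof. by apply: (@card_finPcharP F 2 1). Qed.

Lemma F2_addxx n (v : 'rV[F]_n) : v + v = 0.
Proof. by apply/rowP => i; rewrite !mxE addrr_pchar2 // F2_pchar. Qed.

Lemma K_pchar : 2%N \in [pchar K].
Proof. by rewrite (rmorph_pchar iota F2_pchar). Qed.

(** The relation of Euler, with 3 = 1 in characteristic 2. *)
Lemma cubic_three n (g : {mpoly F[n]}) (v : 'rV[F]_n) : g \is 3.-homog ->
  (dirder v g).@[v 0] = g.@[v 0].
Proof.
move=> hg; rewrite (euler_homog _ hg) -[3%N]/(2 + 1)%N natrD (pcharf0 F2_pchar).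
by rewrite add0r mul1r.
Qed.

(* On F_2, Taylor expansion of a cubic at t = 1. *)
Lemma cubic_taylor n (g : {mpoly F[n]}) (u v : 'rV[F]_n) : g \is 3.-homog ->
  g.@[(u + v) 0] = g.@[u 0] + (dirder v g).@[u 0] + (dirder u g).@[v 0] + g.@[v 0].
Proof.
move=> hg; rewrite -[v in LHS]scale1r -line_polyE.
rewrite (@horner_coef_wide _ 4) ?size_line_poly // !big_ord_recl big_ord0 /=.
rewrite !expr1n !mulr1 addr0 !addrA coef0_line_poly coef1_line_poly.
by rewrite -(lead_line_poly u v hg) -(sublead_line_poly u v hg).
Qed.

Section PlaneCubic.
Variable g : {mpoly F[3]}.
Hypotheses (hg : g \is 3.-homog) (ns : nonsingular iota g).

(** If this derivative were zero, the Taylor expansion would make the derivative at v along u vanish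
    too. The restriction to the line, of degree 3 = q + 1, would then be zero by
    [vanishing_homog_eq0_succ]. *)
Lemma plane_cubic_line (u v : 'rV[F]_3) : row_free (col_mx u v) ->
  g.@[u 0] = 0 -> g.@[v 0] = 0 -> g.@[(u + v) 0] = 0 -> (dirder v g).@[u 0] = 1.
Proof.
move=> rf gu gv guv; apply: F2_neq0; apply/eqP => duv.
have dvu : (dirder u g).@[v 0] = 0.
  by have := cubic_taylor u v hg; rewrite gu gv guv duv !add0r addr0.
pose L : 'M[F]_(1 + 1, 3) := col_mx u v.
apply: (no_line_in_curve hg ns isT (rf : row_free (L : 'M_(2, 3)))).
have Lg (w : 'rV[F]_3) : (dirder u g).@[w 0] = 0 -> (dirder v g).@[w 0] = 0 -> L *m gradient g w = 0.
  move=> h1 h2; rewrite /L mul_col_mx.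
  have E x : x *m gradient g w = ((dirder x g).@[w 0])%:M by rewrite gradientE -mx11_scalar.
  by rewrite !E h1 h2 raddf0 col_mx0.
have Lu : L *m gradient g u = 0 by apply: Lg => //; rewrite cubic_three.
have Lv : L *m gradient g v = 0 by apply: Lg => //; rewrite cubic_three.
apply: (vanishing_homog_eq0_succ (dhomog_restrict L hg)) => [x||i j]; rewrite ?F2 //.
  rewrite meval_restrict -[x](@hsubmxK F 1 1 1) mul_row_col.
  rewrite (mx11_scalar (lsubmx _)) (mx11_scalar (rsubmx _)) !mul_scalar_mx.
  by case: (F2_cases (lsubmx x 0 0)) => ->; case: (F2_cases (rsubmx x 0 0)) => ->;
    rewrite ?scale0r ?scale1r ?add0r ?addr0 // (meval_homog0 hg).
rewrite dirder_restrict gradientE -mulmxA.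
suff -> : L *m gradient g (delta_mx 0 i *m L) = 0 by rewrite mulmx0 mxE.
rewrite -rowE; case: (splitP (i : 'I_(1 + 1))) => k hk.
  have -> : i = lshift 1 k by apply: val_inj.
  by rewrite rowKu row_id.
have -> : i = rshift 1 k by apply: val_inj.
by rewrite rowKd row_id.
Qed.

Lemma indep2 (u v : 'rV[F]_3) : u != 0 -> v != 0 -> u != v -> row_free (col_mx u v).
Proof.
move=> u0 v0 uv; apply: row_free_col_vec; first by rewrite /row_free rank_rV u0.
apply/negP => /sub_rVP[c vE]; case: (F2_cases c) vE => -> vE.
  by rewrite vE scale0r eqxx in v0.
by rewrite vE scale1r eqxx in uv.
Qed.

Let gK := map_mpoly iota g.

(* By symmetry, all partial derivatives of such a cubic vanish at (1 : w : w^2), where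
   w^2 + w + 1 = 0. *)
Lemma cubic_slope (e1 e2 e3 : 'rV[F]_3) :
    (forall x y z : F, x *: e1 + (y *: e2 + z *: e3) = 0 -> [/\ x = 0, y = 0 & z = 0]) ->
    (forall x y z : F, g.@[(x *: e1 + (y *: e2 + z *: e3)) 0] = ([&& x == 1, y == 1 & z == 1])%:R) ->
  forall x y z : K, (dirder (map_mx iota e1) gK).@[(x *: map_mx iota e1 +
     (y *: map_mx iota e2 + z *: map_mx iota e3)) 0] = y ^+ 2 + y * z + z ^+ 2.
Proof.
move=> ind gE x y z; pose pt x y z : 'rV[F]_3 := x *: e1 + (y *: e2 + z *: e3).
have e1E : e1 = pt 1 0 0 by rewrite /pt scale1r !scale0r !addr0.
have e2E : e2 = pt 0 1 0 by rewrite /pt scale1r !scale0r addr0 add0r.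
have e3E : e3 = pt 0 0 1 by rewrite /pt scale1r !scale0r !add0r.
have ptD a b c a' b' c' : pt a b c + pt a' b' c' = pt (a + a') (b + b') (c + c').
  by rewrite /pt !scalerDl addrACA; congr (_ + _); rewrite addrACA.
have pt0 a b c : (pt a b c == 0) = [&& a == 0, b == 0 & c == 0].
  apply/eqP/and3P => [/ind[-> -> ->]|[/eqP-> /eqP-> /eqP->]]; first by rewrite !eqxx.
  by rewrite /pt !scale0r !addr0.
have n01 : (0 == 1 :> F) = false by rewrite eq_sym oner_eq0.
have two : 1 + 1 = 0 :> F by rewrite addrr_pchar2 // F2_pchar.
have ptne a b c a' b' c' : (pt a b c != pt a' b' c') = (pt (a + a') (b + b') (c + c') != 0).
  rewrite -ptD; congr (~~ _); apply/eqP/eqP => [->|h]; first exact: F2_addxx.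
  by rewrite -[LHS]addr0 -(F2_addxx (pt a' b' c')) addrA h add0r.
have line a b c a' b' c' : pt a b c != 0 -> pt a' b' c' != 0 -> pt a b c != pt a' b' c' ->
   ~~ [&& a == 1, b == 1 & c == 1] -> ~~ [&& a' == 1, b' == 1 & c' == 1] ->
   ~~ [&& a + a' == 1, b + b' == 1 & c + c' == 1] -> (dirder (pt a' b' c') g).@[(pt a b c) 0] = 1.
  move=> h1 h2 h3 /negbTE k1 /negbTE k2 /negbTE k3; apply: plane_cubic_line.
  - exact: indep2.
  - by rewrite /pt gE k1.
  - by rewrite /pt gE k2.
  - by rewrite ptD /pt gE k3.
(* The values at the eight rational vectors follow from lines consisting of zeros when (b, c) is not
   (1, 1), and from the Taylor expansion when b = c = 1. *)
have val a b c : (dirder e1 g).@[(pt a b c) 0] = b ^+ 2 + b * c + c ^+ 2.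
  have g1 : g.@[e1 0] = 0 by rewrite e1E /pt gE n01 !andbF.
  have d0 : (dirder e1 g).@[(0 : 'rV[F]_3) 0] = 0.
    by apply: (meval_homog0 (dhomog_dirder e1 hg)).
  have d11 : (dirder e1 g).@[e1 0] = 0 by rewrite cubic_three.
  have d12 : (dirder e2 g).@[e1 0] = 1.
    by rewrite e1E e2E line // ?ptne ?pt0 ?two ?addr0 ?add0r ?n01 ?oner_eq0 ?eqxx //= ?oner_eq0.
  have d13 : (dirder e3 g).@[e1 0] = 1.
    by rewrite e1E e3E line // ?ptne ?pt0 ?two ?addr0 ?add0r ?n01 ?oner_eq0 ?eqxx //= ?oner_eq0.
  have dl a' : (dirder (pt a' 1 1) g).@[e1 0] = 0.
    by rewrite /pt dirder_linl d11 mulr0 add0r dirder_linl d12 scale1r d13 mulr1 two.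
  have gt a' : (dirder e1 g).@[(pt a' 1 1) 0] = 1.
    have := cubic_taylor (pt a' 1 1) e1 hg; rewrite dl g1 !addr0 {1}e1E ptD !addr0.
    have gp t : g.@[(pt t 1 1) 0] = (t == 1)%:R by rewrite /pt gE eqxx !andbT.
    rewrite !gp; case: (F2_cases a') => ->; rewrite ?two ?add0r ?n01 ?eqxx /=.
      by rewrite add0r => <-.
    by move=> /esym/eqP; rewrite addr_eq0 => /eqP h; rewrite -[LHS]opprK -h oppr_pchar2 ?F2_pchar.
  case: (F2_cases b) => ->; case: (F2_cases c) => ->.
  - rewrite !expr0n mulr0 !addr0 /pt !scale0r !addr0.
    by case: (F2_cases a) => ->; rewrite ?scale0r ?scale1r.
  - rewrite expr0n mul0r !add0r expr1n {1}e1E.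
    by case: (F2_cases a) => ->; rewrite line // ?ptne ?pt0 ?two ?addr0 ?add0r ?n01 ?oner_eq0 ?eqxx //= ?oner_eq0.
  - rewrite expr0n mulr0 !addr0 expr1n {1}e1E.
    by case: (F2_cases a) => ->; rewrite line // ?ptne ?pt0 ?two ?addr0 ?add0r ?n01 ?oner_eq0 ?eqxx //= ?oner_eq0.
  - by rewrite gt expr1n mulr1 two add0r.
pose E : 'M[F]_(1 + (1 + 1), 3) := col_mx e1 (col_mx e2 e3).
pose p : {mpoly F[1 + (1 + 1)]} := restrict E (dirder e1 g)
   - ('X_1 ^+ 2 + 'X_1 * 'X_(1 + 1) + 'X_(1 + 1) ^+ 2).
have hX (i : 'I_(1 + (1 + 1))) : ('X_i : {mpoly F[_]}) \is 1.-homog by rewrite dhomogX /= mdeg1.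
have hp : p \is 2.-homog.
  apply: rpredB; first exact: dhomog_restrict (dhomog_dirder _ hg).
  by apply: dhomogD; [apply: dhomogD|]; rewrite ?expr2; apply: (@dhomogM _ _ _ 1 _ 1).
(* A quadratic form vanishing at all rational vectors is zero since 2 <= q; this carries the formula
   over to K. *)
have p0 : p = 0.
  apply: (vanishing_homog_eq0 hp) => [v|]; last by rewrite F2.
  rewrite mevalB !mevalD !mevalM ?rmorphXn /= !mevalXU meval_restrict.
  rewrite -{1}[v]hsubmxK mul_row_col -[rsubmx v]hsubmxK mul_row_col.
  rewrite (mx11_scalar (lsubmx v)) (mx11_scalar (lsubmx (rsubmx v))) (mx11_scalar (rsubmx (rsubmx v))).
  rewrite !mul_scalar_mx -/(pt _ _ _) val !mxE; apply/eqP; rewrite subr_eq0; apply/eqP.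
  by congr (_ ^+ 2 + _ * _ + _ ^+ 2); congr (v 0 _); apply: val_inj.
have := congr1 (fun r => (map_mpoly iota r).@[(row_mx x%:M (row_mx y%:M z%:M)) 0]) p0.
rewrite raddf0 meval0 raddfB /= mevalB map_restrict meval_restrict -dirder_map_mpoly.
rewrite !map_col_mx !mul_row_col !mul_scalar_mx => /eqP; rewrite subr_eq0 => /eqP ->.
rewrite !raddfD /= !rmorphM ?rmorphXn /= !map_mpolyX.
rewrite ?mevalD ?mevalM ?rmorphXn /= !mevalXU.
have -> : (1 : 'I_(1 + (1 + 1))) = rshift 1 (lshift 1 (0 : 'I_1)) by apply: val_inj.
have -> : (rshift 1 (lshift 1 (0 : 'I_1)) + rshift 1 (lshift 1 (0 : 'I_1)) : 'I_(1 + (1 + 1)))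
   = rshift 1 (rshift 1 (0 : 'I_1)) by apply: val_inj.
by rewrite !row_mxEr row_mxEl !mxE eqxx !mulr1n.
Qed.

(** Otherwise at most one of the eight vectors is not a zero. If there is none, the derivatives at
    one coordinate vector along the two others and along their sum all equal 1, but 1 + 1 = 0. If
    there is exactly one, [cubic_slope] yields a singular point. *)
Lemma plane_cubic_bound : (#|zeros g| <= 6)%N.
Proof.
rewrite leqNgt; apply/negP => big.
have card8 := cardsC (zeros g); rewrite (card_rV F2) in card8.
have nz1 : (#|~: zeros g| <= 1)%N by move: big card8; move: #|_| #|_| => a b; lia.
have [Z0|[M]] := set_0Vmem (~: zeros g).
  have g0 (v : 'rV[F]_3) : g.@[v 0] = 0.
    have : v \notin ~: zeros g by rewrite Z0 inE.
    by rewrite !inE negbK => /eqP.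
  have n10 : (1 == 0 :> F) = false by apply/negbTE/oner_neq0.
  have b (i j : 'I_3) : i != j -> (dirder (delta_mx 0 j) g).@[(delta_mx 0 i : 'rV_3) 0] = 1.
    move=> ij; apply: plane_cubic_line => //; apply: indep2.
    - by apply/eqP => /rowP/(_ i)/eqP; rewrite !mxE !eqxx n10.
    - by apply/eqP => /rowP/(_ j)/eqP; rewrite !mxE !eqxx n10.
    - by apply/eqP => /rowP/(_ i)/eqP; rewrite !mxE !eqxx (negbTE ij) n10.
  pose e (i : 'I_3) : 'rV[F]_3 := delta_mx 0 i.
  have : (dirder (e 1 + e (1 + 1)) g).@[(e 0) 0] = 1.
    apply: plane_cubic_line => //; apply: indep2.
    - by apply/eqP => /rowP/(_ 0)/eqP; rewrite !mxE n10.
    - by apply/eqP => /rowP/(_ 1)/eqP; rewrite !mxE /= addr0 n10.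
    - by apply/eqP => /rowP/(_ 0)/eqP; rewrite !mxE /= addr0 n10.
  rewrite -[e 1]scale1r dirder_linl !b // mul1r addrr_pchar2 ?F2_pchar // => /esym/eqP.
  by rewrite n10.
rewrite !inE => gM.
have gE (v : 'rV[F]_3) : g.@[v 0] = (v == M)%:R.
  have [->|vM] := eqVneq v M; first exact: F2_neq0.
  apply/eqP; apply: contraTT nz1 => gv; rewrite -ltnNge.
  by apply/card_gt1P; exists v, M; rewrite !inE.
have M0 : M != 0 by apply: contra gM => /eqP ->; rewrite (meval_homog0 hg).
have rM : row_free M by rewrite /row_free rank_rV M0.
have [X rX] := @row_free_extend F 1 2 3 M rM erefl.
(* A basis in which the only vector off the curve is M = e1 + e2 + e3; this condition is symmetric
   under cyclic permutations. *)
pose e1 := row 0 X; pose e2 := row 1 X; pose e3 := M + e1 + e2.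
have ind (x y z : F) : x *: e1 + (y *: e2 + z *: e3) = 0 -> [/\ x = 0, y = 0 & z = 0].
  have -> : x *: e1 + (y *: e2 + z *: e3) =
      row_mx z%:M (\row_(i < 2) (if i == 0 then x + z else y + z)) *m col_mx M X.
    rewrite mul_row_col mul_scalar_mx mulmx_sum_row !big_ord_recl big_ord0 addr0 !mxE /=.
    rewrite /e3 /e1 /e2 (_ : 1 = lift ord0 ord0); last exact: val_inj.
    move: (row ord0 X) (row (lift ord0 ord0) X) => r0 r1.
    by apply/rowP => i; rewrite !mxE; ring.
  move/eqP; rewrite row_free_mul_eq0 // => /eqP h.
  have z0 : z = 0.
    have := congr1 (fun w : 'rV_(1 + 2) => (lsubmx w) 0 0) h.
    by rewrite row_mxKl linear0 !mxE eqxx mulr1n.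
  have := congr1 (@rsubmx F 1 1 2) h; rewrite row_mxKr linear0 z0 => /rowP r.
  by have := r 0; have := r 1; rewrite !mxE /= !addr0 => -> ->.
have MM : M = e1 + (e2 + e3).
  by rewrite /e3 [e2 + _]addrC -addrA F2_addxx addr0 addrC -addrA F2_addxx addr0.
have gpt x y z : g.@[(x *: e1 + (y *: e2 + z *: e3)) 0] = ([&& x == 1, y == 1 & z == 1])%:R.
  rewrite gE; congr ((nat_of_bool _)%:R); apply/eqP/and3P => [|[/eqP-> /eqP-> /eqP->]]; last first.
    by rewrite !scale1r.
  rewrite MM => /eqP; rewrite -subr_eq0 => /eqP h.
  have [/eqP h1 /eqP h2 /eqP h3] : [/\ x - 1 = 0, y - 1 = 0 & z - 1 = 0].
    apply: ind; rewrite -[RHS]h; move: (e1) (e2) (e3) => r1 r2 r3.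
    by apply/rowP => i; rewrite !mxE; ring.
  by rewrite -!(subr_eq0 _ 1) h1 h2 h3.
have s1 := cubic_slope ind gpt.
have s2 := @cubic_slope e2 e3 e1 _ _.
have s3 := @cubic_slope e3 e1 e2 _ _.
have perm (V : zmodType) (a b c : V) : a + (b + c) = b + (c + a) by rewrite addrC addrA.
have {}s2 : forall x y z : K, (dirder (map_mx iota e2) gK).@[(x *: map_mx iota e1 +
     (y *: map_mx iota e2 + z *: map_mx iota e3)) 0] = z ^+ 2 + z * x + x ^+ 2.
  move=> x y z; rewrite perm; apply: s2 => a b c.
    by rewrite -perm => /ind[].
  by rewrite -perm gpt andbC -andbA.
have {}s3 : forall x y z : K, (dirder (map_mx iota e3) gK).@[(x *: map_mx iota e1 +
     (y *: map_mx iota e2 + z *: map_mx iota e3)) 0] = x ^+ 2 + x * y + y ^+ 2.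
  move=> x y z; rewrite perm perm; apply: s3 => a b c.
    by rewrite perm => /ind[].
  by rewrite perm gpt andbA andbC.
have [w /rootP hw] : exists w : K, root ('X^2 + 'X + 1%:P) w.
  by apply/closed_rootP; rewrite -addrA size_polyDl size_polyXn // size_XaddC.
have {}hw : w ^+ 2 + w + 1 = 0 by rewrite -[RHS]hw !hornerE.
pose P := 1 *: map_mx iota e1 + (w *: map_mx iota e2 + w ^+ 2 *: map_mx iota e3).
pose E : 'M[K]_(1 + (1 + 1), 3) := col_mx (map_mx iota e1) (col_mx (map_mx iota e2) (map_mx iota e3)).
have rE : row_free E.
  rewrite /E -!map_col_mx /row_free mxrank_map; apply: row_free_ker => v.
  rewrite -[v]hsubmxK mul_row_col -[rsubmx v]hsubmxK mul_row_col.
  rewrite (mx11_scalar (lsubmx v)) (mx11_scalar (lsubmx (rsubmx v))) (mx11_scalar (rsubmx (rsubmx v))).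
  by rewrite !mul_scalar_mx => /ind[-> -> ->]; rewrite !raddf0 !row_mx0.
have PE : P = row_mx 1%:M (row_mx w%:M (w ^+ 2)%:M) *m E.
  by rewrite !mul_row_col !mul_scalar_mx.
have P0 : P != 0.
  rewrite PE row_free_mul_eq0 //; apply/eqP => /(congr1 (fun v => (lsubmx v) 0 0)).
  by rewrite row_mxKl linear0 !mxE eqxx mulr1n => /eqP; rewrite oner_eq0.
have grad : gradient gK P = 0.
  apply: (gradient_full_eq0 rE) => //.
  have D v : v *m gradient gK P = ((dirder v gK).@[P 0])%:M by rewrite gradientE -mx11_scalar.
  rewrite /E !mul_col_mx !D s1 s2 s3.
  have -> : w ^+ 2 + w * w ^+ 2 + (w ^+ 2) ^+ 2 = w ^+ 2 * (w ^+ 2 + w + 1) by ring.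
  have -> : (w ^+ 2) ^+ 2 + w ^+ 2 * 1 + 1 ^+ 2 = (w ^+ 2 - w + 1) * (w ^+ 2 + w + 1) by ring.
  have -> : 1 ^+ 2 + 1 * w + w ^+ 2 = w ^+ 2 + w + 1 by ring.
  by rewrite hw !mulr0 raddf0 !col_mx0.
have gP : gK.@[P 0] = 0.
  have := euler_homog P (dhomog_map_mpoly iota hg).
  rewrite -/gK gradientE grad mulmx0 mxE -[3%N]/(2 + 1)%N natrD (pcharf0 K_pchar) add0r mul1r.
  by move=> <-.
by have := nonsingular_gradient ns P0 gP; rewrite -/gK grad eqxx.
Qed.
End PlaneCubic.
End Binary.

(** * Cubic threefolds over the field with two elements *)

Section BinaryThreefold.
Variable F : finFieldType.
Hypothesis F2 : #|F| = 2.
Variables (K : closedFieldType) (iota : {rmorphism F -> K}) (f : {mpoly F[5]}).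
Hypotheses (hf : f \is 3.-homog) (ns : nonsingular iota f).

Local Notation Z := (~: zeros f).

Lemma binary_value (v : 'rV[F]_5) : f.@[v 0] = (v \in Z)%:R.
Proof.
rewrite !inE; case: eqP => [->//|/eqP h]; exact: F2_neq0.
Qed.

(** The i-th coordinate is the sum of the values of x_i f, a form of degree 4 < 5; the values of f
    are 0 and 1. *)
Lemma sum_nonzeros : \sum_(v in Z) v = 0 :> 'rV[F]_5.
Proof.
apply/rowP => i; rewrite summxE mxE.
have hp : 'X_i * f \is (1 + 3).-homog by apply: dhomogM hf; rewrite dhomogX /= mdeg1.
rewrite -[RHS](sum_meval F2 hp isT) big_mkcond /=; apply: eq_bigr => v _.
by rewrite mevalM mevalXU binary_value; case: (v \in Z); rewrite ?mulr1 ?mulr0.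
Qed.

Lemma nonzeros_even : (2 %| #|Z|)%N.
Proof.
rewrite (dvdn_pcharf (F2_pchar F2)) -(sum_meval F2 hf isT) -sum1_card natr_sum big_mkcond /=.
by apply/eqP; apply: eq_bigr => v _; rewrite binary_value; case: (v \in Z).
Qed.

Lemma card_gt0_split (T : finType) (A : {set T}) : (0 < #|A|)%N ->
  exists2 a, a \in A & #|A :\ a| = #|A|.-1.
Proof. by case/card_gt0P => a aA; exists a; rewrite // (cardsD1 a A) aA. Qed.

(** The number is even and positive, and it is not 2: two vectors with sum zero would be equal. *)
Lemma nonzeros_gt2 : (3 < #|Z|)%N.
Proof.
have [v fv] := not_all_zeros F2 hf ns.
have Z0 : (0 < #|Z|)%N by apply/card_gt0P; exists v; rewrite !inE.
rewrite ltnNge; apply/negP => Z3; have Z2 : #|Z| = 2.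
  by case/dvdnP: nonzeros_even => k hk; move: Z0 Z3; rewrite hk; case: k {hk} => [|[|]].
have /eqP/cards2P[a [b [ab ZE]]] := Z2.
have := sum_nonzeros; rewrite ZE big_setU1 ?inE //= big_set1 => /eqP.
rewrite addr_eq0 => /eqP abE; case/eqP: ab; rewrite abE.
by apply/eqP; rewrite eq_sym -addr_eq0 F2_addxx.
Qed.

(** If the four vectors are a, b, c, d, then a + b = c + d, and translation by this sum exchanges a
    with b and c with d. *)
Lemma nonzeros_translation : #|Z| = 4 ->
  exists2 P : 'rV[F]_5, P != 0 & forall y : 'rV[F]_5, f.@[(y + P) 0] = f.@[y 0].
Proof.
move=> Z4.
have [|a aZ Za] := @card_gt0_split _ Z; first by rewrite Z4.
rewrite Z4 in Za; have [|b bZ Zb] := @card_gt0_split _ (Z :\ a); first by rewrite Za.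
rewrite Za in Zb; have [|c cZ Zc] := @card_gt0_split _ (Z :\ a :\ b); first by rewrite Zb.
rewrite Zb in Zc; have [|d dZ Zd] := @card_gt0_split _ (Z :\ a :\ b :\ c); first by rewrite Zc.
rewrite Zc /= in Zd; have Zd0 : Z :\ a :\ b :\ c :\ d = set0 by apply/eqP; rewrite -cards_eq0 Zd.
have := sum_nonzeros; rewrite (big_setD1 a) // (big_setD1 b) // (big_setD1 c) // (big_setD1 d) //=.
rewrite Zd0 big_set0 addr0 => S0.
have two := F2_addxx F2.
have sw (x y : 'rV[F]_5) : x + y = 0 -> x = y by move=> h; rewrite -[x]addr0 -(two _ y) addrA h add0r.
have cd : c + d = a + b.
  by apply/esym/sw; rewrite -addrA.
have Zcases v : v \in Z -> [\/ v = a, v = b, v = c | v = d].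
  move=> vZ; have : v \notin Z :\ a :\ b :\ c :\ d by rewrite Zd0 inE.
  rewrite !in_setD1 vZ andbT !negb_and !negbK.
  by case/or4P => /eqP ->; [constructor 4|constructor 3|constructor 2|constructor 1].
have [bZ' ba] : b \in Z /\ b != a by move: bZ; rewrite in_setD1 => /andP[].
have cZ' : c \in Z by move: cZ; rewrite !in_setD1 => /and3P[].
have dZ' : d \in Z by move: dZ; rewrite !in_setD1 => /and4P[].
have tr v : v \in Z -> v + (a + b) \in Z.
  case/Zcases => ->.
  - by rewrite addrA two add0r.
  - by rewrite [a + b]addrC addrA two add0r.
  - by rewrite -cd addrA two add0r.
  - by rewrite -cd [c + d]addrC addrA two add0r.
exists (a + b) => [|y].
  by apply: contra ba => /eqP /sw ->.
rewrite !binary_value; congr ((nat_of_bool _)%:R); apply/idP/idP; last exact: tr.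
by move/tr; rewrite -addrA two addr0.
Qed.

(** Of the 32 vectors at least 4 are off the threefold. With exactly 4, the translation vector P is
    the vertex of the cone. *)
Lemma binary_cubic_threefold :
  (#|zeros f| <= 28)%N /\
  (#|zeros f| = 28 ->
   exists (P : 'rV[F]_5) (U : 'M[F]_(3, 5)),
     [/\ P != 0, f.@[P 0] = 0, tangent_section_cone f P U,
         hypersurface 3 (restrict U f) /\ nonsingular iota (restrict U f)
       & #|zeros (restrict U f)| = 6]).
Proof.
have tot := cardsC (zeros f); rewrite (card_rV F2) /= in tot.
have gt := nonzeros_gt2.
split=> [|z28].
  by move: tot gt; rewrite (_ : 2 ^ 5 = 32)%N //; move: #|_| #|_| => x y; lia.
have Z4 : #|Z| = 4.
  by move: tot; rewrite z28 (_ : 2 ^ 5 = 32)%N //; move: #|_| => x; lia.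
have [P P0 trP] := nonzeros_translation Z4.
have fP : f.@[P 0] = 0.
  by rewrite -[P]add0r trP (meval_homog0 hf).
(* The expansion of f(y + P) = f(y) shows that for y tangent at P the derivative at y along P
   vanishes. This yields the condition on derivatives required in degree 3 = q + 1. *)
have d2 y : (dirder y f).@[P 0] = 0 -> (dirder P f).@[y 0] = 0.
  move=> dy; have := cubic_taylor y P hf; rewrite trP dy fP !addr0.
  by move/eqP; rewrite -subr_eq0 opprD addrA subrr add0r oppr_eq0 => /eqP.
have d0 y : (dirder y f).@[(0 : 'rV[F]_5) 0] = 0 by apply: (meval_homog0 (dhomog_dirder y hf)).
have slopes m (U : 'M[F]_(m, 5)) (i : 'I_(1 + m)) (y : 'rV[F]_(1 + m)) :
    (forall x, (dirder (x *m (col_mx P U)) f).@[P 0] = 0) ->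
    (dirder y (restrict (col_mx P U) f)).@[(delta_mx 0 i : 'rV_(1 + m)) 0]
    - (dirder y (restrict (col_mx 0 U) f)).@[(delta_mx 0 i : 'rV_(1 + m)) 0] = 0.
  move=> tan.
  apply: etrans (congr2 (fun a b => a - b) (dirder_restrict _ _ _ _) (dirder_restrict _ _ _ _)) _.
  case: (split_ordP i) => k ->.
    rewrite delta_mx_lshift !mul_row_col !mul0mx !mulmx0 !addr0 d0 subr0.
    move: (delta_mx 0 k : 'rV[F]_1) => w; rewrite (mx11_scalar w) mul_scalar_mx.
    by case: (F2_cases F2 (w 0 0)) => ->; rewrite ?scale0r ?scale1r ?d0 ?tan.
  rewrite delta_mx_rshift !mul_row_col !mul0mx !add0r -[y]hsubmxK !mul_row_col mulmx0 add0r.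
  rewrite (mx11_scalar (lsubmx y)) mul_scalar_mx dirder_linl d2 ?mulr0 ?add0r ?subrr //.
  have := tan (row_mx 0 (delta_mx 0 k)).
  by rewrite mul_row_col mul0mx add0r.
have [|U [tsc [hU nsU] cU]] := cone_output F2 hf ns isT P0 fP.
  move=> U /andP[PUT _]; apply/eqP; rewrite -subr_eq0; apply/eqP.
  have tan x : (dirder (x *m (col_mx P U)) f).@[P 0] = 0.
    have /sub_kermxP h : (x *m col_mx P U <= tangent_space f P)%MS by rewrite (submx_trans (submxMl _ _)).
    by rewrite gradientE h mxE.
  apply: (vanishing_homog_eq0_succ (d := 3)); rewrite ?F2 //.
  - by rewrite rpredB // dhomog_restrict.
  - move=> v; rewrite mevalB !meval_restrict -(@hsubmxK F 1 1 3 v) !(@mul_row_col _ 1 1 3).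
    rewrite mulmx0 add0r (mx11_scalar (lsubmx _)) mul_scalar_mx.
    case: (F2_cases F2 (lsubmx (v : 'rV_(1 + 3)) 0 0)) => ->; first by rewrite scale0r add0r subrr.
    by rewrite scale1r [P + _]addrC trP subrr.
  - by move=> i j; rewrite -[- restrict _ _]scaleN1r dirderD dirderZ mevalD mevalZ mulN1r; apply: slopes.
(* Of the 16 vectors of T_P at most 4 are off the threefold, so the cone has at least 12 and its
   base at least 6; [plane_cubic_bound] is the opposite inequality. *)
exists P, U; split=> //; apply/eqP; rewrite eqn_leq (plane_cubic_bound F2 hU.2 nsU) /= -(@leq_pmul2r 2) //.
rewrite cU; set A := [set v | _].
have gP := nonsingular_gradient_base ns P0 fP.
have cT := card_ker F2 gP.
have sub : [set v : 'rV[F]_5 | v *m gradient f P == 0] \subset A :|: Z.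
  apply/subsetP => v; rewrite !inE gradientE => /eqP ->; rewrite mxE eqxx andbT.
  exact: orbN.
have := subset_leq_card sub; have [le _] := leq_card_setU A Z; move: le cT; rewrite Z4.
by rewrite (_ : 2 ^ 5 = 32)%N //; move: #|_| #|_| #|A| => x y z; lia.
Qed.
End BinaryThreefold.

(** * The three ranges of the degree, and the passage from vectors to points *)

Lemma zeros_bound (F : finFieldType) (K : closedFieldType) (iota : {rmorphism F -> K})
    (q : nat) (Fq : #|F| = q) (e : nat) (e0 : (0 < e)%N) (f : {mpoly F[5]})
    (hf : f \is e.+1.-homog) (ns : nonsingular iota f) :
  (#|zeros f| <= q ^ 2 + e * q * (q ^ 3 - q))%N /\
  (#|zeros f| = (q ^ 2 + e * q * (q ^ 3 - q))%N ->
   exists (P : 'rV[F]_5) (U : 'M[F]_(3, 5)),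
     [/\ P != 0, f.@[P 0] = 0, tangent_section_cone f P U,
         hypersurface e.+1 (restrict U f) /\ nonsingular iota (restrict U f)
       & #|zeros (restrict U f)| = (q + e * (q ^ 2 - q))%N]).
Proof.
have q1 := q_gt1 Fq; have q0 : (0 < q)%N by apply: ltnW.
have strict : (#|zeros f| < q ^ 2 + e * q * (q ^ 3 - q))%N ->
    (#|zeros f| <= q ^ 2 + e * q * (q ^ 3 - q))%N /\
    (#|zeros f| = (q ^ 2 + e * q * (q ^ 3 - q))%N -> False).
  by move=> lt; split; [exact: ltnW | move=> h; rewrite h ltnn in lt].
case: (ltngtP e q) => [eq|eq|eq].
- exact: small_degree_bound.
- have [|le nh] := strict; last by split.
  (* For e > q the bound exceeds the total number q^5 of vectors. *)
  apply: leq_ltn_trans (max_card _) _; rewrite (card_rV Fq).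
  have q5 : (q ^ 5 = q * q * (q * (q * q - 1) + q))%N.
    by rewrite -[X in (_ + X)%N]muln1 -mulnDr subnK ?muln_gt0 ?q0 // !expnS expn0 muln1 !mulnA.
  have c3 : (q ^ 3 - q = q * (q * q - 1))%N by rewrite mulnBr muln1 !expnS expn0 muln1.
  have le_q : (q <= q * q - 1)%N by rewrite leq_subRL ?muln_gt0 ?q0 // add1n ltn_Pmull // ltnW.
  rewrite q5 c3; move: (q * q - 1)%N le_q => a qa.
  have m : (q.+1 * q * (q * a) <= e * q * (q * a))%N by rewrite !leq_mul2r eq !orbT.
  apply: (@leq_ltn_trans (q.+1 * q * (q * a))).
    have -> : (q.+1 * q * (q * a) = q * q * (q * a + a))%N by ring.
    by rewrite leq_mul2l leq_add2l qa orbT.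
  by rewrite (leq_ltn_trans m) // -[X in (X < _)%N]add0n ltn_add2r expn_gt0 ltnW.
- rewrite eq in hf strict *; case: (ltnP 2 q) => q2.
    have := large_degree_bound Fq hf ns q2 => lt.
    by have [|le nh] := strict; [exact: lt | split].
  have q2E : q = 2 by lia.
  by move: hf Fq; rewrite q2E => hf' F2; apply: binary_cubic_threefold F2 _ _ _ hf' ns.
Qed.

Theorem theorem1 (F : finFieldType) (Fbar : closedFieldType)
    (iota : {rmorphism F -> Fbar}) (hFbar : algebraic_closure iota)
    (q : nat) (hq : #|F| = q) (d : nat) (hd : (2 <= d)%N)
    (f : {mpoly F[5]}) (hf : hypersurface d f) (hns : nonsingular iota f) :
  let theta := ((d - 1) * q ^ 2 * (q + 1) + (q + 1))%N in
  (num_points f <= theta)%N /\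
  (num_points f = theta ->
   exists (P : 'rV[F]_5) (U : 'M[F]_(3, 5)),
     [/\ P != 0, f.@[P 0] = 0, tangent_section_cone f P U,
         hypersurface d (restrict U f) /\ nonsingular iota (restrict U f)
       & num_points (restrict U f) = ((d - 1) * q + 1)%N]).
Proof.
case: hf => _ hf; have q1 := q_gt1 hq; have q0 : (0 < q.-1)%N by rewrite -subn1 subn_gt0.
case: d hd hf => // e e0 hf; rewrite subn1 /=; set theta := (_ + _)%N.
have [le eqc] := zeros_bound hq (e0 : (0 < e)%N) hf hns.
(* A number N of points corresponds to N (q - 1) + 1 vectors. *)
have thetaE : (theta * q.-1 + 1 = q ^ 2 + e * q * (q ^ 3 - q))%N.
  rewrite /theta; case: (q) q1 => // r _ /=.
  have -> : (r.+1 ^ 3 = r.+1 + r.+1 * (r * (r + 2)))%N by rewrite !expnS expn0; ring.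
  by rewrite addKn !expnS expn0; ring.
have NE := num_pointsE hq hf (ltn0Sn e).
split.
  by rewrite -(leq_pmul2r q0) -(leq_add2r 1) NE thetaE.
move=> Nt; have [|P [U [P0 fP cone [hU nsU] cU]]] := eqc; first by rewrite -NE Nt thetaE.
exists P, U; split=> //.
(* The same conversion for the curve: ((d - 1) q + 1)(q - 1) + 1 = q + e (q^2 - q), with e = d -
   1. *)
have := num_pointsE hq hU.2 (ltn0Sn e); rewrite cU => h.
apply/eqP; rewrite -(eqn_pmul2r q0) -(eqn_add2r 1) h; apply/eqP.
case: (q) q1 => // r _ /=.
have -> : (r.+1 ^ 2 = r.+1 + r.+1 * r)%N by rewrite !expnS expn0; ring.
rewrite addKn; ring.
Qed.
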